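(* Let $n \geq 1$, let $\Omega \subset \mathbb{C}^n$ be a Reinhardt domain (not necessarily bounded), and let $f \in \mathcal{A}^{\infty}(\Omega)$. Then the Laurent series $\sum_{\alpha \in \mathbb{Z}^n} c_{\alpha} e_{\alpha}$ of $f$ converges unconditionally to $f$ in the topology of $\mathcal{A}^{\infty}(\Omega)$; that is, for every bijection $\sigma : \mathbb{N} \to \mathbb{Z}^n$, the series $\sum_{j=0}^{\infty} c_{\sigma(j)} e_{\sigma(j)}$ converges to $f$ in the topology of $\mathcal{A}^{\infty}(\Omega)$.
   Context: $\mathbb{N} = \{0,1,2,\dots\}$. A domain is an open connected subset of $\mathbb{C}^n$. A domain $\Omega \subset \mathbb{C}^n$ is a Reinhardt domain if $(\lambda_1 z_1, \dots, \lambda_n z_n) \in \Omega$ whenever $(z_1,\dots,z_n) \in \Omega$ and $|\lambda_j| = 1$ for $j = 1,\dots,n$. For $\alpha \in \mathbb{N}^n$ put $[\alpha] = \sum_{j=1}^n \alpha_j$ and $D^{\alpha} f = \frac{\partial^{[\alpha]} f}{\partial z_1^{\alpha_1} \cdots \partial z_n^{\alpha_n}}$. $\mathcal{A}^{\infty}(\Omega)$ is the space of holomorphic functions on $\Omega$ smooth up to the boundary, i.e. holomorphic functions $f$ on $\Omega$ such that $D^{\alpha} f$ extends continuously to $\overline{\Omega}$ for every $\alpha \in \mathbb{N}^n$. Topology of $\mathcal{A}^{\infty}(\Omega)$: convergence $f_j \to f$ means that for every compact $K \subset \overline{\Omega}$, $f_j \to f$ uniformly on $K$ along with all partial derivatives.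 Equivalently, if $\Omega$ is bounded, the topology is generated by the seminorms $\|f\|_{k,\Omega} = \sup\{|D^{\alpha} f(z)| : z \in \Omega,\ [\alpha] \leq k\}$, $k \in \mathbb{N}$; if $\Omega$ is unbounded, it is generated by the seminorms $\|f\|_{k,\Omega_m} = \sup\{|D^{\alpha} f(z)| : z \in \Omega_m,\ [\alpha] \leq k\}$, $k, m \in \mathbb{N}$, where $\Omega_m = \Omega \cap \{z : |z_j| < m \text{ for all } j\}$ (with the supremum over the empty set taken to be $0$). Laurent series: $e_{\alpha}(z) = z^{\alpha} = z_1^{\alpha_1} \cdots z_n^{\alpha_n}$ for $\alpha \in \mathbb{Z}^n$. Every holomorphic function $f$ on a Reinhardt domain $\Omega$ has a unique Laurent series expansion $f = \sum_{\alpha \in \mathbb{Z}^n} c_{\alpha} e_{\alpha}$ converging absolutely and uniformly on compact subsets of $\Omega$; its coefficients are $c_{\alpha} = \frac{1}{(2\pi)^n} \int_0^{2\pi} \cdots \int_0^{2\pi} \frac{f(z_1 e^{i\theta_1}, \dots, z_n e^{i\theta_n})}{z^{\alpha} e^{i(\alpha_1\theta_1 + \cdots + \alpha_n\theta_n)}}\, d\theta_n \cdots d\theta_1$ for any $z \in \Omega$ with all coordinates nonzero. If $\Omega$ meets $\{z_j = 0\}$, then $c_{\alpha} = 0$ whenever $\alpha_j < 0$, and the corresponding term $c_{\alpha} e_{\alpha}$ is understood to be the zero function. *)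

(* Defs.v *)
From HB Require Import structures.
From mathcomp Require Import all_boot all_order all_algebra complex.
From mathcomp Require Import all_classical all_reals all_analysis.

Set Implicit Arguments.
Unset Strict Implicit.
Unset Printing Implicit Defensive.

Import Order.TTheory GRing.Theory Num.Theory.
Import numFieldNormedType.Exports.

Local Open Scope classical_set_scope.
Local Open Scope ring_scope.
Local Open Scope complex_scope.

(* The complex field over R as a numFieldType, so that it carries the library's
   topology and is a normed module over itself: derivatives of functions on
   'rV[Cplx R]_n are complex derivatives. The max norm of 'rV[Cplx R]_n induces
   the usual topology of C^n. *)
Definition Cplx (R : realType) : numFieldType := R[i].

Definition domain (R : realType) (n : nat) (Omega : set 'rV[Cplx R]_n) : Prop :=
  open Omega /\ connected Omega.

Definition reinhardt (R : realType) (n : nat) (Omega : set 'rV[Cplx R]_n) : Prop :=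
  forall lambda z : 'rV[Cplx R]_n,
    (forall j, `|lambda ord0 j| = 1) -> Omega z ->
    Omega (\row_j (lambda ord0 j * z ord0 j)).

Definition holomorphic (R : realType) (n : nat) (Omega : set 'rV[Cplx R]_n)
    (f : 'rV[Cplx R]_n -> Cplx R) : Prop :=
  forall z, Omega z -> differentiable f z.

Definition partial (R : realType) (n : nat) (j : 'I_n)
    (f : 'rV[Cplx R]_n -> Cplx R) : 'rV[Cplx R]_n -> Cplx R :=
  'D_(delta_mx ord0 j) f.

Definition Dmulti (R : realType) (n : nat) (alpha : 'rV[nat]_n)
    (f : 'rV[Cplx R]_n -> Cplx R) : 'rV[Cplx R]_n -> Cplx R :=
  foldr (fun j g => iter (alpha ord0 j) (partial j) g) f (enum 'I_n).

Definition extends_to_closure (R : realType) (n : nat)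
    (Omega : set 'rV[Cplx R]_n) (g : 'rV[Cplx R]_n -> Cplx R) : Prop :=
  exists h : 'rV[Cplx R]_n -> Cplx R,
    {within closure Omega, continuous h} /\ (forall z, Omega z -> h z = g z).

Definition Ainfty (R : realType) (n : nat) (Omega : set 'rV[Cplx R]_n)
    (f : 'rV[Cplx R]_n -> Cplx R) : Prop :=
  holomorphic Omega f /\
  forall alpha : 'rV[nat]_n, extends_to_closure Omega (Dmulti alpha f).

(* When g extends continuously to the closure of Omega, this is, at the points
   of that closure, the value of the (unique) continuous extension. *)
Definition closure_ext (R : realType) (n : nat) (Omega : set 'rV[Cplx R]_n)
    (g : 'rV[Cplx R]_n -> Cplx R) (z : 'rV[Cplx R]_n) : Cplx R :=
  lim (g @ within Omega (nbhs z)).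

(* Convergence of a sequence in A^infty(Omega): uniform convergence, on every
   compact subset of the closure of Omega, of all the partial derivatives
   (extended to the closure). Elements of A^infty(Omega) are represented by
   total functions, of which only the values on Omega matter. *)
Definition cvg_Ainfty (R : realType) (n : nat) (Omega : set 'rV[Cplx R]_n)
    (u : nat -> 'rV[Cplx R]_n -> Cplx R) (f : 'rV[Cplx R]_n -> Cplx R) : Prop :=
  [/\ forall N, Ainfty Omega (u N),
      Ainfty Omega f &
      forall K : set 'rV[Cplx R]_n, compact K -> K `<=` closure Omega ->
      forall alpha : 'rV[nat]_n,
        {uniform K, (fun N => closure_ext Omega (Dmulti alpha (u N))) @ \oo
                    --> closure_ext Omega (Dmulti alpha f)}].

(* With the convention 0^-1 = 0, the value at a point with z_j = 0 and
   alpha_j < 0 is 0. *)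
Definition monomial (R : realType) (n : nat) (alpha : 'rV[int]_n)
    (z : 'rV[Cplx R]_n) : Cplx R :=
  \prod_(j < n) z ord0 j ^ alpha ord0 j.

Definition expi (R : realType) (t : R) : Cplx R := cos t +i* sin t.

Definition Cintegral (R : realType) (a b : R) (g : R -> Cplx R) : Cplx R :=
  Rintegral lebesgue_measure `[a, b] (fun t => complex.Re (g t)) +i*
  Rintegral lebesgue_measure `[a, b] (fun t => complex.Im (g t)).

(* The iterated integral over [0, 2 pi]^n; the outermost integral is in the
   first coordinate of theta. *)
Fixpoint torus_integral (R : realType) (n : nat) :
    ('rV[R]_n -> Cplx R) -> Cplx R :=
  match n with
  | 0 => fun g => g 0
  | m.+1 => fun g =>
      Cintegral 0 (2 * pi)
        (fun t => torus_integral
          (fun theta : 'rV[R]_m => g (row_mx (const_mx t : 'rV_1) theta)))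
  end.

Definition laurent_coef (R : realType) (n : nat) (f : 'rV[Cplx R]_n -> Cplx R)
    (z : 'rV[Cplx R]_n) (alpha : 'rV[int]_n) : Cplx R :=
  ((2 * pi) ^+ n)^-1%:C *
  torus_integral (fun theta : 'rV[R]_n =>
    f (\row_j (z ord0 j * expi (theta ord0 j))) /
    (monomial alpha z *
     expi (\sum_(j < n) (alpha ord0 j)%:~R * theta ord0 j))).

(* Main.v *)
(* On a Reinhardt domain the Laurent term of index a of f is the iterated Fourier
   projection F_a f of f along the n coordinate rotations: F_a f satisfies Euler's
   equations z_j d_j u = a_j u, whose solutions on a connected set are multiples of
   z^a. The projections commute with differentiation up to a shift of the index,
   D^b F_a f = F_(a - b) D^b f, so it suffices to sum, for g = D^b f, the functions
   F_a g. Integrating by parts twice in each coordinate bounds F_a g, uniformly on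
   the points of the domain with bounded coordinates, by a constant times the
   product over j of 1 / |a_j (a_j - 1)|, which is summable over Z^n; the sum is g
   by Fourier inversion in each coordinate. The bounds only involve sup norms of
   derivatives of f, which are finite because these derivatives extend continuously
   to the closure, and the uniform estimates then pass to the closure by
   continuity. *)

Require Import Defs.
From mathcomp Require Import all_boot all_order all_algebra complex.
From mathcomp Require Import all_classical all_reals all_analysis.
From mathcomp Require Import ring lra zify.

Set Implicit Arguments.
Unset Strict Implicit.
Unset Printing Implicit Defensive.

Import Order.TTheory GRing.Theory Num.Theory.
Import numFieldNormedType.Exports.

Local Open Scope classical_set_scope.
Local Open Scope ring_scope.
Local Open Scope complex_scope.

(** * Complex-valued functions of a real variable *)

(** Two obstacles shape the argument. At points with a zero coordinate one cannot divide by z_j, and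
    the closure may touch a hyperplane z_j = 0 that the domain avoids (as for the Hartogs triangle),
    so a monomial with negative exponents may be unbounded near the boundary. Everything therefore
    runs on the projections. They are averages over rotations, and the closure is again rotation
    invariant, so they act on continuous functions on the closure; each Laurent term thus inherits
    its boundary extension from f. Euler's equations are kept in multiplied form, valid on the
    hyperplanes as well. Two uses of them bring in z_j^2, so a bound on the coordinates from above
    is enough, and estimates can be made on the rotation invariant pieces cut out by |z_j| < m.

    Summability of the weights does not by itself identify the sum. That is done along the cubes
    |a_j| <= M, to which inversion in one coordinate at a time applies; a finite index set
    containing a large cube then differs from it only by a tail of the weights. Pointwise inversion
    rests on Bessel's inequality and on a divided difference that is continuous because g is
    differentiable. *)

Lemma cvg_near_eq {T : Type} {U : topologicalType} (F : set_system T)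
  {FF : Filter F} (f g : T -> U) (l : U) :
  f @ F --> l -> (\forall x \near F, f x = g x) -> g @ F --> l.
Proof. by move=> fl fg; apply: cvg_trans fl; exact: near_eq_cvg. Qed.

Lemma cvg_to_pair {T : Type} {U1 U2 : topologicalType} (F : set_system T)
  {FF : Filter F} (f : T -> U1) (g : T -> U2) (l1 : U1) (l2 : U2) :
  f @ F --> l1 -> g @ F --> l2 -> (fun x => (f x, g x)) @ F --> (l1, l2).
Proof.
move=> fl gl A [[A1 A2] /= [lA1 lA2] sub].
have hf : \forall x \near F, A1 (f x) := fl _ lA1.
have hg : \forall x \near F, A2 (g x) := gl _ lA2.
have : \forall x \near F, A (f x, g x).
  by apply: filterS2 hf hg => x h1 h2; apply: (sub (f x, g x)).
by [].
Qed.

Definition imC (R : realType) : Cplx R := 0 +i* 1.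

(** The codomain is stated as [Cplx R], the type that carries the topology. *)
Definition rc (R : realType) (x : R) : Cplx R := x%:C.

Section ComplexBasics.
Variable R : realType.
Local Notation C := (Cplx R).
Local Notation Re := (@complex.Re R).
Local Notation Im := (@complex.Im R).

Lemma rcD (x y : R) : rc (x + y) = rc x + rc y.
Proof. exact: (rmorphD (real_complex R)). Qed.
Lemma rcN (x : R) : rc (- x) = - rc x.
Proof. exact: (rmorphN (real_complex R)). Qed.
Lemma rcB (x y : R) : rc (x - y) = rc x - rc y.
Proof. exact: (rmorphB (real_complex R)). Qed.
Lemma rcM (x y : R) : rc (x * y) = rc x * rc y.
Proof. exact: (rmorphM (real_complex R)). Qed.
Lemma rcV (x : R) : rc x^-1 = (rc x)^-1.
Proof. exact: (fmorphV (real_complex R)). Qed.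
Lemma rcX (x : R) n : rc (x ^+ n) = rc x ^+ n.
Proof. exact: (rmorphXn (real_complex R)). Qed.
Lemma rc0 : rc 0 = 0 :> C. Proof. by []. Qed.
Lemma rc1 : rc 1 = 1 :> C. Proof. by []. Qed.
Lemma rc_eq0 (x : R) : (rc x == 0 :> C) = (x == 0).
Proof. by rewrite /rc eq_complex /= eqxx andbT. Qed.
Lemma rc_le (x y : R) : (rc x <= rc y) = (x <= y). Proof. exact: lecR. Qed.
Lemma rc_lt (x y : R) : (rc x < rc y) = (x < y). Proof. exact: ltcR. Qed.
Lemma norm_ReIm (z : C) : `|z| = rc (Num.sqrt ((Re z) ^+ 2 + (Im z) ^+ 2)).
Proof. exact: normc_def. Qed.

(** In the partial order of the complex numbers a positive element is real, so every radius
    occurring in a limit statement over [Cplx R] is the image of a positive real number. *)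
Lemma gt0_Re (e : C) : 0 < e -> 0 < Re e /\ e = rc (Re e).
Proof.
case: e => a b; rewrite [_ < _]ltcE /= => /andP[/eqP -> a0].
by split.
Qed.

Lemma ge0_Re (e : C) : 0 <= e -> 0 <= Re e /\ e = rc (Re e).
Proof.
case: e => a b; rewrite [_ <= _]lecE /= => /andP[/eqP -> a0].
by split.
Qed.

Lemma normC_real (x : R) : `|rc x| = rc (`|x|).
Proof. by rewrite norm_ReIm /= expr0n /= addr0 sqrtr_sqr. Qed.

Lemma Re_le_norm (z : C) : rc (`|Re z|) <= `|z|.
Proof.
rewrite norm_ReIm rc_le -sqrtr_sqr ler_wsqrtr // lerDl sqr_ge0 //.
Qed.

Lemma Im_le_norm (z : C) : rc (`|Im z|) <= `|z|.
Proof.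
rewrite norm_ReIm rc_le -sqrtr_sqr ler_wsqrtr // lerDr sqr_ge0 //.
Qed.

Lemma norm_le_ReIm (z : C) : `|z| <= rc (`|Re z| + `|Im z|).
Proof.
rewrite norm_ReIm rc_le -[leRHS]ger0_norm ?addr_ge0 // -sqrtr_sqr ler_wsqrtr //.
rewrite sqrrD !real_normK ?num_real // addrAC lerDl mulrn_wge0 // mulr_ge0 //.
Qed.

Lemma cReD (a b : C) : Re (a + b) = Re a + Re b.
Proof. by case: a; case: b. Qed.
Lemma cImD (a b : C) : Im (a + b) = Im a + Im b.
Proof. by case: a; case: b. Qed.
Lemma cReB (a b : C) : Re (a - b) = Re a - Re b.
Proof. by case: a; case: b. Qed.
Lemma cImB (a b : C) : Im (a - b) = Im a - Im b.
Proof. by case: a; case: b. Qed.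
Lemma cReM (a b : C) : Re (a * b) = Re a * Re b - Im a * Im b.
Proof. by case: a; case: b. Qed.
Lemma cImM (a b : C) : Im (a * b) = Re a * Im b + Im a * Re b.
Proof. by case: a => a1 a2; case: b => b1 b2 /=; rewrite addrC. Qed.

Lemma cvg_Re (T : Type) (F : set_system T) {FF : Filter F} (f : T -> C) (l : C) :
  f @ F --> l -> (Re \o f) @ F --> Re l.
Proof.
move=> /cvgrPdist_lt h; apply/cvgrPdist_lt => e e0.
have e0' : 0 < rc e by rewrite rc_lt.
apply: filterS (h _ e0') => t /=.
rewrite -cReB => ht; rewrite -rc_lt; exact: le_lt_trans (Re_le_norm _) ht.
Qed.

Lemma cvg_Im (T : Type) (F : set_system T) {FF : Filter F} (f : T -> C) (l : C) :
  f @ F --> l -> (Im \o f) @ F --> Im l.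
Proof.
move=> /cvgrPdist_lt h; apply/cvgrPdist_lt => e e0.
have e0' : 0 < rc e by rewrite rc_lt.
apply: filterS (h _ e0') => t /=.
rewrite -cImB => ht; rewrite -rc_lt; exact: le_lt_trans (Im_le_norm _) ht.
Qed.

Lemma cvg_ReIm (T : Type) (F : set_system T) {FF : Filter F} (f : T -> C) (l : C) :
  (Re \o f) @ F --> Re l -> (Im \o f) @ F --> Im l -> f @ F --> l.
Proof.
move=> /cvgrPdist_lt hr /cvgrPdist_lt hi; apply/cvgrPdist_lt => e /gt0_Re[e0 eE].
have e20 : 0 < Re e / 2 by rewrite divr_gt0.
near=> t.
have h1 : `|Re l - Re (f t)| < Re e / 2 by near: t; exact: hr.
have h2 : `|Im l - Im (f t)| < Re e / 2 by near: t; exact: hi.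
apply: le_lt_trans (norm_le_ReIm _) _.
rewrite eE rc_lt cReB cImB (splitr (Re e)); exact: ltrD.
Unshelve. all: by end_near.
Qed.

Lemma continuous_real_complex : continuous (fun x : R => rc x).
Proof.
move=> x; apply: cvg_ReIm => /=; first exact: cvg_id.
exact: cvg_cst.
Qed.

Lemma expi_continuous : continuous (fun t : R => expi t : C).
Proof.
by move=> t; apply: cvg_ReIm => /=; [exact: continuous_cos|exact: continuous_sin].
Qed.

Lemma expi0 : expi 0 = 1 :> C.
Proof. by rewrite /expi cos0 sin0. Qed.

Lemma expiD (s t : R) : expi (s + t) = expi s * expi t :> C.
Proof.
rewrite /expi cosD sinD; apply/eqP; rewrite eq_complex /= eqxx /=.
by rewrite addrC.
Qed.

Lemma norm_expi (t : R) : `|expi t : C| = 1.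
Proof. by rewrite norm_ReIm /= cos2Dsin2 sqrtr1. Qed.

Lemma expi_neq0 (t : R) : expi t != 0 :> C.
Proof. by rewrite -normr_eq0 norm_expi oner_eq0. Qed.

Lemma expiN (t : R) : expi (- t) = (expi t)^-1 :> C.
Proof.
apply: (mulIf (expi_neq0 t)); rewrite mulVf ?expi_neq0 //.
by rewrite -expiD addNr expi0.
Qed.

Lemma expi_int (k : int) (t : R) : expi (k%:~R * t) = (expi t) ^ k :> C.
Proof.
have h (n : nat) : expi (n%:R * t) = (expi t) ^+ n :> C.
  elim: n => [|n IH]; first by rewrite mul0r expi0.
  by rewrite -natr1 mulrDl mul1r expiD IH exprSr.
case: k => n; first by rewrite -pmulrn h.
by rewrite NegzE rmorphN /= -pmulrn mulNr expiN h exprnN.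
Qed.

Lemma expi_2pi : expi (2 * pi) = 1 :> C.
Proof. by rewrite /expi mulr_natl cos2pi sin2pi. Qed.

End ComplexBasics.

Section RealVariable.
Variable R : realType.
Local Notation C := (Cplx R).
Local Notation Re := (@complex.Re R).
Local Notation Im := (@complex.Im R).

(** Derivative in a real variable: [Cplx R] is a normed module over itself, so the real increment
    enters the quotient as the complex factor [rc h^-1]. *)
Definition rderive (g : R -> C) (t : R) (d : C) :=
  (fun h : R => rc h^-1 * (g (t + h) - g t)) @ 0^' --> d.

Lemma rderive_Re (g : R -> C) t d :
  rderive g t d -> is_derive t (1 : R) (Re \o g) (Re d).
Proof.
move=> gd.
have h : (fun h : R => h^-1 *: (((Re \o g) \o shift t) (h *: 1) - (Re \o g) t))
    @ 0^' --> Re d.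
  apply: cvg_near_eq (cvg_Re gd) _; near=> x.
  by rewrite /= cReM /= mul0r subr0 cReB [in RHS]/GRing.scale /= mulr1 (addrC x).
by split; [apply/cvg_ex; exists (Re d)|exact: cvg_lim].
Unshelve. all: by end_near. Qed.

Lemma rderive_Im (g : R -> C) t d :
  rderive g t d -> is_derive t (1 : R) (Im \o g) (Im d).
Proof.
move=> gd.
have h : (fun h : R => h^-1 *: (((Im \o g) \o shift t) (h *: 1) - (Im \o g) t))
    @ 0^' --> Im d.
  apply: cvg_near_eq (cvg_Im gd) _; near=> x.
  by rewrite /= cImM /= mul0r addr0 cImB [in RHS]/GRing.scale /= mulr1 (addrC x).
by split; [apply/cvg_ex; exists (Im d)|exact: cvg_lim].
Unshelve. all: by end_near. Qed.

Lemma rderive_ReIm (g : R -> C) t (d : C) :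
  is_derive t (1 : R) (Re \o g) (Re d) ->
  is_derive t (1 : R) (Im \o g) (Im d) -> rderive g t d.
Proof.
move=> [dr er] [di ei]; apply: cvg_ReIm => /=.
- rewrite -er; apply: cvg_near_eq dr _; near=> x.
  by rewrite /= cReM /= mul0r subr0 cReB [in LHS]/GRing.scale /= mulr1 (addrC x).
- rewrite -ei; apply: cvg_near_eq di _; near=> x.
  by rewrite /= cImM /= mul0r addr0 cImB [in LHS]/GRing.scale /= mulr1 (addrC x).
Unshelve. all: by end_near. Qed.

Lemma rderive_incr (g : R -> C) t d : rderive g t d ->
  (fun h => g (t + h)) @ 0^' --> g t.
Proof.
move=> gd.
have h : (fun h : R => rc h * (rc h^-1 * (g (t + h) - g t)) + g t) @ 0^'
   --> (rc 0 * d + g t).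
  apply: cvgD; last exact: cvg_cst.
  apply: cvgM gd.
  have := @continuous_real_complex R 0.
  by apply: cvg_trans; apply: cvg_app; exact: cvg_within.
rewrite mul0r add0r in h.
apply: cvg_near_eq h _; near=> x.
have x0 : x != 0 by near: x; exact: nbhs_dnbhs_neq.
by rewrite mulrA -rcM mulfV //= rc1 mul1r subrK.
Unshelve. all: by end_near. Qed.

Lemma rderiveM (g1 g2 : R -> C) t d1 d2 : rderive g1 t d1 -> rderive g2 t d2 ->
  rderive (fun x => g1 x * g2 x) t (d1 * g2 t + g1 t * d2).
Proof.
move=> h1 h2.
have : (fun h : R => rc h^-1 * (g1 (t + h) - g1 t) * g2 (t + h) +
    g1 t * (rc h^-1 * (g2 (t + h) - g2 t))) @ 0^' --> (d1 * g2 t + g1 t * d2).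
  apply: cvgD; first exact: cvgM h1 (rderive_incr h2).
  by apply: cvgM; [exact: cvg_cst|].
move=> h; apply: cvg_near_eq h _; near=> x; ring.
Unshelve. all: by end_near. Qed.

Lemma rderive_cst (a : C) t : rderive (fun=> a) t 0.
Proof.
apply: cvg_near_eq (cvg_cst _) _; near=> x.
by rewrite /cst subrr mulr0.
Unshelve. all: by end_near. Qed.

Lemma rderiveZ (a : C) (g : R -> C) t d : rderive g t d ->
  rderive (fun x => a * g x) t (a * d).
Proof.
by move=> h; have := rderiveM (rderive_cst a t) h; rewrite mul0r add0r.
Qed.

Lemma rderive_real t : rderive (@rc R) t 1.
Proof.
apply: rderive_ReIm.
exact: is_derive_cst.
Qed.

Lemma rderive_expi (a t : R) :
  rderive (fun x => expi (a * x)) t ((rc a * imC R) * expi (a * t)).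
Proof.
have lin : is_derive t (1 : R) (fun x => a * x) a.
  have h := is_deriveZ a (@is_derive_id R R t (1 : R)).
  have -> : (fun x => a * x) = a \*: id by apply/funext.
  by move: h; rewrite [a *: 1]mulr1.
apply: rderive_ReIm.
- have -> : Re (rc a * imC R * expi (a * t)) = - sin (a * t) * a.
    by rewrite !cReM !cImM /=; ring.
  exact: (@is_derive1_comp _ (@cos R) (fun x => a * x)).
- have -> : Im (rc a * imC R * expi (a * t)) = cos (a * t) * a.
    by rewrite !cImM !cReM /=; ring.
  exact: (@is_derive1_comp _ (@sin R) (fun x => a * x)).
Qed.

Lemma rderive_continuous (g : R -> C) t d : rderive g t d -> {for t, continuous g}.
Proof.
move=> gd; apply: cvg_ReIm.
- have [dr _] := rderive_Re gd.
  exact/differentiable_continuous/derivable1_diffP.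
- have [dr _] := rderive_Im gd.
  exact/differentiable_continuous/derivable1_diffP.
Qed.

Lemma continuous_Re (g : R -> C) : continuous g -> continuous (Re \o g).
Proof. by move=> cg t; exact: cvg_Re (cg t). Qed.

Lemma continuous_Im (g : R -> C) : continuous g -> continuous (Im \o g).
Proof. by move=> cg t; exact: cvg_Im (cg t). Qed.

Lemma continuous_itv_integrable (a b : R) (g : R -> R) : continuous g ->
  (@lebesgue_measure R).-integrable `[a, b] (EFin \o g).
Proof.
move=> cg; apply: continuous_compact_integrable; first exact: segment_compact.
exact: continuous_subspaceT.
Qed.

Lemma CintegralD (a b : R) (g1 g2 : R -> C) : continuous g1 -> continuous g2 ->
  Cintegral a b (fun t => g1 t + g2 t) = Cintegral a b g1 + Cintegral a b g2.
Proof.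
move=> c1 c2; rewrite /Cintegral.
apply/eqP; rewrite eq_complex /=; apply/andP; split; apply/eqP.
- rewrite -RintegralD //; [|exact/continuous_itv_integrable/continuous_Re..].
  by apply: eq_Rintegral => x _; rewrite cReD.
- rewrite -RintegralD //; [|exact/continuous_itv_integrable/continuous_Im..].
  by apply: eq_Rintegral => x _; rewrite cImD.
Qed.

Lemma CintegralZ (a b : R) (c : C) (g : R -> C) : continuous g ->
  Cintegral a b (fun t => c * g t) = c * Cintegral a b g.
Proof.
move=> cg; rewrite /Cintegral.
have ir := @continuous_itv_integrable a b _ (continuous_Re cg).
have ii := @continuous_itv_integrable a b _ (continuous_Im cg).
have cM (r : R) (h : R -> R) : continuous h -> continuous (fun t => r * h t).
  by move=> ch t; apply: cvgM; [exact: cvg_cst|exact: ch].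
apply/eqP; rewrite eq_complex /=; apply/andP; split; apply/eqP.
- rewrite cReM /= -!RintegralZl // -RintegralB //.
  + by apply: eq_Rintegral => x _; rewrite cReM.
  + exact/continuous_itv_integrable/cM/continuous_Re.
  + exact/continuous_itv_integrable/cM/continuous_Im.
- rewrite cImM /= -!RintegralZl // -RintegralD //.
  + by apply: eq_Rintegral => x _; rewrite cImM.
  + exact/continuous_itv_integrable/cM/continuous_Im.
  + exact/continuous_itv_integrable/cM/continuous_Re.
Qed.

Lemma eq_Cintegral (a b : R) (g1 g2 : R -> C) :
  (forall t, g1 t = g2 t) -> Cintegral a b g1 = Cintegral a b g2.
Proof. by move=> e; congr Cintegral; apply/funext. Qed.

Lemma cont_mulc (c : C) (g : R -> C) :
  continuous g -> continuous (fun t => c * g t).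
Proof. by move=> cg t; apply: cvgM; [exact: cvg_cst|exact: cg]. Qed.

Lemma CintegralB (a b : R) (g1 g2 : R -> C) : continuous g1 -> continuous g2 ->
  Cintegral a b (fun t => g1 t - g2 t) = Cintegral a b g1 - Cintegral a b g2.
Proof.
move=> c1 c2; transitivity (Cintegral a b (fun t => g1 t + (-1) * g2 t)).
  by apply: eq_Cintegral => t; rewrite mulN1r.
by rewrite (CintegralD _ _ c1 (@cont_mulc (-1) _ c2)) (@CintegralZ a b (-1) _ c2) mulN1r.
Qed.

Lemma norm_Rintegral_le (a b : R) (g : R -> R) (M : R) : a <= b ->
  continuous g -> (forall t : R, a <= t <= b -> `|g t| <= M) ->
  `|Rintegral lebesgue_measure `[a, b] g| <= M * (b - a).
Proof.
move=> ab cg gM.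
apply: (le_trans (le_normr_Rintegral _ _)) => //.
  exact: continuous_itv_integrable.
have cn : continuous (fun t => `|g t|).
  by move=> t; apply: cvg_norm; exact: cg.
apply: (le_trans (le_Rintegral (f2 := fun=> M) _ _ _ _)) => //.
- exact: continuous_itv_integrable.
- by apply: continuous_itv_integrable => t; exact: cvg_cst.
rewrite Rintegral_cst //= lebesgue_measure_itv /= lte_fin.
case: ltP => [_|ba]; first by rewrite -EFinD.
have -> : b = a by apply/le_anti/andP.
by rewrite subrr.
Qed.

(** The factor 2 comes from bounding the real and imaginary parts separately; such constants are
    harmless, as only smallness and summability matter later. *)
Lemma norm_Cintegral_le (a b : R) (g : R -> C) (M : R) : a <= b ->
  continuous g -> (forall t : R, a <= t <= b -> `|g t| <= rc M) ->
  `|Cintegral a b g| <= rc (2 * M * (b - a)).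
Proof.
move=> ab cg gM; apply: le_trans (norm_le_ReIm _) _ => /=.
rewrite rc_le -mulrA mulr_natl mulr2n lerD //.
- apply: norm_Rintegral_le => //; first exact: continuous_Re.
  by move=> t /gM h; rewrite -rc_le; exact: le_trans (Re_le_norm _) h.
- apply: norm_Rintegral_le => //; first exact: continuous_Im.
  by move=> t /gM h; rewrite -rc_le; exact: le_trans (Im_le_norm _) h.
Qed.

Lemma Rintegral_FTC (a b : R) (g G : R -> R) : a < b -> continuous g ->
  (forall t, is_derive t (1 : R) G (g t)) ->
  Rintegral lebesgue_measure `[a, b] g = G b - G a.
Proof.
move=> ab cg dG; rewrite /Rintegral.
have cG : continuous G.
  by move=> t; apply/differentiable_continuous/derivable1_diffP; have [] := dG t.
rewrite (@continuous_FTC2 _ g G a b) //=.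
- exact: continuous_subspaceT.
- split.
  + by move=> t _; have [] := dG t.
  + exact: cvg_at_right_filter (cG a).
  + exact: cvg_at_left_filter (cG b).
- by move=> t _; rewrite derive1E; have [] := dG t.
Qed.

Lemma Cintegral_FTC (a b : R) (g G : R -> C) : a < b -> continuous g ->
  (forall t, rderive G t (g t)) -> Cintegral a b g = G b - G a.
Proof.
move=> ab cg dG; rewrite /Cintegral.
rewrite [X in X +i* _](Rintegral_FTC ab (continuous_Re cg)
  (fun t => rderive_Re (dG t))).
rewrite [X in _ +i* X](Rintegral_FTC ab (continuous_Im cg)
  (fun t => rderive_Im (dG t))).
by apply/eqP; rewrite eq_complex /= cReB cImB !eqxx.
Qed.

(** The mean value theorem has no exact form for complex values; applying it to the real and
    imaginary parts costs the factor 2. *)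
Lemma rderive_mean_value (g g' : R -> C) (M : R) :
  (forall t : R, 0 <= t <= 1 -> rderive g t (g' t)) ->
  (forall t : R, 0 <= t <= 1 -> `|g' t| <= rc M) -> `|g 1 - g 0| <= rc (2 * M).
Proof.
move=> dg gM.
have mv (h h' : R -> R) : (forall t : R, 0 <= t <= 1 -> is_derive t (1 : R) h (h' t)) ->
    (forall t : R, 0 <= t <= 1 -> `|h' t| <= M) -> `|h 1 - h 0| <= M.
  move=> dh hM.
  have [||c] := @MVT_segment R h h' 0 1 ler01.
  - by move=> x; rewrite in_itv /= => /andP[x0 x1]; apply: dh; rewrite !ltW.
  - apply: continuous_in_subspaceT => x; rewrite inE /= in_itv /= => x01.
    by apply/differentiable_continuous/derivable1_diffP; have [] := dh _ x01.
  by rewrite in_itv /= => c01 ->; rewrite subr0 mulr1; exact: hM.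
apply: le_trans (norm_le_ReIm _) _; rewrite rc_le mulr_natl mulr2n lerD //.
- rewrite cReB; apply: (mv (Re \o g) (Re \o g')) => t t01.
    by apply: rderive_Re; exact: dg.
  by rewrite -rc_le; exact: le_trans (Re_le_norm _) (gM _ t01).
- rewrite cImB; apply: (mv (Im \o g) (Im \o g')) => t t01.
    by apply: rderive_Im; exact: dg.
  by rewrite -rc_le; exact: le_trans (Im_le_norm _) (gM _ t01).
Qed.

End RealVariable.

(** * Directional derivatives and integrals depending on a parameter *)

Section DirectionalDerivative.
Variables (R : realType) (V : normedModType (Cplx R)).
Local Notation C := (Cplx R).
Local Notation Re := (@complex.Re R).
Local Notation Im := (@complex.Im R).

Lemma is_deriveP (g : V -> C) (p e : V) (d : C) :
  is_derive p e g d <->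
  (fun h : C => h^-1 * (g (p + h *: e) - g p)) @ 0^' --> d.
Proof.
split=> [[dg <-]|h].
  apply: cvg_near_eq dg _; near=> h.
  by rewrite /= [h *: e + p]addrC.
have h' : (fun h : C => h^-1 *: ((g \o shift p) (h *: e) - g p)) @ 0^' --> d.
  by apply: cvg_near_eq h _; near=> x; rewrite /= [x *: e + p]addrC.
by split; [apply/cvg_ex; exists d|exact: cvg_lim].
Unshelve. all: by end_near. Qed.

Lemma derivable_is_derive (g : V -> C) (p e : V) :
  derivable g p e -> is_derive p e g ('D_e g p).
Proof. by move=> dg; exact: DeriveDef. Qed.

(** The divided difference completed by [d] at 0, as in Caratheodory's definition of the derivative:
    it is continuous at 0, and [dquotE] holds for all [h] including 0. *)
Definition dquot (g : V -> C) (p e : V) (d h : C) : C :=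
  if h == 0 then d else h^-1 * (g (p + h *: e) - g p).

Lemma dquot_cvg (g : V -> C) (p e : V) (d : C) : is_derive p e g d ->
  dquot g p e d @ nbhs (0 : C) --> d.
Proof.
move=> /is_deriveP /cvgrPdist_lt dg; apply/cvgrPdist_lt => eps eps0.
have := dg _ eps0; rewrite near_withinE; apply: filterS => h; rewrite /dquot.
by have [_ _|h0 /(_ isT)//] := eqVneq h 0; rewrite subrr normr0.
Qed.

Lemma dquotE (g : V -> C) (p e : V) (d h : C) :
  g (p + h *: e) - g p = h * dquot g p e d h.
Proof.
rewrite /dquot; have [->|h0] := eqVneq h 0; first by rewrite scale0r addr0 subrr mul0r.
by rewrite mulrA mulfV // mul1r.
Qed.

(** The curve stays on the complex line through [z] in direction [e], so differentiability in that
    direction is enough. The completed quotient copes with increments of [gamma] that vanish. *)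
Lemma rderive_comp (g : V -> C) (z e : V) (gamma : R -> C) (t : R) (d d' : C) :
  rderive gamma t d' -> is_derive (z + gamma t *: e) e g d ->
  rderive (fun x => g (z + gamma x *: e)) t (d * d').
Proof.
move=> dgam dg; set p := z + gamma t *: e in dg.
have cq := dquot_cvg dg; have gq := dquotE g p e d; set q := dquot g p e d in cq gq.
have gam0 : (fun h => gamma (t + h) - gamma t) @ 0^' --> (0 : C).
  by rewrite -(subrr (gamma t)); apply: cvgB; [exact: rderive_incr dgam|exact: cvg_cst].
have : (fun h : R => q (gamma (t + h) - gamma t) * (rc h^-1 * (gamma (t + h) - gamma t)))
    @ 0^' --> d * d'.
  apply: cvgM dgam; exact: cvg_comp gam0 cq.
move=> h; apply: cvg_near_eq h _; near=> x.
have -> : z + gamma (t + x) *: e = p + (gamma (t + x) - gamma t) *: e.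
  by rewrite /p scalerBl -addrA [gamma t *: e + _]addrC subrK.
by rewrite -/p gq mulrCA; congr (_ * _); exact: mulrC.
Unshelve. all: by end_near. Qed.

Lemma norm_Re_rc (z : C) : `|z| = rc (Re `|z|).
Proof. by have [_] := ge0_Re (normr_ge0 z). Qed.

(** Subtracting the linear function of slope [c] turns the mean value bound into an estimate by the
    oscillation of [g'] around [c]. A nearby derivative as [c] gives uniform differentiability;
    [c = 0] and [M = 0] give constancy. *)
Lemma dir_mean_value (g g' : V -> C) (z e : V) (h c : C) (M : R) :
  (forall x : R, 0 <= x <= 1 ->
     is_derive (z + (rc x * h) *: e) e g (g' (z + (rc x * h) *: e))) ->
  (forall x : R, 0 <= x <= 1 -> `|g' (z + (rc x * h) *: e) - c| <= rc M) ->
  `|g (z + h *: e) - g z - h * c| <= rc (2 * M) * `|h|.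
Proof.
move=> dg bg.
pose G (x : R) := g (z + (rc x * h) *: e) - rc x * (h * c).
have -> : g (z + h *: e) - g z - h * c = G 1 - G 0.
  by rewrite /G rc1 rc0 !mul1r !mul0r scale0r addr0 subr0; ring.
rewrite norm_Re_rc [X in _ * X]norm_Re_rc -rcM -mulrA -norm_Re_rc.
apply: (@rderive_mean_value _ _ (fun x => (g' (z + (rc x * h) *: e) - c) * h)).
  move=> t t01.
  have dl (a : C) : rderive (fun x => rc x * a) t a.
    by have := rderiveM (rderive_real t) (rderive_cst a t); rewrite mulr0 addr0 mul1r.
  have h1 := rderive_comp (dl h) (dg t t01).
  have h2 := dl (h * c).
  rewrite mulrBl; rewrite /rderive /G.
  rewrite [c * h]mulrC.
  apply: cvg_near_eq (cvgB h1 h2) _; near=> x.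
  by rewrite !fctE -mulrBr; congr (_ * _); ring.
move=> t t01; rewrite normrM rcM -norm_Re_rc ler_wpM2r //; exact: bg.
Unshelve. all: by end_near. Qed.

(** Base point and increment vary together: under the integral sign the base point [L t z] moves
    with [t], so differentiability at a single point would not do. *)
Lemma strict_derive (Omega : set V) (g : V -> C) (e y : V) :
  open Omega -> Omega y -> (forall p, Omega p -> derivable g p e) ->
  ('D_e g) @ y --> 'D_e g y -> forall eps : R, 0 < eps ->
  \forall p \near y & k \near (0 : C),
    `|g (p + k *: e) - g p - k * 'D_e g y| <= rc eps * `|k|.
Proof.
move=> oO Oy dg cDg eps eps0.
have e2 : 0 < rc (eps / 2) :> C by rewrite -rc0 rc_lt divr_gt0.
have : \forall p \near y, Omega p /\ `|'D_e g y - 'D_e g p| < rc (eps / 2).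
  near=> p; split; first by near: p; exact: open_nbhs_nbhs.
  by near: p; move/cvgrPdist_lt : cDg => /(_ _ e2).
move=> /nbhs_normP[r /= r0 Hr].
have r2 : 0 < r / 2 :> C by rewrite divr_gt0.
exists ([set p | `|y - p| < r / 2], [set k : C | `|k| * `|e| < r / 2]).
  split; first by apply/nbhs_normP; exists (r / 2).
  have [->|e0] := eqVneq e 0.
    by apply: filterS (@filterT _ (nbhs (0 : C)) _) => k _ /=; rewrite normr0 mulr0.
  have ne : 0 < `|e| by rewrite normr_gt0.
  apply/nbhs_normP; exists (r / 2 / `|e|); first by rewrite /= divr_gt0.
  by move=> k /=; rewrite sub0r normrN ltr_pdivlMr.
move=> [p k] /= [yp ke].
have seg (x : R) : 0 <= x <= 1 -> `|y - (p + (rc x * k) *: e)| < r.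
  move=> /andP[x0 x1].
  rewrite opprD addrA (splitr r); apply: le_lt_trans (ler_normB _ _) _.
  apply: ltrD => //; apply: le_lt_trans ke; rewrite normrZ normrM.
  rewrite -mulrA ler_piMl ?mulr_ge0 //.
  by rewrite -[`|rc x|]/(`|x%:C : C|) normC_real ger0_norm // -[1]/(rc 1 : C) rc_le.
rewrite (_ : eps = 2 * (eps / 2)); last by rewrite mulrC divfK ?pnatr_eq0.
apply: (dir_mean_value (g' := 'D_e g)) => x x01.
  have [Op _] := Hr _ (seg x x01).
  by apply: derivable_is_derive; exact: dg.
rewrite distrC; have [_ /ltW] := Hr _ (seg x x01).
by [].
Unshelve. all: by end_near. Qed.

End DirectionalDerivative.

Section ParametricIntegral.
Variables (R : realType).
Local Notation C := (Cplx R).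

Lemma Cintegral_cvg (a b : R) (W : Type) (F : set_system W) {FF : Filter F}
  (G : R -> W -> C) (G0 : R -> C) : a <= b ->
  (\forall w \near F, continuous (G^~ w)) -> continuous G0 ->
  (forall t : R, (fun p => G p.1 p.2) @ filter_prod (nbhs t) F --> G0 t) ->
  (fun w => Cintegral a b (G^~ w)) @ F --> Cintegral a b G0.
Proof.
move=> ab cG cG0 GG0; apply/cvgrPdist_le => eps /gt0_Re[e0 eE].
(* The 2 cancels the constant of [norm_Cintegral_le]; the [+ 1] keeps the denominator positive when
   [a = b]. *)
pose del := complex.Re eps / (2 * (b - a + 1)).
have ba1 : 0 < b - a + 1 by rewrite ltr_pwDr // subr_ge0.
have del0 : 0 < del by rewrite divr_gt0 // mulr_gt0.
have del2 : 0 < rc (del / 2) :> C by rewrite -rc0 rc_lt divr_gt0.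
(* Compactness of the segment makes the joint limits at its points uniform in [t]. *)
have near_small : \forall w \near F, `[a, b]%classic `<=`
    (fun t => `|G0 t - G t w| <= rc del).
  have /compact_near_coveringP cov := @segment_compact R a b.
  apply: cov => t _.
  have h1 : \forall p \near filter_prod (nbhs t) F,
      `|G0 t - G p.1 p.2| < rc (del / 2).
    by move/cvgrPdist_lt : (GG0 t); apply.
  have h2 : \forall t' \near t & w \near F, `|G0 t - G0 t'| < rc (del / 2).
    exists ([set t' | `|G0 t - G0 t'| < rc (del / 2)], setT) => /=.
      split; last exact: filterT.
      by move/cvgrPdist_lt : (cG0 t); apply.
    by move=> [t' w] [].
  apply: filterS2 h1 h2 => -[t' w] /= h1 h2.
  rewrite (_ : G0 t' - G t' w = (G0 t - G t' w) - (G0 t - G0 t')); last by ring.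
  apply: le_trans (ler_normB _ _) _.
  by rewrite (splitr del) rcD lerD // ltW.
apply: filterS2 cG near_small => w cGw small.
rewrite -(CintegralB _ _ cG0 cGw).
apply: (le_trans (norm_Cintegral_le (M := del) ab _ _)).
- by move=> t; apply: cvgB; [exact: cG0|exact: cGw].
- by move=> t tab; apply: small; rewrite /= in_itv.
rewrite eE rc_le (_ : 2 * del * (b - a) = complex.Re eps * ((b - a) / (b - a + 1))).
  by rewrite ler_piMr ?(ltW e0) // ler_pdivrMr // mul1r lerDl.
by rewrite /del; field; rewrite gt_eqF.
Qed.

Variable V : normedModType C.

(** Relative continuity through the filter [within X], so that one notion serves the open domain and
    its closure. *)
Definition cont_on (X : set V) (g : V -> C) :=
  forall x, X x -> g @ within X (nbhs x) --> g x.

Lemma Cintegral_cont_on (a b : R) (X Y : set V) (g : V -> C) (L : R -> V -> V)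
  (c : R -> C) : a <= b -> cont_on Y g ->
  (forall (t : R) z, X z -> Y (L t z)) ->
  (forall (t : R) z, (fun p : R * V => L p.1 p.2) @ (t, z) --> L t z) ->
  continuous c ->
  cont_on X (fun z => Cintegral a b (fun t => g (L t z) * c t)).
Proof.
move=> ab cg XY cL cc z Xz.
have joint (t : R) w : X w -> (fun p : R * V => g (L p.1 p.2) * c p.1)
    @ filter_prod (nbhs t) (within X (nbhs w)) --> g (L t w) * c t.
  move=> Xw; apply: cvgM; last first.
    apply: cvg_trans (cc t); apply: cvg_comp; last exact: cvg_id.
    exact: cvg_fst.
  have h : (fun p : R * V => L p.1 p.2) @
      filter_prod (nbhs t) (within X (nbhs w)) --> within Y (nbhs (L t w)).
    move=> A /= YA.
    have /= [[A1 A2] /= [tA1 wA2] sub] := cL t w _ YA.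
    exists (A1, A2 `&` X) => /=.
      by split; [exact: tA1|apply: filterS wA2 => v A2v Xv].
    by move=> [t' v] /= [A1t' [A2v Xv]]; apply: (sub (t', v)) => //=; exact: XY.
  exact: cvg_comp h (cg _ (XY t w Xw)).
have csec w : X w -> continuous (fun t => g (L t w) * c t).
  move=> Xw t.
  have h : (fun t' : R => (t', w)) @ t --> filter_prod (nbhs t) (within X (nbhs w)).
    move=> A /= [[A1 A2] /= [tA1 wA2] sub].
    apply: filterS tA1 => t' A1t'; apply: sub; split => //=.
    exact: (nbhs_singleton wA2).
  exact: cvg_comp h (joint t w Xw).
apply: Cintegral_cvg; first exact: ab.
- by rewrite near_withinE; near=> w => Xw; exact: csec.
- exact: csec.
- by move=> t; exact: joint.
Unshelve. all: by end_near. Qed.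

Lemma cont_section (Omega : set V) (u : V -> C) (L : R -> V -> V) (w : V) :
  open Omega -> cont_on Omega u ->
  (forall (t : R) v, (fun p : R * V => L p.1 p.2) @ (t, v) --> L t v) ->
  (forall t : R, Omega (L t w)) -> continuous (fun t => u (L t w)).
Proof.
move=> oO cu cL OLw t.
have := cu _ (OLw t); rewrite within_interior; last first.
  by rewrite /interior; exact: open_nbhs_nbhs.
have h : (fun t' : R => (t', w)) @ t --> (t, w).
  move=> A /= [[A1 A2] /= [tA1 wA2] sub].
  apply: filterS tA1 => t' A1t'; apply: sub; split => //=.
  exact: (nbhs_singleton wA2).
move=> hu.
have h2 : (fun t' => L t' w) @ t --> L t w by exact: cvg_comp h (cL t w).
exact: cvg_comp h2 hu.
Qed.

(** [L t] is a rotation or a translation along a circle, and [m t] is the factor by which it scales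
    the direction [e]: [expi t] when the rotation acts on the coordinate of [e], and 1 otherwise. *)
Lemma is_derive_Cintegral (a b : R) (X Omega : set V) (g : V -> C)
  (L : R -> V -> V) (c m : R -> C) (e z : V) : a <= b ->
  open X -> X z -> open Omega ->
  (forall p, Omega p -> derivable g p e) -> cont_on Omega g ->
  cont_on Omega ('D_e g) ->
  (forall (t : R) w, X w -> Omega (L t w)) ->
  (forall (t : R) w, (fun p : R * V => L p.1 p.2) @ (t, w) --> L t w) ->
  (forall (t : R) (h : C), L t (z + h *: e) = L t z + (h * m t) *: e) ->
  continuous c -> continuous m ->
  is_derive z e (fun w => Cintegral a b (fun t => g (L t w) * c t))
    (Cintegral a b (fun t => 'D_e g (L t z) * (m t * c t))).
Proof.
move=> ab oX Xz oO dg cg cDg XO cL Lh cc cm; apply/is_deriveP.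
have csec u w (cu : cont_on Omega u) (Xw : X w) :=
  cont_section oO cu cL (fun t => XO t w Xw).
have near_X : \forall h \near (0 : C), X (z + h *: e).
  have : (fun h : C => z + h *: e) @ nbhs (0 : C) --> z + (0 : C) *: e.
    by apply: cvgD; [exact: cvg_cst|apply: cvgZr_tmp; exact: cvg_id].
  by rewrite scale0r addr0; apply; exact: open_nbhs_nbhs.
pose Q (t : R) (h : C) := h^-1 * (g (L t z + (h * m t) *: e) - g (L t z)) * c t.
have cQ : \forall h \near (0 : C)^', continuous (Q ^~ h).
  rewrite near_withinE; apply: filterS near_X => h Xh _.
  have -> : Q ^~ h = fun t => (h^-1 * (g (L t (z + h *: e)) - g (L t z))) * c t.
    by apply/funext => t; rewrite /Q Lh.
  move=> t; apply: cvgM; last exact: cc.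
  apply: cvgM; first exact: cvg_cst.
  by apply: cvgB; [exact: csec cg Xh t|exact: csec cg Xz t].
have c0 : continuous (fun t => 'D_e g (L t z) * (m t * c t)).
  move=> t; apply: cvgM; first exact: csec cDg Xz t.
  by apply: cvgM; [exact: cm|exact: cc].
have jQ (t : R) : (fun p => Q p.1 p.2) @ filter_prod (nbhs t) (0 : C)^' -->
    'D_e g (L t z) * (m t * c t).
  set y := L t z; have Oy : Omega y by exact: XO.
  (* The error of the difference quotient as a function of base point and increment; its joint
     continuity at [(y, 0)] is what [strict_derive] provides. *)
  pose s (p : V * C) := if p.2 == 0 then 0 else
    p.2^-1 * (g (p.1 + p.2 *: e) - g p.1) - 'D_e g y.
  have s0 : s @ (y, (0 : C)) --> (0 : C).
    apply/cvgrPdist_le => eps /gt0_Re[eps0 ->].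
    have cDy : 'D_e g @ y --> 'D_e g y.
      have := cDg _ Oy; rewrite within_interior; first by apply.
      by rewrite /interior; exact: open_nbhs_nbhs.
    have := strict_derive oO Oy dg cDy eps0.
    apply: filterS => -[p k] /= h; rewrite /s /= sub0r normrN.
    have [_|k0] := eqVneq k 0; first by rewrite normr0 -rc0 rc_le ltW.
    have -> : k^-1 * (g (p + k *: e) - g p) - 'D_e g y =
        k^-1 * (g (p + k *: e) - g p - k * 'D_e g y) by field.
    by rewrite normrM normfV ler_pdivrMl ?normr_gt0 // [`|k| * _]mulrC.
  have f1 : (fun p : R * C => p.1) @ filter_prod (nbhs t) (0 : C)^' --> t.
    exact: cvg_fst.
  have hL : (fun p : R * C => (L p.1 z, p.2 * m p.1)) @
      filter_prod (nbhs t) (0 : C)^' --> (y, (0 : C)).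
    apply: cvg_to_pair.
      have h : (fun p : R * C => (p.1, z)) @ filter_prod (nbhs t) (0 : C)^'
          --> (t, z).
        move=> A /= [[A1 A2] /= [tA1 wA2] sub].
        exists (A1, setT) => /=; first by split => //; exact: filterT.
        move=> [t' k] /= [A1t' _]; apply: sub; split => //=.
        exact: (nbhs_singleton wA2).
      exact: cvg_comp h (cL t z).
    have c2 : (fun p : R * C => p.2) @ filter_prod (nbhs t) (0 : C)^' --> (0 : C).
      move=> A A0; exists (setT, A) => /=; last by move=> [? ?] [].
      by split; [exact: filterT|exact: nbhs_dnbhs].
    have : (fun p : R * C => p.2 * m p.1) @ filter_prod (nbhs t) (0 : C)^' --> 0 * m t.
      by apply: cvgM c2 _; exact: cvg_comp f1 (cm t).
    by rewrite mul0r.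
  have h1 : (fun p : R * C => (s (L p.1 z, p.2 * m p.1) + 'D_e g y) * (m p.1 * c p.1)) @
      filter_prod (nbhs t) (0 : C)^' --> (0 + 'D_e g y) * (m t * c t).
    apply: cvgM.
      apply: cvgD; last exact: cvg_cst.
      exact: cvg_comp hL s0.
    by apply: cvgM; [exact: cvg_comp f1 (cm t)|exact: cvg_comp f1 (cc t)].
  rewrite add0r in h1; apply: cvg_near_eq h1 _.
  exists (setT, [set k : C | k != 0]) => /=.
    split; first exact: filterT.
    by rewrite /dnbhs /within /=; apply: filterS (@filterT _ (nbhs (0 : C)) _) => k _.
  move=> [t' k] /= [_ k0]; rewrite /s /Q /=.
  (* As [k] is nonzero, a zero product means [m t' = 0]; the base point does not move then and both
     expressions vanish. *)
  have [/eqP|] := eqVneq (k * m t') 0.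
    rewrite mulf_eq0 (negPf k0) /= => /eqP ->.
    by rewrite mul0r !mulr0 scale0r addr0 subrr mulr0 mul0r.
  by move=> km; rewrite subrK; field; move: km; rewrite mulf_eq0 negb_or.
apply: cvg_near_eq (Cintegral_cvg ab cQ c0 jQ) _.
near=> h.
have Xh : X (z + h *: e) by near: h; exact: nbhs_dnbhs.
have c1 : continuous (fun t => g (L t (z + h *: e)) * c t).
  by move=> t; apply: cvgM; [exact: csec cg Xh t|exact: cc].
have c2 : continuous (fun t => g (L t z) * c t).
  by move=> t; apply: cvgM; [exact: csec cg Xz t|exact: cc].
rewrite -(CintegralB _ _ c1 c2) -(@CintegralZ _ a b h^-1 _ _).
  by apply: eq_Cintegral => t; rewrite /Q Lh; ring.
by move=> t; apply: cvgB; [exact: c1|exact: c2].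
Unshelve. all: by end_near. Qed.

End ParametricIntegral.

(** * Fourier projections in one coordinate *)

Section Mean.
Variable R : realType.
Local Notation C := (Cplx R).

Definition mean (g : R -> C) : C :=
  (rc (2 * pi))^-1 * Cintegral 0 (2 * pi) g.

Lemma twopi_gt0 : 0 < 2 * pi :> R.
Proof. by rewrite mulr_gt0 // pi_gt0. Qed.

Lemma rc_twopi_neq0 : rc (2 * pi) != 0 :> C.
Proof. by rewrite rc_eq0 gt_eqF // twopi_gt0. Qed.

Lemma eq_mean (g1 g2 : R -> C) : (forall t, g1 t = g2 t) -> mean g1 = mean g2.
Proof. by move=> e; rewrite /mean (eq_Cintegral _ _ e). Qed.

Lemma meanD (g1 g2 : R -> C) : continuous g1 -> continuous g2 ->
  mean (fun t => g1 t + g2 t) = mean g1 + mean g2.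
Proof. by move=> c1 c2; rewrite /mean (CintegralD _ _ c1 c2) mulrDr. Qed.

Lemma meanB (g1 g2 : R -> C) : continuous g1 -> continuous g2 ->
  mean (fun t => g1 t - g2 t) = mean g1 - mean g2.
Proof. by move=> c1 c2; rewrite /mean (CintegralB _ _ c1 c2) mulrBr. Qed.

Lemma meanZ (c : C) (g : R -> C) : continuous g ->
  mean (fun t => c * g t) = c * mean g.
Proof. by move=> cg; rewrite /mean (CintegralZ _ _ c cg) mulrCA. Qed.

Lemma mean_FTC (g G : R -> C) : continuous g -> (forall t, rderive G t (g t)) ->
  G (2 * pi) = G 0 -> mean g = 0.
Proof.
move=> cg dG e; rewrite /mean (Cintegral_FTC twopi_gt0 cg dG) e subrr mulr0 //.
Qed.

Lemma continuous_cst_fun (c : C) : continuous (fun _ : R => c).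
Proof. by move=> t; exact: cvg_cst. Qed.

Lemma mean_cst (c : C) : mean (fun=> c) = c.
Proof.
have d (t : R) : rderive (fun x => rc x * c) t c.
  by have := rderiveM (rderive_real t) (@rderive_cst R c t); rewrite mulr0 addr0 mul1r.
rewrite /mean (Cintegral_FTC twopi_gt0 (@continuous_cst_fun c) d).
by rewrite rc0 mul0r subr0 mulKf // rc_twopi_neq0.
Qed.

Lemma norm_mean_le (g : R -> C) (M : R) : continuous g ->
  (forall t, `|g t| <= rc M) -> `|mean g| <= rc (2 * M).
Proof.
move=> cg gM; rewrite /mean normrM normfV.
have -> : `|rc (2 * pi) : C| = rc (2 * pi).
  by rewrite [LHS]normC_real ger0_norm // ltW // twopi_gt0.
rewrite ler_pdivrMl; last by rewrite -rc0 rc_lt twopi_gt0.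
apply: (le_trans (norm_Cintegral_le (ltW twopi_gt0) cg (fun t _ => gM t))).
by rewrite subr0 -rcM rc_le mulrC.
Qed.

(** The kernel e^(-ikt), so that [mean (fun t => G t * chr k t)] is the Fourier coefficient of index
    [k]; the character e^(ikt) itself is [chr (- k)]. *)
Definition chr (k : int) (t : R) : C := expi (- (k%:~R * t)).

Lemma chrE k t : chr k t = (expi t) ^ (- k).
Proof. by rewrite /chr -mulNr -rmorphN expi_int. Qed.

Lemma rderive_chr k t : rderive (chr k) t (- (k%:~R * imC R) * chr k t).
Proof.
have := @rderive_expi R (- k%:~R) t.
have -> : rc (- k%:~R) = - k%:~R :> C.
  by rewrite rcN; congr (- _); exact: (rmorph_int (real_complex R)).
have -> : (fun x : R => expi (- k%:~R * x)) = chr k.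
  by apply/funext => x; rewrite mulNr.
by rewrite !mulNr.
Qed.

Lemma chr_continuous k : continuous (chr k).
Proof. by move=> t; exact: rderive_continuous (@rderive_chr k t). Qed.

Lemma chr_2pi k : chr k (2 * pi) = 1.
Proof. by rewrite chrE expi_2pi exp1rz. Qed.

Lemma chr_0 k : chr k 0 = 1.
Proof. by rewrite chrE expi0 exp1rz. Qed.

Lemma norm_chr k t : `|chr k t| = 1.
Proof. exact: norm_expi. Qed.

Lemma chrD k l t : chr (k + l) t = chr k t * chr l t.
Proof. by rewrite !chrE opprD expfzDr // expi_neq0. Qed.

Lemma chrB1 k t : chr (k - 1) t = expi t * chr k t.
Proof. by rewrite chrD mulrC; congr (_ * _); rewrite chrE. Qed.

Lemma imC_neq0 : imC R != 0.
Proof. by rewrite /imC eq_complex /= oner_eq0 andbF. Qed.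

Lemma mean_chr k : mean (chr k) = (k == 0)%:R.
Proof.
have [->|k0] := eqVneq k 0.
  by rewrite (eq_mean (g2 := fun=> 1)) ?mean_cst // => t; rewrite chrE expr0z.
have ck : continuous (fun t => - (k%:~R * imC R) * chr k t).
  by move=> t; apply: cvgM; [exact: cvg_cst|exact: chr_continuous].
have := mean_FTC ck (fun t => @rderive_chr k t).
rewrite chr_2pi chr_0 (meanZ _ (@chr_continuous k)) => /(_ erefl) /eqP.
rewrite mulf_eq0 oppr_eq0 mulf_eq0 intr_eq0 (negPf k0) /=.
by rewrite (negPf imC_neq0) => /eqP.
Qed.

Lemma continuousM_fun (u v : R -> C) : continuous u -> continuous v ->
  continuous (fun t => u t * v t).
Proof. by move=> cu cv t; apply: cvgM; [exact: cu|exact: cv]. Qed.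

(** Integration by parts on the circle: the derivative of the periodic function [u * chr k] has mean
    0. Along a rotation orbit [v] will be z_j d_j g, the factor [imC R] coming from the derivative
    of [expi]. *)
Lemma mean_euler (u v : R -> C) (k : int) : continuous v ->
  (forall t, rderive u t (imC R * v t)) -> u (2 * pi) = u 0 ->
  mean (fun t => v t * chr k t) = k%:~R * mean (fun t => u t * chr k t).
Proof.
move=> cv du per.
have cu : continuous u by move=> t; exact: rderive_continuous (du t).
have c1 := continuousM_fun cv (@chr_continuous k).
have c2 := continuousM_fun cu (@chr_continuous k).
have d t : rderive (fun x => u x * chr k x) t
    (imC R * (v t * chr k t) - k%:~R * imC R * (u t * chr k t)).
  have := rderiveM (du t) (@rderive_chr k t).
  by congr (rderive _ _ _); ring.
have c3 := @cont_mulc R (imC R) _ c1.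
have c4 := @cont_mulc R (k%:~R * imC R) _ c2.
have c5 : continuous (fun t => imC R * (v t * chr k t) - k%:~R * imC R * (u t * chr k t)).
  by move=> t; apply: cvgB; [exact: c3|exact: c4].
have := mean_FTC c5 d; rewrite chr_2pi chr_0 per => /(_ erefl).
rewrite (meanB c3 c4) (meanZ _ c1) (meanZ _ c2) => /eqP.
rewrite subr_eq0 => /eqP h; apply: (mulfI imC_neq0); rewrite h; ring.
Qed.

End Mean.

(** * Rotations of one coordinate and the projections they define *)

Section Rotation.
Variables (R : realType) (n : nat).
Local Notation C := (Cplx R).
Local Notation V := 'rV[C]_n.
Implicit Types (j l : 'I_n) (k : int) (z : V) (g : V -> C).

Definition bv j : V := delta_mx ord0 j.

(* Rotation by the angle [t] in coordinate [j], written as a displacement along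
   the [j]-th basis vector so that directional derivatives apply directly. *)
Definition turn j (t : R) z : V := z + ((expi t - 1) * z ord0 j) *: bv j.

Lemma turnE j t z l : turn j t z ord0 l = if l == j then expi t * z ord0 j else z ord0 l.
Proof.
rewrite !mxE eqxx /=; have [->|lj] := eqVneq l j; last by rewrite mulr0 addr0.
by rewrite mulr1; ring.
Qed.

Lemma turn0 j z : turn j 0 z = z.
Proof. by rewrite /turn expi0 subrr mul0r scale0r addr0. Qed.

Lemma turn2pi j z : turn j (2 * pi) z = z.
Proof. by rewrite /turn expi_2pi subrr mul0r scale0r addr0. Qed.

Lemma coord_cvg j z : (fun w : V => w ord0 j) @ z --> z ord0 j.
Proof. exact: coord_continuous. Qed.

Lemma turn_joint j (t : R) z : (fun p : R * V => turn j p.1 p.2) @ (t, z) --> turn j t z.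
Proof.
have f1 : (fun p : R * V => p.1) @ filter_prod (nbhs t) (nbhs z) --> t by exact: cvg_fst.
have f2 : (fun p : R * V => p.2) @ filter_prod (nbhs t) (nbhs z) --> z by exact: cvg_snd.
have c1 : (fun x : R => expi x - 1 : C) @ t --> (expi t - 1 : C).
  exact: (cvgB (@expi_continuous R t) (cvg_cst (1 : C))).
have h1 : (fun p : R * V => expi p.1 - 1 : C) @ filter_prod (nbhs t) (nbhs z)
    --> (expi t - 1 : C) by exact: cvg_comp f1 c1.
have h2 : (fun p : R * V => p.2 ord0 j) @ filter_prod (nbhs t) (nbhs z) --> z ord0 j.
  exact: cvg_comp f2 (@coord_cvg j z).
have h3 : (fun p : R * V => turn j p.1 p.2) @ filter_prod (nbhs t) (nbhs z) --> turn j t z.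
  have FF : Filter (filter_prod (nbhs t) (nbhs z)) by typeclasses eauto.
  by apply: cvgD; [exact: f2|apply: cvgZr_tmp; exact: cvgM h1 h2].
exact: h3.
Qed.

Lemma coord_bv j l z (h : C) :
  (z + h *: bv l) ord0 j = z ord0 j + h * (j == l)%:R.
Proof. by rewrite !mxE eqxx. Qed.

Lemma turn_bv_neq j l t z (h : C) : l != j ->
  turn j t (z + h *: bv l) = turn j t z + (h * 1) *: bv l.
Proof.
move=> lj; rewrite /turn coord_bv eq_sym (negPf lj) mulr0 addr0.
by rewrite mulr1 addrAC.
Qed.

Lemma turn_bv j t z (h : C) :
  turn j t (z + h *: bv j) = turn j t z + (h * expi t) *: bv j.
Proof.
rewrite /turn coord_bv eqxx mulr1 -!addrA -!scalerDl.
by congr (_ + _ *: _); ring.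
Qed.

Definition rot_inv (X : set V) := forall j t z, X z -> X (turn j t z).

(* The [k]-th Fourier coefficient of [t |-> g (turn j t z)] as a function of [z];
   for holomorphic [g] it is the part of the Laurent series of degree [k] in [z_j]. *)
Definition fproj j k g : V -> C := fun z => mean (fun t => g (turn j t z) * chr k t).

Lemma cont_on_turn (X : set V) g j z : rot_inv X -> cont_on X g -> X z ->
  continuous (fun t => g (turn j t z)).
Proof.
move=> rX cg Xz t.
have Xr := rX j t z Xz.
have h : (fun t' : R => turn j t' z) @ t --> within X (nbhs (turn j t z)).
  move=> A /= XA.
  have /= [[A1 A2] /= [tA1 wA2] sub] := turn_joint XA.
  apply: filterS tA1 => t' A1t'; apply: (sub (t', z)); last exact: rX.
  by split => //=; apply: nbhs_singleton; exact: wA2.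
exact: cvg_comp h (cg _ Xr).
Qed.

Lemma fproj_cont_fun (X : set V) g j k z : rot_inv X -> cont_on X g -> X z ->
  continuous (fun t => g (turn j t z) * chr k t).
Proof.
move=> rX cg Xz; apply: continuousM_fun; first exact: cont_on_turn cg Xz.
exact: chr_continuous.
Qed.

Lemma fproj_cont (X : set V) g j k : rot_inv X -> cont_on X g -> cont_on X (fproj j k g).
Proof.
move=> rX cg z Xz; apply: cvgM; first exact: cvg_cst.
apply: (@Cintegral_cont_on R V 0 (2 * pi) X X g (turn j) (@chr R k)) => //.
- exact: ltW (twopi_gt0 R).
- by move=> t w; exact: rX.
- by move=> t w; exact: turn_joint.
- exact: chr_continuous.
Qed.

Lemma eq_fproj j k g1 g2 z : (forall t, g1 (turn j t z) = g2 (turn j t z)) ->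
  fproj j k g1 z = fproj j k g2 z.
Proof. by move=> e; apply: eq_mean => t; rewrite e. Qed.

Lemma fprojZ (X : set V) j k (c : C) g z : rot_inv X -> cont_on X g -> X z ->
  fproj j k (fun w => c * g w) z = c * fproj j k g z.
Proof.
move=> rX cg Xz; rewrite /fproj -(meanZ c (@fproj_cont_fun X g j k z rX cg Xz)).
by apply: eq_mean => t; rewrite mulrA.
Qed.

Lemma norm_fproj_le (X : set V) j k g z (M : R) : rot_inv X -> cont_on X g -> X z ->
  (forall t, `|g (turn j t z)| <= rc M) -> `|fproj j k g z| <= rc (2 * M).
Proof.
move=> rX cg Xz gM; apply: norm_mean_le; first exact: fproj_cont_fun cg Xz.
by move=> t; rewrite normrM norm_chr mulr1.
Qed.

(* By [hol_partial] below, this first-order condition is inherited by all the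
   partial derivatives. *)
Definition hol (Omega : set V) g := [/\ cont_on Omega g,
  forall j z, Omega z -> derivable g z (bv j) &
  forall j, cont_on Omega ('D_(bv j) g)].

Lemma cont_on_eq (X : set V) g1 g2 : (forall z, X z -> g1 z = g2 z) ->
  cont_on X g1 -> cont_on X g2.
Proof.
move=> e c z Xz; rewrite -(e _ Xz); apply: cvg_near_eq (c z Xz) _.
by rewrite near_withinE; near=> w => Xw; exact: e.
Unshelve. all: by end_near. Qed.

Lemma open_near (Omega : set V) z : open Omega -> Omega z ->
  \forall w \near z, Omega w.
Proof. by move=> oO Oz; exact: open_nbhs_nbhs. Qed.

Lemma is_derive_eq_on (Omega : set V) g1 g2 z e d : open Omega -> Omega z ->
  (forall w, Omega w -> g1 w = g2 w) -> is_derive z e g1 d -> is_derive z e g2 d.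
Proof.
move=> oO Oz e12 /is_deriveP h; apply/is_deriveP.
apply: cvg_near_eq h _; rewrite -(e12 _ Oz).
have : \forall h \near (0 : C), Omega (z + h *: e).
  have : (fun h : C => z + h *: e) @ nbhs (0 : C) --> z + (0 : C) *: e.
    by apply: cvgD; [exact: cvg_cst|apply: cvgZr_tmp; exact: cvg_id].
  by rewrite scale0r addr0; apply; exact: open_near.
move=> near_O; near=> h; rewrite e12 //; near: h; exact: nbhs_dnbhs.
Unshelve. all: by end_near. Qed.

Lemma hol_eq (Omega : set V) g1 g2 : open Omega ->
  (forall z, Omega z -> g1 z = g2 z) -> hol Omega g1 -> hol Omega g2.
Proof.
move=> oO e [c d cD].
have d2 j z : Omega z -> is_derive z (bv j) g2 ('D_(bv j) g1 z).
  move=> Oz; apply: (is_derive_eq_on oO Oz e).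
  by apply: derivable_is_derive; exact: d.
split.
- exact: cont_on_eq e c.
- by move=> j z Oz; have [h _] := d2 j z Oz; exact: h.
- by move=> j; apply: (cont_on_eq _ (cD j)) => z Oz; have [_ ->] := d2 j z Oz.
Qed.

Variable Omega : set V.
Hypothesis oO : open Omega.
Hypothesis rO : rot_inv Omega.

Lemma fproj_derive_neq j l k g z : l != j -> hol Omega g -> Omega z ->
  is_derive z (bv l) (fproj j k g) (fproj j k ('D_(bv l) g) z).
Proof.
move=> lj [cg dg cD] Oz.
have := @is_derive_Cintegral R V 0 (2 * pi) Omega Omega g (turn j) (@chr R k)
  (fun=> 1) (bv l) z (ltW (twopi_gt0 R)) oO Oz oO (dg l) cg (cD l)
  (fun t w => @rO j t w) (fun t w => @turn_joint j t w)
  (fun t h => turn_bv_neq t z h lj) (@chr_continuous R k)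
  (@continuous_cst_fun R 1).
move=> /(is_deriveZ (rc (2 * pi))^-1) h.
have -> : fproj j k g = (rc (2 * pi))^-1 \*:
  (fun w => Cintegral 0 (2 * pi) (fun t => g (turn j t w) * chr k t)) by [].
have -> // : fproj j k ('D_(bv l) g) z = (rc (2 * pi))^-1 *:
  Cintegral 0 (2 * pi) (fun t => 'D_(bv l) g (turn j t z) * (1 * chr k t)).
by congr (_ * _); apply: eq_Cintegral => t; rewrite mul1r.
Qed.

(** The rotation multiplies the direction [bv j] by [expi t], and this factor changes [chr k] into
    [chr (k - 1)]: the degree drops by one. *)
Lemma fproj_derive j k g z : hol Omega g -> Omega z ->
  is_derive z (bv j) (fproj j k g) (fproj j (k - 1) ('D_(bv j) g) z).
Proof.
move=> [cg dg cD] Oz.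
have := @is_derive_Cintegral R V 0 (2 * pi) Omega Omega g (turn j) (@chr R k)
  (@expi R) (bv j) z (ltW (twopi_gt0 R)) oO Oz oO (dg j) cg (cD j)
  (fun t w => @rO j t w) (fun t w => @turn_joint j t w)
  (fun t h => turn_bv j t z h) (@chr_continuous R k)
  (@expi_continuous R).
move=> /(is_deriveZ (rc (2 * pi))^-1) h.
have -> : fproj j k g = (rc (2 * pi))^-1 \*:
  (fun w => Cintegral 0 (2 * pi) (fun t => g (turn j t w) * chr k t)) by [].
have -> // : fproj j (k - 1) ('D_(bv j) g) z = (rc (2 * pi))^-1 *:
  Cintegral 0 (2 * pi) (fun t => 'D_(bv j) g (turn j t z) * (expi t * chr k t)).
by congr (_ * _); apply: eq_Cintegral => t; rewrite chrB1.
Qed.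

Lemma fproj_hol j k g : hol Omega g -> hol Omega (fproj j k g).
Proof.
move=> hg; have [cg dg cD] := hg; split.
- exact: (@fproj_cont Omega g j k rO cg).
- move=> l z Oz; have [->|lj] := eqVneq l j.
    by have [h _] := fproj_derive j k hg Oz; exact: h.
  by have [h _] := fproj_derive_neq k lj hg Oz; exact: h.
- move=> l; have [->|lj] := eqVneq l j.
    have h := @fproj_cont Omega ('D_(bv j) g) j (k - 1) rO (cD j).
    apply: cont_on_eq h => z Oz.
    by have [_ ->] := fproj_derive j k hg Oz.
  have h := @fproj_cont Omega ('D_(bv l) g) j k rO (cD l).
  apply: cont_on_eq h => z Oz.
  by have [_ ->] := fproj_derive_neq k lj hg Oz.
Qed.

(** The derivative in [t] of g along the orbit of [z] is i times z_j d_j g at the rotated point, so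
    [mean_euler] applies. Nothing is divided by the coordinate, and points with [z ord0 j = 0] are
    included. *)
Lemma fproj_euler j k g z : hol Omega g -> Omega z ->
  z ord0 j * fproj j (k - 1) ('D_(bv j) g) z = k%:~R * fproj j k g z.
Proof.
move=> [cg dg cD] Oz.
have cv := @cont_on_turn Omega _ j z rO (cD j) Oz.
pose v t := z ord0 j * expi t * 'D_(bv j) g (turn j t z).
have cv' : continuous v.
  apply: continuousM_fun cv; apply: cont_mulc; exact: expi_continuous.
rewrite /fproj -(@mean_euler R (fun t => g (turn j t z)) v k cv').
- rewrite -(meanZ _ (@fproj_cont_fun Omega _ j _ z rO (cD j) Oz)).
  by apply: eq_mean => t; rewrite chrB1 /v; ring.
- move=> t.
  have dgam : rderive (fun x => (expi x - 1) * z ord0 j) t (imC R * (z ord0 j * expi t)).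
    have h := @rderive_expi R 1 t.
    have h2 := rderiveM h (@rderive_cst R (z ord0 j) t).
    rewrite rc1 mul1r mulr0 addr0 in h2.
    have -> : imC R * (z ord0 j * expi t) = imC R * expi (1 * t) * z ord0 j.
      by rewrite mul1r; ring.
    apply: cvg_near_eq h2 _; near=> x; rewrite !mul1r; ring.
  have Orot := rO j t Oz.
  have := rderive_comp dgam (derivable_is_derive (dg j _ Orot)).
  by congr (rderive _ _ _); rewrite /v /turn; ring.
- by rewrite turn2pi turn0.
Unshelve. all: by end_near. Qed.

End Rotation.

(** * The Cauchy formula and higher derivatives *)

Section Power.
Variable R : realType.
Local Notation C := (Cplx R).

Lemma is_derive_exprz (k : int) (w : C) : w != 0 ->
  is_derive w (1 : C) (fun s : C => s ^ k) (k%:~R * w ^ (k - 1)).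
Proof.
move=> w0.
have nat_case (n : nat) : is_derive w (1 : C) (fun s : C => s ^+ n) (n%:R * w ^+ n.-1).
  elim: n => [|n IH]; first by rewrite mul0r; exact: is_derive_cst.
  have -> : (fun s : C => s ^+ n.+1) = (fun s : C => s) * (fun s : C => s ^+ n).
    by apply/funext => s; rewrite exprS.
  apply: is_derive_eq (is_deriveM (@is_derive_id C C w (1 : C)) IH) _.
  rewrite /GRing.scale /= mulr1; case: n {IH} => [|n]; first by rewrite mul0r mulr0 add0r expr0 mulr1.
  by rewrite /= exprS -[in RHS]natr1; ring.
case: k => n.
  case: n => [|n].
    by rewrite mul0r; exact: is_derive_cst.
  apply: is_derive_eq (nat_case n.+1) _.
  by rewrite -[in RHS]pmulrn; congr (_ * _); rewrite intS addrAC subrr add0r.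
have [dn en] := nat_case n.+1.
have wn0 : w ^+ n.+1 != 0 by rewrite expf_neq0.
have -> : (fun s : C => s ^ Negz n) = (fun s : C => (s ^+ n.+1)^-1) by [].
apply: DeriveDef; first exact: (derivableV (f := fun s : C => s ^+ n.+1) wn0 dn).
rewrite (deriveV (f := fun s : C => s ^+ n.+1) wn0 dn) en /GRing.scale /= NegzE mulrNz -pmulrn.
have -> : - n.+1%:Z - 1 = - n.+2%:Z by lia.
rewrite -exprnN /= !mulNr; congr (- _); rewrite !exprS expr0.
have wn : w ^+ n != 0 by rewrite expf_neq0.
by move: wn; set a := w ^+ n => wn; field; rewrite wn w0.
Qed.

(** w^(-k) is an integrating factor: by Euler's relation phi(w) w^(-k) has derivative 0 along the
    segment. *)
Lemma euler_segment (phi phi' : C -> C) (k : int) (a b : C) :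
  (forall x : R, 0 <= x <= 1 -> a + rc x * (b - a) != 0) ->
  (forall x : R, 0 <= x <= 1 -> let w := a + rc x * (b - a) in
     is_derive w (1 : C) phi (phi' w) /\ w * phi' w = k%:~R * phi w) ->
  phi b * b ^ (- k) = phi a * a ^ (- k).
Proof.
move=> nz h.
pose g (s : C) := phi s * s ^ (- k).
have e x : a + (rc x * (b - a)) *: (1 : C) = a + rc x * (b - a).
  by congr (_ + _); exact: mulr1.
have h1 (x : R) : 0 <= x <= 1 ->
    is_derive (a + (rc x * (b - a)) *: (1 : C)) 1 g
      ((fun _ : C => 0 : C) (a + (rc x * (b - a)) *: (1 : C))).
  move=> x01; rewrite e; have w0 := nz x x01; have /= [d we] := h x x01.
  set w := a + _ in w0 d we *.
  apply: is_derive_eq (is_deriveM d (is_derive_exprz (- k) w0)) _.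
  rewrite /GRing.scale /=.
  have -> : w ^ (- k) = w * w ^ (- k - 1) by rewrite -[X in X * _]expr1z -expfzDr // addrC subrK.
  rewrite mulrAC [w * phi' w]we rmorphN /=; ring.
have h2 (x : R) : 0 <= x <= 1 -> `|(fun _ : C => 0 : C) (a + (rc x * (b - a)) *: (1 : C)) - 0| <= rc 0.
  by move=> _; rewrite subrr normr0 rc0.
have := @dir_mean_value R C g (fun _ : C => 0 : C) a 1 (b - a) 0 0 h1 h2.
rewrite !mulr0 rc0 mul0r subr0 normr_le0 subr_eq0 /g => /eqP.
have -> : a + (b - a) *: (1 : C) = b by rewrite [(b - a) *: _]mulr1 addrC subrK.
by [].
Qed.

Lemma eq_by_eps (a b : C) :
  (forall eps : R, 0 < eps -> `|a - b| <= rc eps) -> a = b.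
Proof.
move=> h; apply/eqP; rewrite -subr_eq0 -normr_le0.
have -> : `|a - b| = rc (complex.Re `|a - b|) by have [_] := ge0_Re (normr_ge0 (a - b)).
rewrite -rc0 rc_le; apply/ler_addgt0Pr => e e0; rewrite add0r -rc_le.
by have [_ <-] := ge0_Re (normr_ge0 (a - b)); exact: h.
Qed.

(* [H s = mean (phi (s e^it) e^-it)] satisfies Euler's relation [s H' = H], so
   [H s / s] is constant along rays and equals its limit [phi' 0] at the origin. *)
Lemma cauchy_derivative (phi : C -> C) (r rho : R) : 0 < r -> r < rho ->
  let U := [set w : C | `|w| < rc rho] in
  (forall w, U w -> derivable phi w 1) -> cont_on U phi -> cont_on U ('D_1 phi) ->
  rc r * 'D_1 phi 0 = mean (fun t => phi (rc r * expi t) * chr 1 t).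
Proof.
move=> r0 rrho U dphi cphi cD.
have oU : open U.
  have -> : U = ball (0 : C) (rc rho).
    by apply/seteqP; split => w; rewrite /U -ball_normE /ball_ /= sub0r normrN.
  exact: ball_open.
have U0 : U 0 by rewrite /U /= normr0 -rc0 rc_lt (lt_trans r0).
pose L (t : R) (w : C) : C := w * expi t.
have UL t w : U w -> U (L t w) by rewrite /U /L /= normrM norm_expi mulr1.
have cL (t : R) (w : C) : (fun p : R * C => L p.1 p.2) @ (t, w) --> L t w.
  have f1 : (fun p : R * C => p.1) @ filter_prod (nbhs t) (nbhs w) --> t by exact: cvg_fst.
  have f2 : (fun p : R * C => p.2) @ filter_prod (nbhs t) (nbhs w) --> w by exact: cvg_snd.
  have f3 : (fun p : R * C => expi p.1) @ filter_prod (nbhs t) (nbhs w) --> (expi t : C).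
    exact: cvg_comp f1 (@expi_continuous R t).
  have FF : Filter (filter_prod (nbhs t) (nbhs w)) by typeclasses eauto.
  exact: (cvgM f2 f3).
have Lh (w : C) (t : R) (h : C) : L t (w + h *: (1 : C)) = L t w + (h * expi t) *: (1 : C).
  by rewrite /L /GRing.scale /= !mulr1 mulrDl.
pose H (w : C) := mean (fun t => phi (L t w) * chr 1 t).
pose P (w : C) := mean (fun t => 'D_1 phi (L t w) * chr 0 t).
have dH w : U w -> is_derive w (1 : C) H (P w).
  move=> Uw.
  have := @is_derive_Cintegral R C 0 (2 * pi) U U phi L (@chr R 1) (@expi R) 1 w
    (ltW (twopi_gt0 R)) oU Uw oU dphi cphi cD UL cL (Lh w) (@chr_continuous R 1)
    (@expi_continuous R).
  move=> /(is_deriveZ (rc (2 * pi))^-1) h.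
  have -> : H = (rc (2 * pi))^-1 \*:
    (fun w => Cintegral 0 (2 * pi) (fun t => phi (L t w) * chr 1 t)) by [].
  have -> // : P w = (rc (2 * pi))^-1 *:
    Cintegral 0 (2 * pi) (fun t => 'D_1 phi (L t w) * (expi t * chr 1 t)).
  by congr (_ * _); apply: eq_Cintegral => t; rewrite -chrB1 subrr.
have cts (u : C -> C) w : cont_on U u -> U w -> continuous (fun t => u (L t w)).
  by move=> cu Uw; exact: cont_section oU cu cL (fun t => UL t w Uw).
have eH w : U w -> w * P w = 1%:~R * H w.
  move=> Uw.
  pose v t := w * expi t * 'D_1 phi (L t w).
  have cv : continuous v.
    apply: continuousM_fun (cts _ _ cD Uw); apply: cont_mulc; exact: expi_continuous.
  rewrite /H -(@mean_euler R (fun t => phi (L t w)) v 1 cv).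
  - rewrite /P -(meanZ w (continuousM_fun (cts _ _ cD Uw) (@chr_continuous R 0))).
    by apply: eq_mean => t; rewrite -[in LHS](subrr 1) chrB1 /v; ring.
  - move=> t.
    have dgam : rderive (fun x => w * expi x) t (imC R * (w * expi t)).
      have := @rderiveZ R w _ _ _ (@rderive_expi R 1 t); rewrite rc1 mul1r mulrCA mul1r.
      by under eq_fun do rewrite mul1r.
    have UL' := UL t w Uw.
    have := @rderive_comp R C phi 0 1 (fun x => w * expi x) t ('D_1 phi (L t w))
      (imC R * (w * expi t)) dgam.
    have e x : 0 + (w * expi x) *: (1 : C) = L x w.
      by rewrite add0r; exact: mulr1.
    rewrite e => /(_ (derivable_is_derive (dphi _ UL'))).
    under eq_fun do rewrite e.
    by congr (rderive _ _ _); rewrite /v; ring.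
  - by rewrite /L expi_2pi expi0.
have Ux (x : R) : 0 <= x -> x <= r -> U (rc x).
  move=> x0 xr; rewrite /U /= [X in X < _]normC_real rc_lt ger0_norm //.
  exact: le_lt_trans xr rrho.
have ray (x : R) : 0 < x -> x <= r -> H (rc x) / rc x = H (rc r) / rc r.
  move=> x0 xr.
  have pos y : 0 <= y <= 1 -> 0 < x + y * (r - x) <= r.
    move=> /andP[y0 y1]; apply/andP; split.
      by rewrite ltr_pwDl // mulr_ge0 // subr_ge0.
    by rewrite -lerBrDl ler_piMl // subr_ge0.
  have e y : rc x + rc y * (rc r - rc x) = rc (x + y * (r - x)).
    by rewrite rcD rcM rcB.
  have := @euler_segment H P 1 (rc x) (rc r).
  rewrite !exprN1 => hh; apply/esym/hh.
  - by move=> y /pos /andP[p _]; rewrite e rc_eq0 gt_eqF.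
  - move=> y /pos /andP[p q]; rewrite e.
    have Uy := Ux _ (ltW p) q.
    by split; [exact: dH|exact: eH].
have P0 : P 0 = 'D_1 phi 0.
  rewrite /P (eq_mean (g2 := fun=> 'D_1 phi 0)) ?mean_cst // => t.
  by rewrite /L mul0r chrE oppr0 expr0z mulr1.
have H0 : H 0 = 0.
  by have := eH _ U0; rewrite mul0r mulr1z mul1r.
have rn0 : rc r != 0 :> C by rewrite rc_eq0 gt_eqF.
suff -> : 'D_1 phi 0 = H (rc r) / rc r.
  by rewrite mulrC divfK //; apply: eq_mean => t; rewrite /L.
apply: eq_by_eps => eps eps0.
have /is_deriveP := dH _ U0; rewrite P0 => /cvgrPdist_le.
have e0 : 0 < rc eps :> C by rewrite -rc0 rc_lt.
move=> /(_ _ e0); rewrite near_withinE => /nbhs_normP[d /= /gt0_Re[d0 dE] sub].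
(* Small enough for the difference quotient of [H] at 0 to be within [eps] of [P 0], and at most [r]
   so that [ray] carries its value out to [r]. *)
pose x := Num.min r (complex.Re d / 2).
have x0 : 0 < x by rewrite lt_min r0 divr_gt0.
have xr : x <= r by rewrite ge_min lexx.
have := sub (rc x); rewrite /ball_ /= sub0r normrN [`|rc x|]normC_real dE rc_lt.
rewrite gtr0_norm // rc_eq0 gt_eqF // add0r H0 subr0 [_ *: _]mulr1 mulrC (ray x x0 xr).
apply => //.
rewrite (le_lt_trans (_ : _ <= complex.Re d / 2)) ?ge_min ?lexx ?orbT //.
by rewrite ltr_pdivrMr // mulr_natr mulr2n ltrDl.
Qed.

End Power.

(** * Partial derivatives of holomorphic functions in several variables *)

Section Smoothness.
Variables (R : realType) (n : nat).
Local Notation C := (Cplx R).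
Local Notation V := 'rV[C]_n.
Implicit Types (j l : 'I_n) (z p : V) (g : V -> C).

Definition polydisc p (r : R) : set V :=
  [set z | forall j, `|z ord0 j - p ord0 j| < rc r].

Lemma polydisc_ball p (r : R) : 0 < r -> polydisc p r = ball p (rc r).
Proof.
move=> r0; apply/seteqP; split => z.
- move=> h; split => [|i j]; first by rewrite -rc0 rc_lt.
  by rewrite ord1 -ball_normE /= distrC; exact: h.
- move=> [_ h] j; have := h ord0 j.
  by rewrite -ball_normE /= distrC.
Qed.

Lemma polydisc_open p (r : R) : 0 < r -> open (polydisc p r).
Proof.
move=> r0; rewrite polydisc_ball //; apply: ball_open; by rewrite -rc0 rc_lt.
Qed.

Lemma polydisc_center p (r : R) : 0 < r -> polydisc p r p.
Proof. by move=> r0 j; rewrite subrr normr0 -rc0 rc_lt. Qed.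

Lemma nbhs_polydisc p (A : set V) : nbhs p A ->
  exists2 r : R, 0 < r & polydisc p r `<=` A.
Proof.
move=> /nbhs_ballP[e /= /gt0_Re[e0 eE] sub].
exists (complex.Re e); first exact: e0.
apply: subset_trans sub => z pz; split => [|i j].
  by rewrite eE -rc0 rc_lt.
by rewrite ord1 -ball_normE /= distrC [X in _ < X]eE; exact: pz.
Qed.

Lemma slice_deriveP g z j (w d : C) :
  is_derive (w : C) (1 : C) (fun w : C => g (z + w *: bv R j)) d <->
  is_derive (z + w *: bv R j) (bv R j) g d.
Proof.
have e (h : C) : z + (w + h *: (1 : C)) *: bv R j = z + w *: bv R j + h *: bv R j.
  by rewrite [h *: _]mulr1 scalerDl addrA.
split=> /is_deriveP h; apply/is_deriveP; apply: cvg_near_eq h _; near=> x.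
  by rewrite e.
by rewrite e.
Unshelve. all: by end_near. Qed.

Lemma cont_on_slice (Omega : set V) g z j : cont_on Omega g ->
  cont_on [set w : C | Omega (z + w *: bv R j)] (fun w : C => g (z + w *: bv R j)).
Proof.
move=> cg w Ow.
have c : (fun w : C => z + w *: bv R j) @ nbhs w --> z + w *: bv R j.
  by apply: cvgD; [exact: cvg_cst|apply: cvgZr_tmp; exact: cvg_id].
have h : (fun w : C => z + w *: bv R j) @
    within [set w : C | Omega (z + w *: bv R j)] (nbhs w) -->
    within Omega (nbhs (z + w *: bv R j)).
  move=> A /= OA.
  have hh : \forall x \near w, Omega (z + x *: bv R j) -> A (z + x *: bv R j).
    exact: c _ OA.
  suff : \forall x \near within [set w : C | Omega (z + w *: bv R j)] (nbhs w),
    A (z + x *: bv R j) by [].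
  by rewrite near_withinE; apply: filterS hh => x hx Ox; exact: hx.
exact: cvg_comp h (cg _ Ow).
Qed.

Lemma cont_on_sub (W : normedModType C) (X Y : set W) (g : W -> C) :
  X `<=` Y -> cont_on Y g -> cont_on X g.
Proof.
move=> XY cg z Xz; have := cg z (XY _ Xz); apply: cvg_trans.
by apply: cvg_app; exact: within_subset.
Qed.

Lemma cauchy_partial (Omega : set V) g z j (r rho : R) : 0 < r -> r < rho ->
  (forall w : C, `|w| < rc rho -> Omega (z + w *: bv R j)) -> hol Omega g ->
  rc r * 'D_(bv R j) g z =
  mean (fun t => g (z + (rc r * expi t) *: bv R j) * chr 1 t).
Proof.
move=> r0 rrho sub [cg dg cD].
pose phi (w : C) := g (z + w *: bv R j).
have dphi (w : C) : `|w| < rc rho ->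
    is_derive (w : C) (1 : C) phi ('D_(bv R j) g (z + w *: bv R j)).
  move=> wr; apply/slice_deriveP; apply: derivable_is_derive; exact: dg (sub _ wr).
have := @cauchy_derivative R phi r rho r0 rrho.
have -> : 'D_1 phi 0 = 'D_(bv R j) g z.
  have [|_ ->] := dphi 0; last by rewrite scale0r addr0.
  by rewrite normr0 -rc0 rc_lt (lt_trans r0).
apply.
- by move=> w wr; have [h _] := dphi w wr; exact: h.
- by apply: cont_on_sub (@cont_on_slice Omega g z j cg) => w /sub.
- have h : cont_on [set w : C | `|w| < rc rho] (fun w : C => 'D_(bv R j) g (z + w *: bv R j)).
    by apply: cont_on_sub (@cont_on_slice Omega _ z j (cD j)) => w /sub.
  move=> w wr; have [_ ->] := dphi w wr.
  apply: cvg_near_eq (h w wr) _; rewrite near_withinE; near=> s => sr.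
  by have [_ ->] := dphi s sr.
Unshelve. all: by end_near. Qed.

Lemma cvg_cont_on (X : set V) g z : open X -> X z -> cont_on X g -> g @ nbhs z --> g z.
Proof.
move=> oX Xz /(_ z Xz); rewrite within_interior //.
by rewrite /interior; exact: open_near.
Qed.

Lemma cont_on_cvg (X : set V) g z : g @ nbhs z --> g z -> g @ within X (nbhs z) --> g z.
Proof. by apply: cvg_trans; apply: cvg_app; exact: cvg_within. Qed.

Lemma shift_joint j (r : R) (t : R) z :
  (fun p : R * V => p.2 + (rc r * expi p.1) *: bv R j) @ (t, z) -->
  z + (rc r * expi t) *: bv R j.
Proof.
have FF : Filter (filter_prod (nbhs t) (nbhs z)) by typeclasses eauto.
have f1 : (fun p : R * V => p.1) @ filter_prod (nbhs t) (nbhs z) --> t by exact: cvg_fst.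
have f2 : (fun p : R * V => p.2) @ filter_prod (nbhs t) (nbhs z) --> z by exact: cvg_snd.
have f3 : (fun p : R * V => expi p.1) @ filter_prod (nbhs t) (nbhs z) --> (expi t : C).
  exact: cvg_comp f1 (@expi_continuous R t).
have h3 : (fun p : R * V => p.2 + (rc r * expi p.1) *: bv R j) @ filter_prod (nbhs t) (nbhs z)
    --> z + (rc r * expi t) *: bv R j.
  by apply: cvgD; [exact: f2|apply: cvgZr_tmp; exact: cvgM (cvg_cst _) f3].
exact: h3.
Qed.

Variable Omega : set V.
Hypothesis oO : open Omega.

(** One radius serves all [z] near [p] and all [g]. The formula can therefore be differentiated in
    [z], and used for a derivative of [g] on the same circle. *)
Lemma partial_derive_local j p : Omega p ->
  exists (r : R) (X : set V), [/\ 0 < r, open X, X p, X `<=` Omega &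
    (forall t z, X z -> Omega (z + (rc r * expi t) *: bv R j)) /\
    forall g, hol Omega g -> forall z, X z -> rc r * 'D_(bv R j) g z =
      mean (fun t => g (z + (rc r * expi t) *: bv R j) * chr 1 t)].
Proof.
move=> Op; have [r0 r00 sub] := nbhs_polydisc (open_near oO Op).
(* A centre at distance less than [r] from [p] and a displacement of size less than [2 * r] stay
   together within [r0]. *)
pose r := r0 / 3; have r_gt0 : 0 < r by rewrite divr_gt0.
have in_O z (w : C) : polydisc p r z -> `|w| < rc (2 * r) -> Omega (z + w *: bv R j).
  move=> Xz w2; apply: sub => i; rewrite coord_bv.
  have -> : z ord0 i + w * (i == j)%:R - p ord0 i = (z ord0 i - p ord0 i) + w * (i == j)%:R by ring.
  apply: le_lt_trans (ler_normD _ _) _.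
  have -> : r0 = r + 2 * r by rewrite /r; field.
  rewrite rcD ltrD // normrM; apply: le_lt_trans w2.
  by rewrite ler_piMr //; case: eqP; rewrite ?normr1 ?normr0 ?ler01.
have rr : r < 2 * r by rewrite mulr_natl mulr2n ltrDl.
have abs_r t : `|rc r * expi t : C| < rc (2 * r).
  by rewrite normrM norm_expi mulr1 [X in X < _]normC_real rc_lt gtr0_norm.
exists r, (polydisc p r); split => //.
- exact: polydisc_open.
- exact: polydisc_center.
- move=> z Xz; apply: sub => i; apply: lt_trans (Xz i) _.
  by rewrite rc_lt /r ltr_pdivrMr // ltr_pMr // ltr1n.
- split; first by move=> t z Xz; exact: in_O.
  by move=> h hh z Xz; apply: (cauchy_partial r_gt0 rr _ hh) => w; exact: in_O.
Qed.

(** Both mixed derivatives are the same Cauchy integral of ['D_(bv R l) g], which later gives their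
    symmetry. The second equality is conditional because [hol_partial], which supplies the
    condition, is itself deduced from the other parts. *)
Lemma partial_formula_derive j l p g : Omega p -> hol Omega g ->
  exists (r : R) (X : set V), [/\ 0 < r, open X, X p, X `<=` Omega &
    forall z, X z -> is_derive z (bv R l) ('D_(bv R j) g)
       ((rc r)^-1 * mean (fun t => 'D_(bv R l) g (z + (rc r * expi t) *: bv R j) * chr 1 t))
     /\ (hol Omega ('D_(bv R l) g) -> 'D_(bv R j) ('D_(bv R l) g) z =
     (rc r)^-1 * mean (fun t => 'D_(bv R l) g (z + (rc r * expi t) *: bv R j) * chr 1 t))] /\
    cont_on X (fun z => (rc r)^-1 *
      mean (fun t => 'D_(bv R l) g (z + (rc r * expi t) *: bv R j) * chr 1 t)).
Proof.
move=> Op hg; have [r [X [r0 oX Xp XO [LO formula]]]] := partial_derive_local j Op.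
have rn0 : rc r != 0 :> C by rewrite rc_eq0 gt_eqF.
have [cg dg cD] := hg.
exists r, X; split; last first.
  move=> w Xw; apply: cvgM; first exact: cvg_cst.
  apply: cvgM; first exact: cvg_cst.
  apply: (@Cintegral_cont_on R V 0 (2 * pi) X Omega ('D_(bv R l) g)
    (fun t w => w + (rc r * expi t) *: bv R j) (@chr R 1) (ltW (twopi_gt0 R))
    (cD l) LO (fun t w => @shift_joint j r t w) (@chr_continuous R 1) w Xw).
split => // z Xz; split; last first.
  by move=> hl; rewrite -(formula _ hl z Xz) mulKf.
have Lh t h : z + h *: bv R l + (rc r * expi t) *: bv R j =
    z + (rc r * expi t) *: bv R j + (h * 1) *: bv R l by rewrite mulr1 addrAC.
have := @is_derive_Cintegral R V 0 (2 * pi) X Omega g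
  (fun t w => w + (rc r * expi t) *: bv R j) (@chr R 1)
  (fun=> 1) (bv R l) z (ltW (twopi_gt0 R)) oX Xz oO (dg l) cg (cD l)
  LO (fun t w => @shift_joint j r t w) Lh (@chr_continuous R 1)
  (@continuous_cst_fun R 1).
move=> /(is_deriveZ ((rc r)^-1 * (rc (2 * pi))^-1)) h.
apply: (is_derive_eq_on oX Xz (g1 := ((rc r)^-1 * (rc (2 * pi))^-1) \*:
  (fun w => Cintegral 0 (2 * pi) (fun t => g (w + (rc r * expi t) *: bv R j) * chr 1 t)))).
  move=> w Xw; rewrite /= -[LHS]mulrA.
  by have := formula _ hg w Xw; rewrite /mean => <-; rewrite mulKf.
apply: is_derive_eq h _.
rewrite [LHS]/GRing.scale /= -mulrA; congr (_ * (_ * _)).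
by apply: eq_Cintegral => t; rewrite mul1r.
Qed.

(* The Cauchy formula on a circle of fixed radius expresses [D_j g] near a point as
   an integral of [g], which can be differentiated under the integral sign. *)
Lemma hol_partial j g : hol Omega g -> hol Omega ('D_(bv R j) g).
Proof.
move=> hg; have [cg dg cD] := hg; split; first exact: cD.
  move=> l p Op; have [r [X [[r0 oX Xp XO formula] cX]]] := partial_formula_derive j l Op hg.
  by have [[h _] _] := formula p Xp; exact: h.
move=> l p Op; have [r [X [[r0 oX Xp XO formula] cX]]] := partial_formula_derive j l Op hg.
have c : cont_on X ('D_(bv R l) ('D_(bv R j) g)).
  by apply: (cont_on_eq _ cX) => w Xw; have [[_ e] _] := formula w Xw; exact: esym e.
by apply: cont_on_cvg; exact: cvg_cont_on oX Xp c.
Qed.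

Lemma partialC j l g z : hol Omega g -> Omega z ->
  'D_(bv R l) ('D_(bv R j) g) z = 'D_(bv R j) ('D_(bv R l) g) z.
Proof.
move=> hg Oz; have [r [X [[r0 oX Xz XO formula] cX]]] := partial_formula_derive j l Oz hg.
have [[_ e1] e2] := formula z Xz.
exact: etrans e1 (esym (e2 (hol_partial l hg))).
Qed.

End Smoothness.

(** * Fourier inversion at a point *)

Section Inversion.
Variable R : realType.
Local Notation C := (Cplx R).
Local Notation Re := (@complex.Re R).
Local Notation Im := (@complex.Im R).

Definition fcoef (G : R -> C) (k : int) : C := mean (fun t => G t * chr k t).

Definition cj (z : C) : C := Re z -i* Im z.
Definition sqn (z : C) : R := Re z ^+ 2 + Im z ^+ 2.

Lemma sqn_ge0 z : 0 <= sqn z.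
Proof. by rewrite addr_ge0 // sqr_ge0. Qed.

Lemma mul_cj z : z * cj z = rc (sqn z).
Proof.
apply/eqP; rewrite eq_complex cReM cImM /sqn; apply/andP; split; apply/eqP => /=; ring.
Qed.

Lemma cjM a b : cj (a * b) = cj a * cj b.
Proof.
case: a b => [a1 a2] [b1 b2]; apply/eqP; rewrite eq_complex /cj /=.
by apply/andP; split; apply/eqP; ring.
Qed.

Lemma cjB a b : cj (a - b) = cj a - cj b.
Proof.
case: a b => [a1 a2] [b1 b2]; apply/eqP; rewrite eq_complex /cj /=.
by apply/andP; split; apply/eqP; ring.
Qed.

Lemma cj_chr k t : cj (chr k t) = chr (- k) t :> C.
Proof.
rewrite /chr /cj /expi /= mulrNz mulNr opprK cosN sinN opprK //.
Qed.

Lemma cj_continuous (g : R -> C) : continuous g -> continuous (fun t => cj (g t)).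
Proof.
move=> cg t; apply: cvg_ReIm; first exact: continuous_Re cg t.
have h : (fun s => - Im (g s)) @ t --> - Im (g t).
  by apply: cvgN; exact: continuous_Im cg t.
exact: h.
Qed.

Lemma mean_cj (g : R -> C) : continuous g -> mean (fun t => cj (g t)) = cj (mean g).
Proof.
move=> cg; rewrite /mean.
have -> : cj ((rc (2 * pi))^-1 * Cintegral 0 (2 * pi) g) =
    (rc (2 * pi))^-1 * cj (Cintegral 0 (2 * pi) g).
  by rewrite cjM -rcV; congr (_ * _); rewrite /cj /rc /= oppr0.
congr (_ * _); rewrite /Cintegral /cj /=; congr (_ +i* _).
rewrite -[RHS]mulN1r -RintegralZl //.
  by apply: eq_Rintegral => x _; rewrite mulN1r.
exact/continuous_itv_integrable/continuous_Im.
Qed.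

(** The squared L^2 norm on the circle with normalized measure. *)
Definition energy (G : R -> C) : R := Re (mean (fun t => rc (sqn (G t)))).

Lemma energy_ge0 G : 0 <= energy G.
Proof.
rewrite /energy /mean -rcV cReM /= mul0r subr0 mulr_ge0 ?invr_ge0 ?(ltW (twopi_gt0 R)) //.
by apply: Rintegral_ge0 => x _; exact: sqn_ge0.
Qed.

(** Removing one Fourier mode: orthogonality of the characters lowers the energy by the squared
    modulus of the coefficient and leaves the other coefficients unchanged. *)
Lemma bessel_step (G : R -> C) (k : int) : continuous G ->
  let G1 t := G t - fcoef G k * chr (- k) t in
  [/\ continuous G1, energy G1 = energy G - sqn (fcoef G k) &
   forall l, l != k -> fcoef G1 l = fcoef G l].
Proof.
move=> cG; set c := fcoef G k => G1.
have cch l := @chr_continuous R l.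
have cc l : continuous (fun t => c * chr l t) by apply: cont_mulc; exact: cch.
have cG1 : continuous G1 by move=> t; exact: cvgB (cG t) (cc (- k) t).
have cGk l := continuousM_fun cG (cch l).
split => //.
  have e' (a : C) t : rc (sqn (G t - a * chr (- k) t)) =
      rc (sqn (G t)) - a * (cj (G t * chr k t)) - (cj a * (G t * chr k t) - rc (sqn a)).
    rewrite -!mul_cj cjB !cjM !cj_chr opprK.
    have h : chr (- k) t * chr k t = 1 :> C.
      by rewrite -chrD addNr chrE oppr0 expr0z.
    have -> : (G t - a * chr (- k) t) * (cj (G t) - cj a * chr k t) =
      G t * cj (G t) - a * (cj (G t) * chr (- k) t) - cj a * (G t * chr k t) +
      a * cj a * (chr (- k) t * chr k t) by ring.
    by rewrite h; ring.
  have e t : rc (sqn (G1 t)) = rc (sqn (G t)) - c * (cj (G t * chr k t)) -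
      (cj c * (G t * chr k t) - rc (sqn c)) by exact: e'.
  have c1 : continuous (fun t => rc (sqn (G t))).
    move=> t; have h : (fun s => G s * cj (G s)) @ t --> G t * cj (G t).
      exact: cvgM (cG t) (@cj_continuous _ cG t).
    rewrite /continuous_at -mul_cj; apply: cvg_near_eq h _.
    by apply: filterS (@filterT _ (nbhs t) _) => s _; exact: mul_cj.
  have c2 := @cont_mulc R c _ (cj_continuous (cGk k)).
  have c3 := @cont_mulc R (cj c) _ (cGk k).
  have c4 := @continuous_cst_fun R (rc (sqn c)).
  have c12 : continuous (fun t => rc (sqn (G t)) - c * cj (G t * chr k t)).
    by move=> t; exact: cvgB (c1 t) (c2 t).
  have c34 : continuous (fun t => cj c * (G t * chr k t) - rc (sqn c)).
    by move=> t; exact: cvgB (c3 t) (c4 t).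
  rewrite /energy (eq_mean e) (meanB c12 c34) (meanB c1 c2) (meanB c3 c4).
  rewrite (meanZ _ (cj_continuous (cGk k))) (mean_cj (cGk k)) (meanZ _ (cGk k)).
  rewrite -/(fcoef G k) -/c mean_cst [cj c * c]mulrC mul_cj.
  by rewrite !cReB /= subrr subr0.
move=> l lk.
rewrite /fcoef (eq_mean (g2 := fun t => G t * chr l t - c * chr (l - k) t)); last first.
  by move=> t; rewrite /G1 chrD; ring.
rewrite (meanB (cGk l) (cc _)) (meanZ _ (cch _)) mean_chr subr_eq0 (negPf lk).
by rewrite mulr0 subr0.
Qed.

Lemma bessel (ks : seq int) (G : R -> C) : continuous G -> uniq ks ->
  \sum_(k <- ks) sqn (fcoef G k) <= energy G.
Proof.
elim: ks G => [|k ks IH] G cG; first by rewrite big_nil energy_ge0.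
move=> /= /andP[kks uks]; have [cG1 e1 e2] := bessel_step k cG.
rewrite big_cons -lerBrDl -e1.
rewrite (eq_big_seq (fun l => sqn (fcoef (fun t => G t - fcoef G k * chr (- k) t) l))).
  exact: IH.
by move=> l lks; rewrite e2 //; apply: contraNneq kks => <-.
Qed.

Lemma norm_sqn (z : C) (eps : R) : 0 <= eps -> sqn z <= eps ^+ 2 -> `|z| <= rc eps.
Proof.
move=> e0 h; rewrite norm_ReIm rc_le -(ger0_norm e0) -sqrtr_sqr.
exact: ler_wsqrtr.
Qed.

(** By Bessel's inequality the squared moduli along an injective sequence of indices have bounded
    partial sums; their series converges and its terms tend to 0. *)
Lemma riemann_lebesgue (G : R -> C) (h : nat -> int) : continuous G -> injective h ->
  (fun m => fcoef G (h m)) @ \oo --> (0 : C).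
Proof.
move=> cG ih.
pose u m := sqn (fcoef G (h m)).
have cu : u @ \oo --> (0 : R).
  apply: cvg_series_cvg_0; apply: nondecreasing_is_cvgn.
    by apply: nondecreasing_series => m _ _; exact: sqn_ge0.
  exists (energy G) => _ [m _ <-].
  rewrite /series /= -[X in X <= _](big_map h xpredT (fun k => sqn (fcoef G k))).
  by apply: bessel => //; rewrite map_inj_uniq // iota_uniq.
apply/cvgrPdist_le => eps /gt0_Re[e0 ->].
have e2 : 0 < Re eps ^+ 2 by rewrite exprn_gt0.
move/cvgrPdist_le : cu => /(_ _ e2); apply: filterS => m.
rewrite !sub0r !normrN ger0_norm ?sqn_ge0 // => hm.
by apply: norm_sqn => //; exact: ltW.
Qed.

(* If [F - F 0] is divisible by [e^it - 1] with a continuous quotient [G], the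
   symmetric partial Fourier sums of [F] at 0 telescope to [F 0] plus two
   Fourier coefficients of [G], which tend to 0. *)
Lemma fourier_inversion (F G : R -> C) (F0 : C) : continuous F -> continuous G ->
  (forall t, F t - F0 = (expi t - 1) * G t) ->
  (fun M : nat => \sum_(0 <= i < M.*2.+1) fcoef F (i%:Z - M%:Z)) @ \oo --> F0.
Proof.
move=> cF cG FG.
have cGk l := continuousM_fun cG (@chr_continuous R l).
have cch l := @chr_continuous R l.
(* Multiplication by [expi t] shifts the Fourier index by one, so the factor [expi t - 1] produces a
   difference of consecutive coefficients. *)
have fF k : fcoef F k = F0 * (k == 0)%:R + (fcoef G (k - 1) - fcoef G k).
  have c5 := @cont_mulc R F0 _ (cch k).
  have c6 : continuous (fun t => G t * chr (k - 1) t - G t * chr k t).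
    by move=> t; exact: cvgB (cGk _ t) (cGk _ t).
  have h1 : mean (fun t => F0 * chr k t) = F0 * (k == 0)%:R.
    by rewrite (meanZ _ (cch k)) mean_chr.
  have h2 := meanB (cGk (k - 1)) (cGk k).
  rewrite -h1 /fcoef -h2 -(meanD c5 c6); apply: eq_mean => t.
  by rewrite chrB1 -[F t](subrK F0) FG; ring.
have tel (M : nat) : \sum_(0 <= i < M.*2.+1) fcoef F (i%:Z - M%:Z) =
    F0 + (fcoef G (- M.+1%:Z) - fcoef G M%:Z).
  under eq_bigr do rewrite fF.
  rewrite big_split /=; congr (_ + _).
    rewrite (bigD1_seq M) ?iota_uniq ?mem_index_iota //=; last by lia.
    rewrite subrr eqxx mulr1 big1 ?addr0 // => i iM.
    by rewrite subr_eq0 eqz_nat (negPf iM) mulr0.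
  pose u (i : nat) := - fcoef G (i%:Z - M%:Z - 1).
  rewrite (eq_bigr (fun i => u i.+1 - u i)); last first.
    move=> i _; rewrite /u opprK [RHS]addrC; congr (_ - fcoef G _); lia.
  rewrite telescope_sumr // /u opprK addrC; congr (fcoef G _ - fcoef G _); lia.
have l1 := @riemann_lebesgue G (fun M => - M.+1%:Z) cG.
have l2 := @riemann_lebesgue G (fun M => M%:Z) cG.
have h : (fun M : nat => F0 + (fcoef G (- M.+1%:Z) - fcoef G M%:Z)) @ \oo --> F0 + (0 - 0).
  have i1 : injective (fun M => - M.+1%:Z) by move=> a b /oppr_inj [].
  have i2 : injective (fun M => M%:Z) by move=> a b [].
  exact: cvgD (cvg_cst F0) (cvgB (l1 i1) (l2 i2)).
rewrite subr0 addr0 in h; apply: cvg_near_eq h _.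
by near=> M; rewrite tel.
Unshelve. all: by end_near. Qed.

Variable n : nat.
Local Notation V := 'rV[C]_n.
Variable Omega : set V.
Hypothesis oO : open Omega.
Hypothesis rO : rot_inv Omega.

(** Moving [z] by the angle [t] displaces it by (e^it - 1) z_j along [bv R j]; hence the quotient
    required by [fourier_inversion] is z_j times the completed divided difference of [g] at [z]. *)
Lemma fproj_inversion (j : 'I_n) (g : V -> C) (z : V) : hol Omega g -> Omega z ->
  (fun M : nat => \sum_(0 <= i < M.*2.+1) fproj j (i%:Z - M%:Z) g z) @ \oo --> g z.
Proof.
move=> [cg dg cD] Oz.
pose D := 'D_(bv R j) g z.
have dz : is_derive z (bv R j) g D by apply: derivable_is_derive; exact: dg.
pose q := dquot g z (bv R j) D.
pose eta (t : R) : C := (expi t - 1) * z ord0 j.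
have ceta : continuous eta.
  by move=> t; exact: cvgM (cvgB (@expi_continuous R t) (cvg_cst _)) (cvg_cst _).
have cF := @cont_on_turn R n Omega g j z rO cg Oz.
have cq : continuous (fun t => q (eta t)).
  (* [eta] vanishes at full turns, and identically when [z ord0 j = 0]; there continuity comes from
     differentiability of [g] at [z], elsewhere from continuity of the quotient. *)
  move=> t; rewrite /continuous_at; have [e0|e0] := eqVneq (eta t) 0.
    have h := ceta t; rewrite /continuous_at e0 in h.
    have -> : q (eta t) = D by rewrite /q /dquot e0 eqxx.
    exact: cvg_comp h (dquot_cvg dz).
  have h : (fun s => (eta s)^-1 * (g (turn j s z) - g z)) @ t -->
      (eta t)^-1 * (g (turn j t z) - g z).
    exact: cvgM (cvgV e0 (ceta t)) (cvgB (cF t) (cvg_cst _)).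
  have -> : q (eta t) = (eta t)^-1 * (g (turn j t z) - g z).
    by rewrite /q /dquot (negPf e0).
  apply: cvg_near_eq h _.
  have ne : \forall s \near t, eta s != 0 by exact: cvgr_neq0 (ceta t) e0.
  by apply: filterS ne => s s0; rewrite /q /dquot (negPf s0).
have cG := @cont_mulc R (z ord0 j) _ cq.
apply: (fourier_inversion cF cG) => t.
by rewrite {1}/turn (dquotE g z (bv R j) D) mulrA.
Qed.

End Inversion.

(** * Iterated projections *)

Section IteratedOperators.
Variables (R : realType) (n : nat).
Local Notation C := (Cplx R).
Local Notation V := 'rV[C]_n.
Implicit Types (j l : 'I_n) (z : V) (g f : V -> C) (s t : seq 'I_n)
  (a : 'rV[int]_n) (b : 'rV[nat]_n).

(* With [s = enum 'I_n] and [g = f], this is the Laurent term of index [a] of [f]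
   (see [euler_connected] and [laurent_coefE]); the nesting of the integrals is
   that of [torus_integral]. *)
Definition fprojs s a g : V -> C := foldr (fun j h => fproj j (a ord0 j) h) g s.

Definition partials t b f : V -> C :=
  foldr (fun j g => iter (b ord0 j) (partial j) g) f t.

(** The derivatives that two integrations by parts in each coordinate of [t] produce. *)
Definition second_partials t g : V -> C := foldr (fun j h => partial j (partial j h)) g t.

Definition dec l a : 'rV[int]_n := \row_i (a ord0 i - (i == l)%:Z).
Definition inc l b : 'rV[nat]_n := \row_i (b ord0 i + (i == l))%N.

Lemma fprojs_cont (X : set V) s a g : rot_inv X -> cont_on X g -> cont_on X (fprojs s a g).
Proof.
by move=> rX cg; elim: s => [//|j s IH] /=; exact: fproj_cont rX IH.
Qed.

Lemma eq_fprojs s a1 a2 g : {in s, forall j, a1 ord0 j = a2 ord0 j} -> fprojs s a1 g = fprojs s a2 g.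
Proof.
elim: s => [//|j s IH] h; rewrite /= (h j (mem_head j s)).
have -> : fprojs s a1 g = fprojs s a2 g.
  by apply: IH => l ls; apply: h; rewrite in_cons ls orbT.
reflexivity.
Qed.

Variable Omega : set V.
Hypothesis oO : open Omega.
Hypothesis rO : rot_inv Omega.

(** Functions are total but meaningful on the domain only, so operator identities are stated there.
    Derivation respects this relation since the domain is open, projection since it is rotation
    invariant. *)
Definition eqon g1 g2 := forall z, Omega z -> g1 z = g2 z.

Lemma eqon_trans g1 g2 g3 : eqon g1 g2 -> eqon g2 g3 -> eqon g1 g3.
Proof. by move=> h1 h2 z Oz; rewrite h1 // h2. Qed.

Lemma partial_eqon j g1 g2 : hol Omega g1 -> eqon g1 g2 ->
  eqon (partial j g1) (partial j g2).
Proof.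
move=> [_ dg _] e z Oz.
have := is_derive_eq_on oO Oz e (derivable_is_derive (dg j z Oz)).
by move=> [_ h]; exact: esym h.
Qed.

Lemma hol_eqon g1 g2 : hol Omega g1 -> eqon g1 g2 -> hol Omega g2.
Proof. by move=> h e; exact: hol_eq oO e h. Qed.

Lemma partial_hol j g : hol Omega g -> hol Omega (partial j g).
Proof. exact: (hol_partial oO j). Qed.

Lemma partial_comm j l g : hol Omega g ->
  eqon (partial l (partial j g)) (partial j (partial l g)).
Proof. by move=> hg z Oz; exact: (partialC oO j l hg Oz). Qed.

Lemma fproj_eqon j k g1 g2 : eqon g1 g2 -> eqon (fproj j k g1) (fproj j k g2).
Proof. by move=> e z Oz; apply: eq_fproj => t; apply: e; exact: rO. Qed.

Lemma partial_fproj j k g : hol Omega g ->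
  eqon (partial j (fproj j k g)) (fproj j (k - 1) (partial j g)).
Proof. by move=> hg z Oz; have [_ h] := fproj_derive oO rO j k hg Oz; exact: h. Qed.

Lemma partial_fproj_neq j l k g : l != j -> hol Omega g ->
  eqon (partial l (fproj j k g)) (fproj j k (partial l g)).
Proof. by move=> lj hg z Oz; have [_ h] := fproj_derive_neq oO rO k lj hg Oz; exact: h. Qed.

Lemma fprojs_hol s a g : hol Omega g -> hol Omega (fprojs s a g).
Proof. by move=> hg; elim: s => [//|j s IH] /=; exact: fproj_hol oO rO _ _ _ IH. Qed.

Lemma fprojs_eqon s a g1 g2 : eqon g1 g2 -> eqon (fprojs s a g1) (fprojs s a g2).
Proof. by move=> e; elim: s => [//|j s IH] /=; exact: fproj_eqon. Qed.

Lemma partial_fprojs_notin l s a g : hol Omega g -> l \notin s ->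
  eqon (partial l (fprojs s a g)) (fprojs s a (partial l g)).
Proof.
move=> hg; elim: s => [//|j s IH] /=; rewrite in_cons negb_or => /andP[lj ls].
apply: eqon_trans (partial_fproj_neq _ lj (fprojs_hol s a hg)) _.
exact: fproj_eqon (IH ls).
Qed.

Lemma partial_fprojs_in l s a g : hol Omega g -> uniq s -> l \in s ->
  eqon (partial l (fprojs s a g)) (fprojs s (dec l a) (partial l g)).
Proof.
move=> hg; elim: s => [//|j s IH] /= /andP[js us]; rewrite in_cons.
have [-> _|lj /= ls] := eqVneq l j.
  apply: eqon_trans (partial_fproj j _ (fprojs_hol s a hg)) _.
  rewrite mxE eqxx.
  rewrite -(@eq_fprojs s a (dec j a)); last first.
    by move=> i is_; rewrite mxE; case: eqP => [e|]; [rewrite -e is_ in js|rewrite subr0].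
  exact: fproj_eqon (partial_fprojs_notin a hg js).
apply: eqon_trans (partial_fproj_neq _ lj (fprojs_hol s a hg)) _.
rewrite mxE eq_sym (negPf lj) subr0.
exact: fproj_eqon (IH us ls).
Qed.

Lemma fproj_coord j l k g z : l != j -> cont_on Omega g -> Omega z ->
  fproj j k (fun w => w ord0 l * g w) z = z ord0 l * fproj j k g z.
Proof.
move=> lj cg Oz; rewrite -(fprojZ j k (z ord0 l) rO cg Oz).
by apply: eq_fproj => t; rewrite turnE (negPf lj).
Qed.

(** For the outermost coordinate this is [fproj_euler]. Otherwise the derivative and the factor
    [z ord0 l] pass under the projection in [j], whose rotations fix coordinate [l]. *)
Lemma fprojs_euler l s a g z : hol Omega g -> uniq s -> l \in s -> Omega z ->
  z ord0 l * partial l (fprojs s a g) z = (a ord0 l)%:~R * fprojs s a g z.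
Proof.
move=> hg; elim: s z => [//|j s IH] z /= /andP[js us]; rewrite in_cons.
have hF := fprojs_hol s a hg.
have [-> _ Oz|lj /= ls Oz] := eqVneq l j.
  by rewrite (partial_fproj j _ hF Oz); exact: (fproj_euler rO j _ hF Oz).
rewrite (partial_fproj_neq _ lj hF Oz).
have [cF _ _] := hF; have [cpF _ _] := partial_hol l hF.
rewrite -(fproj_coord _ lj cpF Oz) -(fprojZ j (a ord0 j) _ rO cF Oz).
by apply: (fproj_eqon _ _ _ Oz) => w Ow; exact: IH.
Qed.

Lemma iter_hol m j g : hol Omega g -> hol Omega (iter m (partial j) g).
Proof. by move=> hg; elim: m => [//|m IH]; rewrite iterS; exact: partial_hol. Qed.

Lemma iter_eqon m j g1 g2 : hol Omega g1 -> eqon g1 g2 ->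
  eqon (iter m (partial j) g1) (iter m (partial j) g2).
Proof.
move=> hg e; elim: m => [//|m IH]; rewrite !iterS.
by apply: partial_eqon IH; exact: iter_hol.
Qed.

Lemma partials_hol t b g : hol Omega g -> hol Omega (partials t b g).
Proof. by move=> hg; elim: t => [//|j t IH] /=; exact: iter_hol. Qed.

Lemma partials_eqon t b g1 g2 : hol Omega g1 -> eqon g1 g2 -> eqon (partials t b g1) (partials t b g2).
Proof.
by move=> hg e; elim: t => [//|j t IH] /=; apply: iter_eqon IH; exact: partials_hol.
Qed.

Lemma partial_iter m j l g : hol Omega g ->
  eqon (partial l (iter m (partial j) g)) (iter m (partial j) (partial l g)).
Proof.
move=> hg; elim: m => [//|m IH]; rewrite !iterS.
apply: eqon_trans (partial_comm j l (iter_hol m j hg)) _.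
by apply: partial_eqon IH; apply: partial_hol; exact: iter_hol.
Qed.

Lemma eq_partials t b1 b2 g : {in t, forall j, b1 ord0 j = b2 ord0 j} ->
  partials t b1 g = partials t b2 g.
Proof.
elim: t => [//|j t IH] h; rewrite /= (h j (mem_head j t)).
have -> : partials t b1 g = partials t b2 g.
  by apply: IH => l ls; apply: h; rewrite in_cons ls orbT.
reflexivity.
Qed.

Lemma partial_partials l t b g : hol Omega g -> uniq t -> l \in t ->
  eqon (partial l (partials t b g)) (partials t (inc l b) g).
Proof.
move=> hg; elim: t => [//|j t IH] /= /andP[jt ut]; rewrite in_cons.
have [-> _|lj /= lt] := eqVneq l j.
  rewrite mxE eqxx addn1 iterS -(@eq_partials t b (inc j b)) // => i it.
  by rewrite mxE; case: eqP => [e|]; [rewrite -e it in jt|rewrite addn0].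
apply: eqon_trans (partial_iter _ j l (partials_hol t b hg)) _.
rewrite mxE eq_sym (negPf lj) addn0.
by apply: iter_eqon (IH ut lt); apply: partial_hol; exact: partials_hol.
Qed.

Lemma Dmulti_hol b g : hol Omega g -> hol Omega (Dmulti b g).
Proof. exact: (@partials_hol (enum 'I_n) b g). Qed.

Lemma Dmulti_eqon b g1 g2 : hol Omega g1 -> eqon g1 g2 -> eqon (Dmulti b g1) (Dmulti b g2).
Proof. exact: (@partials_eqon (enum 'I_n) b g1 g2). Qed.

Lemma partial_Dmulti l b g : hol Omega g -> eqon (partial l (Dmulti b g)) (Dmulti (inc l b) g).
Proof.
by move=> hg; apply: (@partial_partials l (enum 'I_n) b g hg); rewrite ?enum_uniq ?mem_enum.
Qed.

Lemma second_partials_hol t g : hol Omega g -> hol Omega (second_partials t g).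
Proof. by move=> hg; elim: t => [//|j t IH] /=; do 2 apply: partial_hol. Qed.

(** Brings these derivatives to the form [Dmulti], for which membership in [Ainfty] provides an
    extension to the closure and hence bounds. *)
Lemma second_partials_Dmulti t b g : hol Omega g -> uniq t ->
  eqon (second_partials t (Dmulti b g)) (Dmulti (\row_i (b ord0 i + (i \in t).*2)%N) g).
Proof.
move=> hg; elim: t => [_|j t IH /= /andP[jt ut]].
  move=> z _ /=; congr (Dmulti _ g z); apply/rowP => i.
  by rewrite mxE /= addn0.
have h1 := IH ut.
have h2 : eqon (partial j (second_partials t (Dmulti b g)))
    (Dmulti (inc j (\row_i (b ord0 i + (i \in t).*2)%N)) g).
  apply: eqon_trans (partial_Dmulti j _ hg).
  by apply: partial_eqon h1; apply: second_partials_hol; exact: Dmulti_hol.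
have h3 : eqon (partial j (partial j (second_partials t (Dmulti b g))))
    (Dmulti (inc j (inc j (\row_i (b ord0 i + (i \in t).*2)%N))) g).
  apply: eqon_trans (partial_Dmulti j _ hg).
  by apply: partial_eqon h2; apply: partial_hol; apply: second_partials_hol; exact: Dmulti_hol.
apply: eqon_trans h3 _ => z _; congr (Dmulti _ g z); apply/rowP => i.
rewrite !mxE in_cons; have [->|ij] := eqVneq i j; last by rewrite !addn0.
by rewrite (negPf jt) /= addn0 !addn1 addn2.
Qed.

(** The factor [i \in t] records the coordinates already differentiated, which lets the induction on
    [t] run with full projections. *)
Lemma partials_fprojs t b a g : hol Omega g -> uniq t ->
  eqon (partials t b (fprojs (enum 'I_n) a g))
    (fprojs (enum 'I_n) (\row_i (a ord0 i - ((i \in t) * b ord0 i)%N%:Z)) (partials t b g)).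
Proof.
move=> hg; elim: t => [_|j t IH /= /andP[jt ut]].
  rewrite /= (@eq_fprojs _ a (\row_i (a ord0 i - ((i \in [::]) * b ord0 i)%N%:Z))) //.
  by move=> i _; rewrite mxE in_nil mul0n subr0.
have hD := partials_hol t b hg.
have it m a' : eqon (iter m (partial j) (fprojs (enum 'I_n) a' (partials t b g)))
    (fprojs (enum 'I_n) (\row_i (a' ord0 i - ((i == j) * m)%N%:Z))
      (iter m (partial j) (partials t b g))).
  elim: m => [|m IHm].
    by rewrite /= -(@eq_fprojs _ a') // => i _; rewrite mxE muln0 subr0.
  rewrite !iterS.
  apply: eqon_trans (partial_eqon j _ IHm) _.
    by apply: iter_hol; exact: fprojs_hol.
  apply: eqon_trans (partial_fprojs_in _ (iter_hol m j hD) (enum_uniq _) (mem_enum _ j)) _.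
  rewrite (@eq_fprojs _ _ (\row_i (a' ord0 i - ((i == j) * m.+1)%N%:Z))) //.
  move=> i _; rewrite !mxE; case: eqP => _; rewrite ?mul0n ?subr0 // !mul1n.
  by rewrite -addrA -opprD -PoszD addn1.
apply: eqon_trans (iter_eqon _ _ _ (IH ut)) _.
  by apply: partials_hol; exact: fprojs_hol.
apply: eqon_trans (it _ _) _.
rewrite (@eq_fprojs _ _ (\row_i (a ord0 i - ((i \in j :: t) * b ord0 i)%N%:Z))) //.
move=> i _; rewrite !mxE in_cons; case: eqP => [->|_] /=.
  by rewrite (negPf jt) !mul1n mul0n subr0.
by rewrite mul0n subr0.
Qed.

Lemma Dmulti_fprojs b a g : hol Omega g ->
  eqon (Dmulti b (fprojs (enum 'I_n) a g))
    (fprojs (enum 'I_n) (\row_i (a ord0 i - (b ord0 i)%:Z)) (Dmulti b g)).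
Proof.
move=> hg; have h := @partials_fprojs (enum 'I_n) b a g hg (enum_uniq _).
apply: eqon_trans h _ => z _.
have := @eq_fprojs (enum 'I_n) (\row_i (a ord0 i - ((i \in enum 'I_n) * b ord0 i)%N%:Z))
  (\row_i (a ord0 i - (b ord0 i)%:Z)) (partials (enum 'I_n) b g).
by move=> -> // i _; rewrite !mxE mem_enum mul1n.
Qed.

(* The decay rate given by two derivatives ([fproj_two_derivatives]); it is
   summable over [k : int]. *)
Definition wt (k : int) : R :=
  if (k == 0) || (k == 1) then 1 else (`|(k * (k - 1))%:~R|)^-1.

Lemma wt_ge0 k : 0 <= wt k.
Proof. by rewrite /wt; case: ifP => // _; rewrite invr_ge0. Qed.

Variables (Y : set V) (m : R).
Hypothesis YO : Y `<=` Omega.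
Hypothesis rY : rot_inv Y.
Hypothesis m0 : 0 <= m.
Hypothesis Ym : forall z j, Y z -> `|z ord0 j| <= rc m.

Lemma norm_intr_rc (k : int) : `|(k%:~R : C)| = rc `|k%:~R|.
Proof. by rewrite -(rmorph_int (real_complex R)) [LHS]normC_real. Qed.

(** Euler's relation is used in degree [k] and then in degree [k - 1], since each derivative lowers
    the degree. This is why the rate is k (k - 1), and why the degrees 0 and 1 are treated apart in
    [wt]. *)
Lemma fproj_two_derivatives j (k : int) g z : hol Omega g -> Omega z ->
  (k * (k - 1))%:~R * fproj j k g z =
  z ord0 j ^+ 2 * fproj j (k - 2) (partial j (partial j g)) z.
Proof.
move=> hg Oz; rewrite rmorphM /=.
have e1 := fproj_euler rO j k hg Oz.
have e2 : z ord0 j * fproj j (k - 1 - 1) (partial j (partial j g)) z =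
  (k - 1)%:~R * fproj j (k - 1) (partial j g) z := fproj_euler rO j (k - 1) (partial_hol j hg) Oz.
rewrite -[k%:~R * _ * _]mulrA mulrCA -e1 mulrCA -e2.
have e3 : k - 1 - 1 = k - 2 by lia.
rewrite mulrA -expr2 e3; reflexivity.
Qed.

(** The constant [1 + m ^+ 2] covers both cases: 1 for the trivial bound in degrees 0 and 1,
    [m ^+ 2] for the factor z_j^2 in the others. *)
Lemma norm_fproj_wt j k g z (M : R) : hol Omega g -> Y z ->
  (forall w, Y w -> `|g w| <= rc M) ->
  (forall w, Y w -> `|partial j (partial j g) w| <= rc M) ->
  `|fproj j k g z| <= rc (2 * (1 + m ^+ 2) * M * wt k).
Proof.
move=> hg Yz g1 g2; have Oz := YO Yz.
have M0 : 0 <= M by rewrite -rc_le rc0; exact: le_trans (normr_ge0 _) (g1 _ Yz).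
have m2 : 0 <= m ^+ 2 by rewrite exprn_ge0.
rewrite /wt; case: ifPn => [_|].
  have [cg _ _] := hg.
  have := @norm_fproj_le R n Omega j k g z M rO cg Oz (fun x => g1 _ (rY j x Yz)).
  move=> /le_trans; apply; rewrite rc_le mulr1 -mulrA ler_pM2l //.
  by rewrite mulrDl mul1r lerDl mulr_ge0.
rewrite negb_or => /andP[k0 k1].
have kk : (k * (k - 1))%:~R != 0 :> R by rewrite intr_eq0 mulf_neq0 // subr_eq0.
have [cg _ _] := partial_hol j (partial_hol j hg).
have := @norm_fproj_le R n Omega j (k - 2) _ z M rO cg Oz (fun x => g2 _ (rY j x Yz)).
have := congr1 (fun x => `|x|) (fproj_two_derivatives j k hg Oz).
rewrite /= normrM [in RHS]normrM norm_intr_rc normrX => e h.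
rewrite rcM rcV ler_pdivlMr; last by rewrite -rc0 rc_lt normr_gt0.
rewrite mulrC e.
have zm : `|z ord0 j| ^+ 2 <= rc (m ^+ 2).
  by rewrite rcX lerXn2r ?nnegrE // ?Ym // -rc0 rc_le.
apply: le_trans (ler_pM _ _ zm h) _; rewrite ?exprn_ge0 //.
rewrite -rcM rc_le -subr_ge0.
have -> : 2 * (1 + m ^+ 2) * M - m ^+ 2 * (2 * M) = 2 * M by ring.
by rewrite mulr_ge0.
Qed.

(** The outer projection needs two further derivatives in [j] of the inner ones. They commute with
    projections in other coordinates and fall on [g], so all subsets of the coordinates enter the
    hypothesis. *)
Lemma fprojs_bound s a g (B : R) z : hol Omega g -> uniq s ->
  (forall t, uniq t -> {subset t <= s} -> forall w, Y w -> `|second_partials t g w| <= rc B) ->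
  Y z ->
  `|fprojs s a g z| <= rc ((2 * (1 + m ^+ 2)) ^+ size s * B * \prod_(j <- s) wt (a ord0 j)).
Proof.
elim: s g z => [|j s IH] g z hg /=.
  move=> _ h Yz; rewrite expr0 mul1r big_nil mulr1.
  exact: (h [::] isT (fun _ => id) z Yz).
move=> /andP[js us] h Yz.
have h1 w : Y w -> `|fprojs s a g w| <=
    rc ((2 * (1 + m ^+ 2)) ^+ size s * B * \prod_(j <- s) wt (a ord0 j)).
  move=> Yw; apply: (IH _ _ hg us _ Yw) => t ut ts; apply: (h t ut).
  by move=> i /ts its; rewrite in_cons its orbT.
have h2 w : Y w -> `|partial j (partial j (fprojs s a g)) w| <=
    rc ((2 * (1 + m ^+ 2)) ^+ size s * B * \prod_(j <- s) wt (a ord0 j)).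
  move=> Yw.
  have e1 := partial_fprojs_notin a hg js.
  have e2 := eqon_trans (partial_eqon j (partial_hol j (fprojs_hol s a hg)) e1)
    (partial_fprojs_notin a (partial_hol j hg) js).
  rewrite (e2 _ (YO Yw)).
  apply: (IH _ _ (partial_hol j (partial_hol j hg)) us _ Yw) => t ut ts v Yv.
  (* The derivatives in [j] act on [g] before those in [t], hence at the innermost end of the
     fold. *)
  have := h (rcons t j) _ _ v Yv; rewrite /second_partials foldr_rcons; apply.
    by rewrite rcons_uniq ut andbT; apply: contra js; exact: ts.
  by move=> i; rewrite mem_rcons !in_cons => /orP[->//|/ts ->]; rewrite orbT.
have := norm_fproj_wt (a ord0 j) (fprojs_hol s a hg) Yz h1 h2.
rewrite big_cons; set K := 2 * (1 + m ^+ 2); set P := \prod_(_ <- s) _.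
rewrite (exprS K (size s)).
by congr (_ <= rc _); ring.
Qed.

End IteratedOperators.

(** * Laurent terms as solutions of Euler's equations *)

Section EulerMonomial.
Variables (R : realType).
Local Notation C := (Cplx R).

Lemma rc_imC_eq0 (x y : R) : rc x + rc y * imC R = 0 -> x = 0 /\ y = 0.
Proof.
move=> h.
have hr : complex.Re (rc x + rc y * imC R) = 0 by rewrite h.
have hi : complex.Im (rc x + rc y * imC R) = 0 by rewrite h.
move: hr hi; rewrite cReD cImD cReM cImM /=.
by rewrite !(mulr0, mul0r, mulr1, subr0, addr0, add0r).
Qed.

Variables (c : C) (r : R) (phi phi' : C -> C) (k : int).
Let U := [set w : C | `|w - c| < rc r].
Hypothesis dphi : forall w, U w -> is_derive w (1 : C) phi (phi' w).
Hypothesis euler : forall w, U w -> w * phi' w = k%:~R * phi w.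

Lemma disc_convex (a b : C) (x : R) : U a -> U b -> 0 <= x <= 1 ->
  U (a + rc x * (b - a)).
Proof.
move=> Ua Ub /andP[x0 x1]; rewrite /U /=.
have -> : a + rc x * (b - a) - c = rc (1 - x) * (a - c) + rc x * (b - c).
  by rewrite rcB rc1; ring.
apply: le_lt_trans (ler_normD _ _) _; rewrite !normrM.
have -> : `|rc (1 - x) : C| = rc (1 - x).
  by rewrite [LHS]normC_real ger0_norm ?subr_ge0.
have -> : `|rc x : C| = rc x by rewrite [LHS]normC_real ger0_norm.
have [e|x_neq0] := eqVneq x 0.
  by rewrite e subr0 rc1 rc0 mul1r mul0r addr0.
have -> : rc r = rc (1 - x) * rc r + rc x * rc r.
  by rewrite -mulrDl -rcD subrK rc1 mul1r.
apply: ler_ltD.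
  by apply: ler_wpM2l; [rewrite -rc0 rc_le subr_ge0|exact: ltW].
by rewrite ltr_pM2l // -rc0 rc_lt lt_neqAle eq_sym x_neq0.
Qed.

Lemma disc_open : open U.
Proof.
have -> : U = ball_ Num.Def.normr c (rc r).
  by apply/seteqP; split => w; rewrite /U /ball_ /= distrC.
have [r0|r0] := ltP 0 r; last first.
  have -> : ball_ Num.Def.normr c (rc r) = set0; last exact: open0.
  apply/seteqP; split => // w; rewrite /ball_ /= => h.
  have := le_lt_trans (normr_ge0 _) h; rewrite -rc0 rc_lt ltNge r0 //.
by rewrite ball_normE; apply: ball_open; rewrite -rc0 rc_lt.
Qed.

(* [phi w * w ^ (- k)] is constant along segments avoiding 0. If [0] lies on the
   segment from [a] to [b], go through a point near 0 in the direction [i a]. *)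
Lemma euler_disc_neq0 (a b : C) : U a -> U b -> a != 0 -> b != 0 ->
  phi b * b ^ (- k) = phi a * a ^ (- k).
Proof.
have seg (a' b' : C) : U a' -> U b' ->
    (forall x : R, 0 <= x <= 1 -> a' + rc x * (b' - a') != 0) ->
    phi b' * b' ^ (- k) = phi a' * a' ^ (- k).
  move=> Ua Ub nz; apply: (euler_segment nz (phi' := phi')) => x x01 /=.
  have Ux := disc_convex Ua Ub x01.
  by split; [exact: dphi|exact: euler].
move=> Ua Ub a0 b0.
have [nz|] := pselect (forall x : R, 0 <= x <= 1 -> a + rc x * (b - a) != 0).
  exact: seg.
move=> /existsNP[x /not_implyP[x01 /negP/negPn/eqP x_root]].
have U0 : U 0 by rewrite -x_root; exact: disc_convex.
have x0 : x != 0.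
  by apply: contraNneq a0 => x0; move: x_root; rewrite x0 rc0 mul0r addr0 => ->.
(* When 0 lies on the segment, [b] is a real multiple of [a]; the detour point in direction i a is
   then collinear with neither, and both new segments avoid 0. *)
have bE : b = rc ((x - 1) / x) * a.
  have : rc x * b = rc (x - 1) * a.
    apply/eqP; rewrite -subr_eq0; apply/eqP; rewrite -[RHS]x_root rcB rc1; ring.
  by rewrite rcM rcV => h; rewrite mulrAC -h mulrC mulKf // rc_eq0.
have [d d0 dU] : exists2 d : R, 0 < d & forall w : C, `|w| < rc d -> U w.
  have /nbhs_normP[d /= /gt0_Re[d0 dE] sub] : nbhs (0 : C) U.
    by apply: open_nbhs_nbhs; split; [exact: disc_open|exact: U0].
  exists (complex.Re d) => // w wd; apply: sub.
  by rewrite /ball_ /= sub0r normrN dE.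
have na : 0 < complex.Re `|a|.
  have h : 0 < `|a| by rewrite normr_gt0.
  by have [] := gt0_Re h.
(* Chosen so that the detour point [e] has modulus [d / 2], inside the disc around 0 contained in
   [U]. *)
pose eta := d / 2 / complex.Re `|a|.
have eta0 : 0 < eta by rewrite !divr_gt0.
pose e := rc eta * imC R * a.
have ne : `|e| = rc (d / 2).
  rewrite /e !normrM [`|rc eta|]normC_real (gtr0_norm eta0).
  have -> : `|imC R| = 1 :> C by rewrite norm_ReIm /= expr0n expr1n add0r sqrtr1.
  by rewrite mulr1 [`|a|]norm_Re_rc -rcM /eta divfK ?gt_eqF.
have Ue : U e by apply: dU; rewrite ne rc_lt ltr_pdivrMr // mulr_natr mulr2n ltrDl.
have h1 : phi e * e ^ (- k) = phi a * a ^ (- k).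
  apply: seg => // y y01; apply/eqP => h.
  have : (rc (1 - y) + rc (y * eta) * imC R) * a = 0.
    by rewrite -[RHS]h /e rcB rcM rc1; ring.
  move=> /eqP; rewrite mulf_eq0 (negPf a0) orbF => /eqP /rc_imC_eq0[y1 ye].
  have y1' : y = 1 by apply/eqP; rewrite eq_sym -subr_eq0 y1.
  by move: ye; rewrite y1' mul1r => /eqP; rewrite gt_eqF.
rewrite -h1; apply: seg => // y y01; apply/eqP => h.
have : (rc (y * ((x - 1) / x)) + rc (eta * (1 - y)) * imC R) * a = 0.
  by rewrite -[RHS]h bE /e !rcM rcB rc1; ring.
move=> /eqP; rewrite mulf_eq0 (negPf a0) orbF => /eqP /rc_imC_eq0[h2 h3].
have y1 : y = 1.
  by move/eqP: h3; rewrite mulf_eq0 gt_eqF //= subr_eq0 => /eqP.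
by move/eqP: b0; apply; rewrite bE; move: h2; rewrite y1 mul1r => ->; rewrite rc0 mul0r.
Qed.

Hypothesis cphi : cont_on U phi.

(** The product form makes sense at [a = 0]. For nonzero [k], Euler's relation at 0 forces
    [phi 0 = 0], and 0^k is 0 even for negative [k] by the convention 0^-1 = 0. For [k = 0] the
    function is constant off 0 and continuity gives its value there. *)
Lemma euler_disc (a b : C) : U a -> U b -> b != 0 -> phi a * b ^ k = phi b * a ^ k.
Proof.
move=> Ua Ub b0; have [a0|a0] := eqVneq a 0; last first.
  have h := euler_disc_neq0 Ua Ub a0 b0.
  have bk : b ^ k != 0 by rewrite expfz_neq0.
  have ak : a ^ k != 0 by rewrite expfz_neq0.
  have -> : phi b = phi a * a ^ (- k) * b ^ k.
    by rewrite -h -mulrA -expfzDr // addNr expr0z mulr1.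
  by rewrite [RHS]mulrAC -(mulrA (phi a)) -expfzDr // addNr expr0z mulr1.
rewrite a0 in Ua *; have [k0|k0] := eqVneq k 0; last first.
  have := euler Ua; rewrite mul0r => /esym/eqP.
  by rewrite mulf_eq0 intr_eq0 (negPf k0) /= => /eqP ->; rewrite mul0r exp0rz (negPf k0) mulr0.
rewrite k0 !expr0z !mulr1; apply: eq_by_eps => eps eps0.
have e0 : 0 < rc eps :> C by rewrite -rc0 rc_lt.
have h1 : \forall w \near (0 : C), U w.
  by apply: open_nbhs_nbhs; split; [exact: disc_open|exact: Ua].
have h2 : \forall w \near (0 : C), U w -> `|phi 0 - phi w| < rc eps.
  by have := cphi Ua => /cvgrPdist_lt /(_ _ e0); rewrite near_withinE.
have h3 : \forall w \near (0 : C)^', w != 0 by exact: nbhs_dnbhs_neq.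
have /filter_ex[w [w0 Uw Pw]] : \forall w \near (0 : C)^',
    [/\ w != 0, U w & `|phi 0 - phi w| < rc eps].
  near=> w; have Uw : U w by near: w; exact: nbhs_dnbhs.
  split; [by near: w; exact: h3|exact: Uw|].
  by move: Uw; near: w; exact: nbhs_dnbhs.
have := euler_disc_neq0 Uw Ub w0 b0; rewrite k0 oppr0 !expr0z !mulr1 => ->.
exact: ltW.
Unshelve. all: by end_near. Qed.

End EulerMonomial.

Section LaurentMonomial.
Variables (R : realType) (n : nat).
Local Notation C := (Cplx R).
Local Notation V := 'rV[C]_n.
Variable Omega : set V.
Hypothesis oO : open Omega.
Variables (F : V -> C) (a : 'rV[int]_n).
Hypothesis hF : hol Omega F.
Hypothesis eulerF : forall j z, Omega z ->
  z ord0 j * partial j F z = (a ord0 j)%:~R * F z.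

(** Corners of a path from [w] to [z] that changes one coordinate at a time; they stay in any
    polydisc containing both ends. *)
Definition mix (s : seq 'I_n) (z w : V) : V :=
  \row_j (if j \in s then z ord0 j else w ord0 j).

Lemma euler_polydisc p (r : R) z w : polydisc p r `<=` Omega ->
  polydisc p r z -> polydisc p r w -> (forall j, w ord0 j != 0) ->
  F z * monomial a w = F w * monomial a z.
Proof.
move=> sub Dz Dw w0.
have claim s : uniq s -> F (mix s z w) * \prod_(j <- s) w ord0 j ^ a ord0 j =
    F w * \prod_(j <- s) z ord0 j ^ a ord0 j.
  elim: s => [_|j s IH /= /andP[js us]].
    by rewrite !big_nil; congr (F _ * _); apply/rowP => i; rewrite mxE in_nil.
  set u := mix s z w in IH.
  (* Coordinate [j] of [u'] is 0, so the slice parameter is the coordinate itself and Euler's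
     equation takes its one-variable form. *)
  pose u' := u + (- w ord0 j) *: bv R j.
  pose phi (v : C) := F (u' + v *: bv R j).
  have uj : u ord0 j = w ord0 j by rewrite mxE (negPf js).
  have coord v i : (u' + v *: bv R j) ord0 i = if i == j then v else u ord0 i.
    rewrite coord_bv coord_bv; have [->|_] := eqVneq i j; last by rewrite !mulr0 !addr0.
    by rewrite !mulr1 uj subrr add0r.
  have inD v : `|v - p ord0 j| < rc r -> polydisc p r (u' + v *: bv R j).
    move=> vr i; rewrite coord; have [->//|_] := eqVneq i j.
    by rewrite mxE; case: ifP.
  have phi_w : phi (w ord0 j) = F u.
    by congr F; apply/rowP => i; rewrite coord; have [->|//] := eqVneq i j.
  have phi_z : phi (z ord0 j) = F (mix (j :: s) z w).
    congr F; apply/rowP => i; rewrite coord [RHS]mxE in_cons.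
    by have [->//|_] := eqVneq i j; rewrite mxE.
  have [cF dF _] := hF.
  have dphi v : `|v - p ord0 j| < rc r ->
      is_derive (v : C) (1 : C) phi (partial j F (u' + v *: bv R j)).
    move=> /inD/sub Ov; apply/slice_deriveP; apply: derivable_is_derive; exact: dF Ov.
  have ephi v : `|v - p ord0 j| < rc r ->
      v * partial j F (u' + v *: bv R j) = (a ord0 j)%:~R * phi v.
    move=> /inD/sub Ov; have := eulerF j Ov.
    by rewrite coord eqxx.
  have cphi : cont_on [set v : C | `|v - p ord0 j| < rc r] phi.
    apply: cont_on_sub (@cont_on_slice R n Omega F u' j cF) => v /inD /sub; exact.
  have := euler_disc dphi ephi cphi (Dz j) (Dw j) (w0 j).
  rewrite phi_w phi_z !big_cons => h.
  by rewrite mulrA h mulrAC (IH us) mulrAC mulrA.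
have := claim (enum 'I_n) (enum_uniq _); rewrite !big_enum /=.
have -> // : mix (enum 'I_n) z w = z by apply/rowP => i; rewrite mxE mem_enum.
Qed.

Lemma nonzero_dense (p : V) (A : set V) : nbhs p A ->
  exists2 w : V, A w & forall j, w ord0 j != 0.
Proof.
move=> /nbhs_polydisc[r r0 sub].
exists (\row_j (if p ord0 j == 0 then rc (r / 2) else p ord0 j)).
  apply: sub => j; rewrite mxE; case: eqP => [->|_].
    rewrite subr0 [X in X < _]normC_real rc_lt gtr0_norm ?divr_gt0 //.
    by rewrite ltr_pdivrMr // mulr_natr mulr2n ltrDl.
  by rewrite subrr normr0 -rc0 rc_lt.
move=> j; rewrite mxE; case: ifP => [_|->//].
by rewrite rc_eq0 gt_eqF // divr_gt0.
Qed.

Lemma monomial_neq0 (w : V) : (forall j, w ord0 j != 0) -> monomial a w != 0 :> C.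
Proof.
by move=> w0; apply/prodf_neq0 => j _; rewrite expfz_neq0.
Qed.

(** Connectedness is applied to the interior of [P], not to [P]: at a point on a coordinate
    hyperplane the identity may read 0 = 0 and then does not spread, whereas an open set always
    contains points off the hyperplanes. *)
Lemma euler_connected z0 : connected Omega -> Omega z0 ->
  (forall j, z0 ord0 j != 0) -> forall z, Omega z ->
  F z * monomial a z0 = F z0 * monomial a z.
Proof.
move=> conO Oz0 z00.
pose P : set V := [set w | F w * monomial a z0 = F z0 * monomial a w].
have spread p (r : R) w : polydisc p r `<=` Omega -> polydisc p r w ->
    (forall j, w ord0 j != 0) -> P w -> polydisc p r `<=` P.
  move=> sub Dw w0 Pw z Dz; rewrite /P /=.
  apply: (mulIf (monomial_neq0 w0)).
  have := euler_polydisc sub Dz Dw w0; move: Pw; rewrite /P /=.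
  move: (F z) (F w) (F z0) (monomial a z) (monomial a w) (monomial a z0).
  by move=> x1 x2 x3 x4 x5 x6 h1 h2; rewrite mulrAC h2 mulrAC h1 mulrAC.
have nb z : Omega z -> exists2 r : R, 0 < r & polydisc z r `<=` Omega.
  by move=> Oz; apply: nbhs_polydisc; exact: open_near.
have intP z (r : R) : 0 < r -> polydisc z r `<=` P -> P° z.
  move=> r0 sub; rewrite /interior; apply: filterS sub _.
  exact: open_near (@polydisc_open R n z r r0) (@polydisc_center R n z r r0).
have eqO : Omega `&` P° = Omega.
  apply: conO.
  - exists z0; split => //; have [r r0 sub] := nb z0 Oz0.
    by apply: (intP z0 r r0); apply: (spread z0 r z0 sub _ z00) => //; exact: polydisc_center.
  - by exists P° => //; exact: open_interior.
  - exists (closure P°); first exact: closed_closure.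
    apply/seteqP; split => z [Oz].
      by move=> Pz; split => //; exact: subset_closure.
    move=> clz; split => //; have [r r0 sub] := nb z Oz.
    have nz : nbhs z (polydisc z r) :=
      open_near (@polydisc_open R n z r r0) (@polydisc_center R n z r r0).
    have [s [Ps partials]] := clz _ nz.
    have h1 : nbhs s P° := open_near (@open_interior _ P) Ps.
    have h2 : nbhs s (polydisc z r) := open_near (@polydisc_open R n z r r0) partials.
    have h3 : nbhs s (P° `&` polydisc z r) by exact: filterI h1 h2.
    have [w [Pw Dw] w0] := nonzero_dense h3.
    by apply: (intP z r r0); apply: (spread z r w sub Dw w0); exact: interior_subset.
by move=> z; rewrite -{1}eqO => -[_ /interior_subset].
Qed.

End LaurentMonomial.

(** * Torus integrals as iterated projections *)

Section LaurentCoefficient.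
Variables (R : realType) (n : nat).
Local Notation C := (Cplx R).
Local Notation V := 'rV[C]_n.
Variable Omega : set V.
Hypothesis rO : rot_inv Omega.
Variables (f : V -> C) (a : 'rV[int]_n).
Hypothesis cf : cont_on Omega f.

(** The map [h] tells which coordinate each angle rotates. Separating the number of angles [m] from
    [n] allows induction on the number of integrals with [z] kept in dimension [n]. *)
Definition spin m (h : 'I_m -> 'I_n) (theta : 'rV[R]_m) (z : V) : V :=
  \row_l (z ord0 l * \prod_(i < m) (if h i == l then expi (theta ord0 i) else 1)).

Lemma row_mx_ord0 m (t : R) (theta : 'rV[R]_m) :
  (row_mx (const_mx t : 'rV_1) theta) ord0 (ord0 : 'I_(1 + m)) = t.
Proof.
rewrite mxE; case: splitP => k /= hk; last by [].
by rewrite mxE.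
Qed.

Lemma row_mx_lift m (t : R) (theta : 'rV[R]_m) (i : 'I_m) :
  (row_mx (const_mx t : 'rV_1) theta) ord0 (lift (ord0 : 'I_(1 + m)) i) = theta ord0 i.
Proof.
rewrite mxE; case: splitP => k /= hk; first by case: k hk => -[].
by congr (theta _ _); apply/val_inj; move: hk; rewrite /= /bump /= => -[].
Qed.

(** With the outer angle [t] fixed, its rotation moves [z] to [turn u t z] and its character is a
    constant factor; the parameter [c] is there to absorb it. *)
Lemma torus_integral_fprojs m (h : 'I_m -> 'I_n) (c : C) (z : V) : Omega z ->
  torus_integral (fun theta : 'rV[R]_m =>
    c * (f (spin h theta z) * \prod_(i < m) chr (a ord0 (h i)) (theta ord0 i))) =
  c * rc (2 * pi) ^+ m * fprojs [seq h i | i <- enum 'I_m] a f z.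
Proof.
elim: m h c z => [|m IH] h c z Oz.
  rewrite /= big_ord0 mulr1 expr0 mulr1 (size0nil (size_enum_ord 0)) /=.
  congr (_ * f _); apply/rowP => l.
  by rewrite mxE big_ord0 mulr1.
rewrite enum_ordSl /= -map_comp.
set h' := h \o lift ord0; set u := h ord0.
have step t : torus_integral (fun theta : 'rV[R]_m => c *
    (f (spin h (row_mx (const_mx t : 'rV_1) theta) z) *
     \prod_(i < m.+1) chr (a ord0 (h i)) (row_mx (const_mx t : 'rV_1) theta ord0 i))) =
    (c * rc (2 * pi) ^+ m) *
      (fprojs [seq h' i | i <- enum 'I_m] a f (turn u t z) * chr (a ord0 u) t).
  have -> : (fun theta : 'rV[R]_m => c *
      (f (spin h (row_mx (const_mx t : 'rV_1) theta) z) *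
       \prod_(i < m.+1) chr (a ord0 (h i)) (row_mx (const_mx t : 'rV_1) theta ord0 i))) =
      (fun theta : 'rV[R]_m => (c * chr (a ord0 u) t) *
        (f (spin h' theta (turn u t z)) *
         \prod_(i < m) chr (a ord0 (h' i)) (theta ord0 i))).
    apply/funext => theta.
    have -> : spin h (row_mx (const_mx t : 'rV_1) theta) z = spin h' theta (turn u t z).
      apply/rowP => l; rewrite /spin [LHS]mxE [RHS]mxE turnE big_ord_recl row_mx_ord0 mulrA.
      congr (_ * _); last by apply: eq_bigr => i _; rewrite row_mx_lift.
      rewrite eq_sym -/u; case: eqP => [->|_]; first by rewrite mulrC.
      by rewrite mulr1.
    rewrite big_ord_recl row_mx_ord0.
    have -> : \prod_(i < m) chr (a ord0 (h (lift ord0 i)))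
        (row_mx (const_mx t : 'rV_1) theta ord0 (lift ord0 i)) =
        \prod_(i < m) chr (a ord0 (h' i)) (theta ord0 i) :> C.
      by apply: eq_bigr => i _; rewrite row_mx_lift.
    by rewrite -/u; ring.
  rewrite IH; first by ring.
  exact: rO.
rewrite (eq_Cintegral _ _ step).
have cF := @fprojs_cont R n Omega [seq h' i | i <- enum 'I_m] a f rO cf.
have cc := @fproj_cont_fun R n Omega _ u (a ord0 u) z rO cF Oz.
rewrite (CintegralZ _ _ _ cc) exprSr.
rewrite -/h' -/u [fproj _ _ _ _]/(mean _) /mean.
set I := Cintegral _ _ _; set p := rc (2 * pi); move: (p ^+ m) => q.
have p0 : p != 0 := rc_twopi_neq0 R.
by rewrite [RHS]mulrA (mulrA c) mulfK.
Qed.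

Lemma expi_sum m (g : 'I_m -> R) : expi (\sum_(i < m) g i) = \prod_(i < m) expi (g i) :> C.
Proof. by elim/big_rec2: _ => [|i y x _ <-]; rewrite ?expi0 ?expiD. Qed.

Lemma laurent_coefE z : Omega z ->
  laurent_coef f z a = fprojs (enum 'I_n) a f z / monomial a z.
Proof.
move=> Oz; rewrite /laurent_coef.
have -> : (fun theta : 'rV[R]_n => f (\row_j (z ord0 j * expi (theta ord0 j))) /
    (monomial a z * expi (\sum_(j < n) (a ord0 j)%:~R * theta ord0 j))) =
    (fun theta : 'rV[R]_n => (monomial a z)^-1 *
      (f (spin id theta z) * \prod_(i < n) chr (a ord0 i) (theta ord0 i))).
  apply/funext => theta.
  have -> : spin id theta z = \row_j (z ord0 j * expi (theta ord0 j)).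
    apply/rowP => l; rewrite !mxE; congr (_ * _).
    by rewrite -big_mkcond big_pred1_eq.
  have -> : \prod_(i < n) chr (a ord0 i) (theta ord0 i) =
      (expi (\sum_(j < n) (a ord0 j)%:~R * theta ord0 j))^-1 :> C.
    by rewrite expi_sum -prodfV; apply: eq_bigr => i _; rewrite /chr expiN.
  by rewrite invfM mulrCA.
rewrite (torus_integral_fprojs id _ Oz) map_id.
have tn0 : rc (2 * pi) ^+ n != 0 :> C by rewrite expf_neq0 // rc_twopi_neq0.
have -> : ((2 * pi) ^+ n)^-1%:C = (rc (2 * pi) ^+ n)^-1 :> C by rewrite -rcX -rcV.
by rewrite [RHS]mulrC; move: tn0; set x := rc _ ^+ n => x0; rewrite !mulrA [x^-1 * _]mulrC mulfVK.
Qed.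

End LaurentCoefficient.

(** * Unconditional summation of the projections *)

Section RealBounds.
Variable R : realType.

Lemma rc_sum I (s : seq I) (P : pred I) (F : I -> R) :
  rc (\sum_(i <- s | P i) F i) = \sum_(i <- s | P i) rc (F i) :> Cplx R.
Proof. exact: (raddf_sum (real_complex R)). Qed.

Lemma le_rc_eps (x : Cplx R) (y : R) : 0 <= x ->
  (forall e, 0 < e -> x <= rc (y + e)) -> x <= rc y.
Proof.
move=> /ge0_Re[_ ->] h; rewrite rc_le; apply/ler_addgt0Pr => e e0.
by rewrite -rc_le; exact: h.
Qed.

End RealBounds.

Section SymmetricSums.

Definition zint (M : nat) : seq int := [seq i%:Z - M%:Z | i <- iota 0 M.*2.+1].

Lemma big_zintS (V : zmodType) (F : int -> V) M :
  \sum_(k <- zint M.+1) F k = F (- M.+1%:Z) + \sum_(k <- zint M) F k + F M.+1%:Z.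
Proof.
rewrite /zint !big_map doubleS.
have -> : iota 0 M.*2.+3 = 0%N :: rcons [seq i.+1 | i <- iota 0 M.*2.+1] M.*2.+2.
  have -> : iota 0 M.*2.+3 = 0%N :: iota (1 + 0) M.*2.+2 by [].
  have -> : iota (1 + 0) M.*2.+2 = map S (iota 0 M.*2.+2) by rewrite iotaDl.
  have -> : iota 0 M.*2.+2 = rcons (iota 0 M.*2.+1) M.*2.+1.
    by rewrite -[M.*2.+2]addn1 iotaD cats1.
  by rewrite map_rcons.
rewrite big_cons big_rcons big_map /= sub0r -addrA; congr (_ + (_ + F _)); last by lia.
by apply: eq_bigr => i _; congr F; lia.
Qed.

Arguments zint : simpl never.

Lemma mem_zint M (k : int) : (k \in zint M) = (`|k| <= M)%N.
Proof.
apply/mapP/idP => [[p hp ->]|kM].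
  by move: hp; rewrite mem_iota; lia.
by exists (absz (k + M%:Z)%R); rewrite ?mem_iota; lia.
Qed.

Lemma zint_uniq M : uniq (zint M).
Proof. by rewrite map_inj_uniq ?iota_uniq // => i j; lia. Qed.

End SymmetricSums.

Section Weights.
Variable R : realType.
Local Notation wt := (wt R).

Definition Wsum (M : nat) : R := \sum_(k <- zint M) wt k.

Lemma WsumS M : Wsum M.+1 = wt (- M.+1%:Z) + Wsum M + wt M.+1%:Z.
Proof. exact: big_zintS. Qed.

Lemma Wsum_ge0 M : 0 <= Wsum M.
Proof. by apply: sumr_ge0 => k _; exact: wt_ge0. Qed.

Lemma Wsum_ndecr : nondecreasing_seq Wsum.
Proof.
apply/nondecreasing_seqP => M; rewrite WsumS addrAC lerDr.
by rewrite addr_ge0 ?wt_ge0.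
Qed.

(** Each new pair of weights is at most 2 (1/(M+1) - 1/(M+2)), which telescopes. The start, 1/2 + 1
    + 1, is below 5 - 2. *)
Lemma Wsum_le M : Wsum M.+1 <= 5 - 2 / M.+1%:R.
Proof.
elim: M => [|M IH].
  rewrite WsumS /Wsum big_map /= !big_cons big_nil /wt /=.
  have -> : (`|(-1 * (-1 - 1) : int)%:~R| : R) = 2.
    by rewrite -[_ * _ : int]/(2%:Z) ger0_norm ?ler0n.
  by lra.
rewrite WsumS.
have M0 : 0 < M.+1%:R :> R by rewrite ltr0n.
have h1 : wt M.+2%:Z <= (M.+1%:R)^-1 - (M.+2%:R)^-1.
  rewrite /wt (_ : (M.+2%:Z == 0) || (M.+2%:Z == 1) = false); last by lia.
  have -> : (M.+2%:Z * (M.+2%:Z - 1)) = (M.+2 * M.+1)%N%:Z by lia.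
  rewrite ger0_norm ?ler0n // -[X in X^-1]/((M.+2 * M.+1)%N%:R) natrM.
  rewrite (_ : M.+2%:R = M.+1%:R + 1 :> R) ?natr1 //.
  rewrite le_eqVlt; apply/orP; left; apply/eqP; field.
  by rewrite !gt_eqF // addr_gt0.
have h2 : wt (- M.+2%:Z) <= (M.+1%:R)^-1 - (M.+2%:R)^-1.
  rewrite /wt (_ : (- M.+2%:Z == 0) || (- M.+2%:Z == 1) = false); last by lia.
  have -> : (- M.+2%:Z * (- M.+2%:Z - 1)) = (M.+2 * M.+3)%N%:Z by lia.
  rewrite ger0_norm ?ler0n // -[X in X^-1]/((M.+2 * M.+3)%N%:R) natrM.
  have -> : (M.+1%:R)^-1 - (M.+2%:R)^-1 = (M.+2%:R * M.+1%:R)^-1 :> R.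
    rewrite (_ : M.+2%:R = M.+1%:R + 1 :> R) ?natr1 //; field.
    by rewrite !gt_eqF // addr_gt0.
  by rewrite lef_pV2 ?posrE ?mulr_gt0 ?ltr0n // ler_pM2l ?ltr0n // ler_nat; lia.
move: IH h1 h2; move: (wt _) (wt _) (Wsum _) (_^-1) (_^-1) => w1 w2 W x y; lra.
Qed.

Lemma Wsum_bounded M : Wsum M <= 5.
Proof.
apply: le_trans (Wsum_ndecr (leqnSn M)) _; apply: le_trans (Wsum_le M) _.
by rewrite gerBl divr_ge0.
Qed.

Definition Winf : R := limn Wsum.

Lemma Wsum_cvg : Wsum @ \oo --> Winf.
Proof.
apply: nondecreasing_is_cvgn; first exact: Wsum_ndecr.
by exists 5 => _ [M _ <-]; exact: Wsum_bounded.
Qed.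

Lemma Wsum_le_inf M : Wsum M <= Winf.
Proof.
apply: nondecreasing_cvgn_le; first exact: Wsum_ndecr.
by apply/cvg_ex; exists Winf; exact: Wsum_cvg.
Qed.

Lemma norm_symsum_diff (F : int -> Cplx R) (c : R) M N : (M <= N)%N ->
  (forall k, `|F k| <= rc (c * wt k)) ->
  `|\sum_(k <- zint N) F k - \sum_(k <- zint M) F k| <= rc (c * (Wsum N - Wsum M)).
Proof.
move=> MN bF; rewrite -(subnKC MN); elim: (N - M)%N => [|d IH].
  by rewrite addn0 !subrr normr0 mulr0 rc0.
rewrite addnS big_zintS WsumS.
set A := \sum_(k <- zint (M + d)) _; set B := \sum_(k <- zint M) _ in IH *.
have -> : F (- (M + d).+1%:Z) + A + F (M + d).+1%:Z - B =
  F (- (M + d).+1%:Z) + ((A - B) + F (M + d).+1%:Z) by ring.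
have -> : c * (wt (- (M + d).+1%:Z) + Wsum (M + d) + wt (M + d).+1%:Z - Wsum M) =
  c * wt (- (M + d).+1%:Z) + (c * (Wsum (M + d) - Wsum M) + c * wt (M + d).+1%:Z) by ring.
rewrite rcD (rcD (c * (_ - _))).
apply: le_trans (ler_normD _ _) _; apply: lerD; first exact: bF.
by apply: le_trans (ler_normD _ _) _; apply: lerD; [exact: IH|exact: bF].
Qed.

End Weights.

(** * Cubes of multi-indices *)

Section Boxes.
Variable n : nat.
Implicit Types (j : 'I_n) (s : seq 'I_n) (a b : 'rV[int]_n).

Definition upd a j (k : int) : 'rV[int]_n := \row_i (if i == j then k else a ord0 i).

(** Built coordinate by coordinate, so that a sum over the cube is an iterated sum matching the
    nesting of the projections; entries outside [s] are 0. *)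
Fixpoint box (M : nat) s : seq 'rV[int]_n :=
  if s is j :: s' then [seq upd a j k | a <- box M s', k <- zint M] else [:: 0].

Lemma updE a j k i : upd a j k ord0 i = if i == j then k else a ord0 i.
Proof. by rewrite mxE. Qed.

Lemma mem_box M s a : uniq s ->
  reflect (forall i, if i \in s then (`|a ord0 i| <= M)%N else a ord0 i == 0)
    (a \in box M s).
Proof.
elim: s a => [|j s IH] a.
  move=> _; rewrite inE; apply: (iffP eqP) => [-> i|h]; first by rewrite mxE.
  by apply/rowP => i; rewrite mxE; apply/eqP; exact: h.
rewrite [uniq _]/= => /andP[js us].
have P := @allpairsP _ _ _ (fun a k => upd a j k) (box M s) (zint M) a.
apply: (iffP P) => [[[b k] [/= hb hk ->]] i|h].
  rewrite updE in_cons; have [->/=|_ /=] := eqVneq i j; first by rewrite -mem_zint.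
  exact: (IH b us hb i).
exists (upd a j 0, a ord0 j); split => /=.
- apply/(IH _ us) => i; rewrite updE; have := h i; rewrite in_cons.
  by have [->/=|_ //] := eqVneq i j; rewrite (negPf js).
- by rewrite mem_zint; have := h j; rewrite in_cons eqxx.
- by apply/rowP => i; rewrite !updE; case: eqP => [->|].
Qed.

Lemma box_uniq M s : uniq s -> uniq (box M s).
Proof.
elim: s => [//|j s IH]; rewrite [uniq (j :: s)]/= => /andP[js us].
apply: allpairs_uniq; rewrite ?zint_uniq ?IH //.
move=> p q /allpairsP[[a' k'] [ha _ ->]] /allpairsP[[b' l'] [hb _ ->]].
rewrite /= in ha hb * => /rowP e.
have {}e i : upd a' j k' ord0 i = upd b' j l' ord0 i := e i.
have kl : k' = l' by have := e j; rewrite !updE eqxx.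
have ab : a' = b'.
  apply/rowP => i; have [->|ij] := eqVneq i j; last by have := e i; rewrite !updE (negPf ij).
  have := (mem_box M a' us ha) j; have := (mem_box M b' us hb) j.
  by rewrite (negPf js) => /eqP -> /eqP ->.
by rewrite ab kl.
Qed.

Lemma mem_box_enum M a :
  reflect (forall i, (`|a ord0 i| <= M)%N) (a \in box M (enum 'I_n)).
Proof.
apply: (iffP (mem_box M a (enum_uniq _))) => h i; have := h i; by rewrite mem_enum.
Qed.

Lemma box_subset M N : (M <= N)%N -> {subset box M (enum 'I_n) <= box N (enum 'I_n)}.
Proof.
by move=> MN a /mem_box_enum h; apply/mem_box_enum => i; exact: leq_trans (h i) MN.
Qed.

Lemma ex_box (A : seq 'rV[int]_n) :
  exists M0, forall M, (M0 <= M)%N -> {subset A <= box M (enum 'I_n)}.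
Proof.
exists (\max_(a <- A) \max_i `|a ord0 i|)%N => M hM a aA; apply/mem_box_enum => i.
apply: leq_trans hM; apply: leq_trans (leq_bigmax_seq _ aA isT).
exact: (leq_bigmax i).
Qed.

Lemma big_box_cons (V : zmodType) (F : 'rV[int]_n -> V) M j s :
  \sum_(a <- box M (j :: s)) F a = \sum_(a <- box M s) \sum_(k <- zint M) F (upd a j k).
Proof. by rewrite big_allpairs_dep. Qed.

Variable R : realType.

Definition wprod s a : R := \prod_(j <- s) wt R (a ord0 j).

Lemma wprod_ge0 s a : 0 <= wprod s a.
Proof. by apply: prodr_ge0 => j _; exact: wt_ge0. Qed.

Lemma wprod_upd s a j k : j \notin s -> wprod s (upd a j k) = wprod s a.
Proof.
move=> js; rewrite /wprod !big_seq; apply: eq_bigr => i si.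
by rewrite updE; case: eqP => [e|//]; rewrite -e si in js.
Qed.

Lemma sum_wprod M s : uniq s -> \sum_(a <- box M s) wprod s a = Wsum R M ^+ size s.
Proof.
elim: s => [|j s IH]; first by rewrite big_seq1 /wprod big_nil expr0.
rewrite big_box_cons /= => /andP[js us]; rewrite exprSr -(IH us) mulr_suml.
apply: eq_bigr => a _; rewrite mulr_sumr; apply: eq_bigr => k _.
by rewrite /wprod big_cons updE eqxx mulrC -/(wprod _ _) wprod_upd.
Qed.

End Boxes.

(** * Uniform error estimates for finite sums of projections *)

Section Summation.
Variables (R : realType) (n : nat).
Local Notation C := (Cplx R).
Local Notation V := 'rV[C]_n.
Variables (Omega Y : set V) (m B : R).
Hypothesis oO : open Omega.
Hypothesis rO : rot_inv Omega.
Hypothesis YO : Y `<=` Omega.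
Hypothesis rY : rot_inv Y.
Hypothesis m0 : 0 <= m.
Hypothesis Ym : forall z j, Y z -> `|z ord0 j| <= rc m.
Variable g : V -> C.
Hypothesis hg : hol Omega g.
Hypothesis B0 : 0 <= B.
Hypothesis gB : forall t, uniq t -> forall w, Y w -> `|second_partials t g w| <= rc B.

Let K := 2 * (1 + m ^+ 2).

Lemma norm_fprojs s a z : uniq s -> Y z ->
  `|fprojs s a g z| <= rc (K ^+ size s * B * wprod R s a).
Proof.
by move=> us Yz; apply: (fprojs_bound oO rO YO rY m0 Ym _ hg us) => // t ut _; exact: gB.
Qed.

(** Inversion in coordinate [j] gives the limit of the symmetric sums; the sum up to [M] is compared
    with a much longer one through the weights between them. *)
Lemma tail_fprojs M j s a z : uniq (j :: s) -> Y z ->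
  `|\sum_(k <- zint M) fproj j k (fprojs s a g) z - fprojs s a g z| <=
  rc (K ^+ size (j :: s) * B * wprod R s a * (Winf R - Wsum R M)).
Proof.
move=> us Yz; have /= /andP[js _] := us.
pose c := K ^+ size (j :: s) * B * wprod R s a.
have c0 : 0 <= c by rewrite !mulr_ge0 ?wprod_ge0 ?exprn_ge0 // /K; nra.
have bk k : `|fproj j k (fprojs s a g) z| <= rc (c * wt R k).
  have := norm_fprojs (upd a j k) us Yz; rewrite /= updE eqxx.
  rewrite (@eq_fprojs R n s (upd a j k) a g); last first.
    by move=> i si; rewrite updE; case: eqP => [e|//]; rewrite -e si in js.
  rewrite /wprod big_cons updE eqxx -/(wprod R s (upd a j k)) wprod_upd //.
  by rewrite /c /= (mulrC (wt R k)) mulrA.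
have lim := fproj_inversion rO j (fprojs_hol oO rO s a hg) (YO Yz).
apply: le_rc_eps => [|e e0]; first exact: normr_ge0.
have e0' : 0 < rc e :> C by rewrite -rc0 rc_lt.
have /cvgrPdist_le /(_ _ e0') hN := lim.
have hM : \forall N \near \oo, (M <= N)%N by exact: nbhs_infty_ge.
have [N [hN1 hN2]] := filter_ex (filterI hN hM).
have hd := norm_symsum_diff hN2 bk.
move: hN1; set G := fprojs s a g z; rewrite (_ : \sum_(0 <= i < N.*2.+1) _ =
  \sum_(k <- zint N) fproj j k (fprojs s a g) z); last by rewrite /zint big_map /index_iota subn0.
move: hd; set SN := \sum_(k <- zint N) _; set SM := \sum_(k <- zint M) _ => hd hN1.
have -> : SM - G = - (SN - SM) - (G - SN) by ring.
apply: le_trans (ler_normB _ _) _; rewrite normrN rcD; apply: lerD hN1.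
apply: le_trans hd _; rewrite rc_le ler_wpM2l // lerB //.
exact: Wsum_le_inf.
Qed.

(** Coordinates are added one at a time. The errors made in coordinate [j] are weighted by
    [wprod R s a], whose sum over any cube is at most [5 ^+ size s]; this makes the constant
    independent of [M]. *)
Lemma box_sum_error s : uniq s -> exists2 c : R, 0 <= c &
  forall M z, Y z ->
  `|\sum_(a <- box M s) fprojs s a g z - g z| <= rc (c * (Winf R - Wsum R M)).
Proof.
elim: s => [_|j s IH us].
  by exists 0 => // M z _; rewrite big_seq1 /= subrr normr0 mul0r rc0.
have /= /andP[js us'] := us.
have [c c0 hc] := IH us'.
have c1 : 0 <= K ^+ size (j :: s) * B * 5 ^+ size s.
  by rewrite !mulr_ge0 ?exprn_ge0 // /K; nra.
exists (K ^+ size (j :: s) * B * 5 ^+ size s + c); first by rewrite addr_ge0.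
move=> M z Yz; rewrite big_box_cons.
have W0 : 0 <= Winf R - Wsum R M by rewrite subr_ge0 Wsum_le_inf.
have -> : \sum_(a <- box M s) \sum_(k <- zint M) fprojs (j :: s) (upd a j k) g z - g z =
  \sum_(a <- box M s) (\sum_(k <- zint M) fproj j k (fprojs s a g) z - fprojs s a g z) +
  (\sum_(a <- box M s) fprojs s a g z - g z).
  rewrite sumrB addrA subrK; congr (_ - _); apply: eq_bigr => a _; apply: eq_bigr => k _.
  rewrite /= updE eqxx (@eq_fprojs R n s (upd a j k) a g) // => i si.
  by rewrite updE; case: eqP => [e|//]; rewrite -e si in js.
apply: le_trans (ler_normD _ _) _; rewrite mulrDl rcD; apply: lerD; last exact: hc.
apply: le_trans (ler_norm_sum _ _ _) _.
apply: le_trans (ler_sum _ (fun a _ => tail_fprojs M a us Yz)) _.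
rewrite -rc_sum rc_le -mulr_suml -mulr_sumr sum_wprod //.
apply: ler_wpM2r => //; apply: ler_wpM2l; last first.
  by rewrite lerXn2r ?nnegrE ?Wsum_ge0 // Wsum_bounded.
by rewrite mulr_ge0 ?exprn_ge0 // /K; nra.
Qed.

Let E := enum 'I_n.

(** The extra indices lie in some larger cube, so their weights sum to at most the difference of two
    powers of [Wsum]. *)
Lemma finite_sum_error M A z : uniq A -> {subset box M E <= A} -> Y z ->
  `|\sum_(a <- A) fprojs E a g z - \sum_(a <- box M E) fprojs E a g z| <=
  rc (K ^+ n * B * (Winf R ^+ n - Wsum R M ^+ n)).
Proof.
move=> uA sub Yz; have uE : uniq E by exact: enum_uniq.
have szE : size E = n by rewrite size_enum_ord.
have split_sum (T : zmodType) (F : 'rV[int]_n -> T) (D : seq 'rV[int]_n) : uniq D ->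
    {subset box M E <= D} ->
    \sum_(a <- D) F a = \sum_(a <- box M E) F a + \sum_(a <- D | a \notin box M E) F a.
  move=> uD sD; rewrite (bigID (mem (box M E))) /=; congr (_ + _).
  rewrite -big_filter; apply: perm_big; apply: uniq_perm; rewrite ?filter_uniq ?box_uniq //.
  by move=> a; rewrite mem_filter; case: (boolP (a \in box M E)) => // /sD.
rewrite (split_sum _ _ A uA sub) addrC addKr.
have [N0 hN0] := ex_box A.
pose N := maxn N0 M.
have AN : {subset A <= box N E} by apply: hN0; exact: leq_maxl.
have BN : {subset box M E <= box N E} by apply: box_subset; exact: leq_maxr.
have c0 : 0 <= K ^+ n * B by rewrite mulr_ge0 ?exprn_ge0 // /K; nra.
apply: le_trans (ler_norm_sum _ _ _) _.
have h a : true -> `|fprojs E a g z| <= rc (K ^+ n * B * wprod R E a).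
  by move=> _; have := norm_fprojs a uE Yz; rewrite szE.
apply: le_trans (ler_sum _ (fun a _ => h a isT)) _.
rewrite -rc_sum rc_le -mulr_sumr; apply: ler_wpM2l => //.
apply: (@le_trans _ _ (\sum_(a <- box N E | a \notin box M E) wprod R E a)).
  rewrite -big_filter -[leRHS]big_filter.
  set A' := [seq i <- A | i \notin box M E]; set N' := [seq i <- box N E | i \notin box M E].
  have sA : {subset A' <= N'}.
    by move=> a; rewrite !mem_filter => /andP[-> /AN ->].
  have uA' : uniq A' by rewrite filter_uniq.
  have uN' : uniq N' by rewrite filter_uniq // box_uniq.
  rewrite [leRHS](bigID (mem A')) /= -[X in X + _]big_filter.
  have -> : \sum_(i <- [seq i <- N' | i \in A']) wprod R E i = \sum_(i <- A') wprod R E i.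
    apply: perm_big; apply: uniq_perm; rewrite ?filter_uniq ?box_uniq //.
    by move=> a; rewrite mem_filter; case: (boolP (a \in A')) => // /sA.
  by rewrite lerDl; apply: sumr_ge0 => a _; exact: wprod_ge0.
have := split_sum _ (wprod R E) (box N E) (box_uniq _ uE) BN.
rewrite !sum_wprod // szE => e.
have -> : \sum_(a <- box N E | a \notin box M E) wprod R E a = Wsum R N ^+ n - Wsum R M ^+ n.
  by rewrite e addrAC subrr add0r.
apply: lerB => //; rewrite lerXn2r ?nnegrE ?Wsum_ge0 ?Wsum_le_inf //.
exact: le_trans (Wsum_ge0 R 0) (Wsum_le_inf R 0).
Qed.

Lemma fprojs_sum_uniform (tau : nat -> 'rV[int]_n) (e : R) : bijective tau -> 0 < e ->
  exists N0, forall N, (N0 <= N)%N -> forall z, Y z ->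
  `|\sum_(i < N) fprojs E (tau i) g z - g z| <= rc e.
Proof.
move=> [tau' tK tK'] e0.
have [c c0 hc] := box_sum_error (enum_uniq 'I_n).
(* First the cost of indices outside the cube, then the error of the cube sum itself. *)
pose h M := K ^+ n * B * (Winf R ^+ n - Wsum R M ^+ n) + c * (Winf R - Wsum R M).
have h0 : h @ \oo --> (0 : R).
  have -> : (0 : R) = K ^+ n * B * (Winf R ^+ n - Winf R ^+ n) + c * (Winf R - Winf R).
    by rewrite !subrr !mulr0 addr0.
  have cW := @Wsum_cvg R.
  have cWn : (fun M => Wsum R M ^+ n) @ \oo --> Winf R ^+ n.
    exact: (cvg_comp _ _ cW (@exprn_continuous R n (Winf R))).
  by apply: cvgD; apply: cvgMr; apply: cvgB => //; exact: cvg_cst.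
have /cvgrPdist_le /(_ _ e0) hM := h0.
have [M hM1] := filter_ex hM.
have hMe : h M <= e.
  by move: hM1; rewrite sub0r normrN; exact: le_trans (ler_norm _).
(* [tau'] gives the position of an index in the enumeration; past the last position of a cube
   element, the partial sum contains the whole cube. *)
exists (\max_(a <- box M E) (tau' a).+1)%N => N hN z Yz.
pose A := [seq tau i | i <- iota 0 N].
have uA : uniq A by rewrite map_inj_uniq ?iota_uniq //; exact: can_inj tK.
have sA : {subset box M E <= A}.
  move=> a aM; apply/mapP; exists (tau' a); last by rewrite tK'.
  rewrite mem_iota /= add0n; apply: leq_trans hN.
  exact: (leq_bigmax_seq _ aM isT).
have -> : \sum_(i < N) fprojs E (tau i) g z = \sum_(a <- A) fprojs E a g z.
  rewrite /A big_map -(big_mkord xpredT (fun i => fprojs E (tau i) g z)).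
  by rewrite /index_iota subn0.
have h1 := finite_sum_error uA sA Yz; have h2 := hc M z Yz.
move: h1 h2; set SA := \sum_(a <- A) _; set SM := \sum_(a <- box M E) _ => h1 h2.
rewrite (_ : SA - g z = (SA - SM) + (SM - g z)); last by ring.
apply: le_trans (ler_normD _ _) _; apply: le_trans (lerD h1 h2) _.
by rewrite -rcD rc_le.
Qed.

End Summation.

(** * Differentiability and passage to the closure *)

Section ContinuouslyDifferentiable.
Variables (R : realType) (n : nat).
Local Notation C := (Cplx R).
Local Notation V := 'rV[C]_n.
Variable Omega : set V.
Hypothesis oO : open Omega.
Variable f : V -> C.
Hypothesis hf : hol Omega f.

Lemma norm_coord_le (h : V) j : `|h ord0 j| <= `|h|.
Proof.
rewrite [leRHS]/Num.Def.normr /= mx_normE.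
have le := le_bigmax (0%:nng : {nonneg C}) (fun i : 'I_1 * 'I_n => `|h i.1 i.2|%:nng) (ord0, j).
exact: le.
Qed.

Lemma mix_cons j s (w z : V) : j \notin s ->
  mix (j :: s) w z = mix s w z + (w ord0 j - z ord0 j) *: bv R j.
Proof.
move=> js; apply/rowP => i; rewrite coord_bv [LHS]mxE [mix s w z _ _]mxE in_cons.
have [->|_] := eqVneq i j; last by rewrite mulr0 addr0.
by rewrite (negPf js) /= mulr1 addrC subrK.
Qed.

(** The increment from [z] to [w] is split into moves in single coordinates, each estimated by
    [dir_mean_value] with the derivative at [z] as slope. *)
Lemma hol_increment (z : V) (e : R) : Omega z -> 0 < e ->
  exists2 r : R, 0 < r & forall w, polydisc z r w ->
  `|f w - f z - \sum_j (w ord0 j - z ord0 j) * partial j f z| <= rc e * `|w - z|.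
Proof.
move=> Oz e0; have [_ df cpf] := hf.
(* The 2 is the constant of [dir_mean_value]; there are [n] moves, and [n.+1] keeps the denominator
   positive. *)
pose e' := e / (2 * n.+1%:R).
have e'0 : 0 < e' by rewrite divr_gt0 // mulr_gt0.
have e'0C : 0 < rc e' :> C by rewrite -rc0 rc_lt.
have near_j j : \forall w \near z, `|partial j f z - partial j f w| < rc e'.
  have h : \forall w \near z, Omega w -> `|partial j f z - partial j f w| < rc e'.
    by have := cpf j z Oz => /cvgrPdist_lt /(_ _ e'0C); rewrite near_withinE.
  by apply: filterS2 (open_near oO Oz) h => w Ow; exact.
have near_all : \forall w \near z, Omega w /\ forall j, `|partial j f z - partial j f w| < rc e'.
  have h : \forall w \near z, forall j, `|partial j f z - partial j f w| < rc e'.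
    exact: filter_forall near_j.
  by apply: filterS2 (open_near oO Oz) h => w Ow hw; split.
have [r r0 sub] := nbhs_polydisc near_all.
exists r => // w Dw.
have claim s : uniq s ->
    `|f (mix s w z) - f z - \sum_(j <- s) (w ord0 j - z ord0 j) * partial j f z| <=
    rc (2 * e' * (size s)%:R) * `|w - z|.
  elim: s => [_|j s IH /= /andP[js us]].
    have -> : mix [::] w z = z by apply/rowP => i; rewrite mxE.
    by rewrite big_nil subrr subr0 normr0 mulr0 rc0 mul0r.
  rewrite big_cons mix_cons //.
  set u := mix s w z in IH *; set h := w ord0 j - z ord0 j.
  set S := \sum_(_ <- s) _ in IH *.
  have inD x : 0 <= x <= 1 -> polydisc z r (u + (rc x * h) *: bv R j).
    move=> /andP[x0 x1] i; rewrite coord_bv [u _ _]mxE.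
    have [->|_] := eqVneq i j.
      rewrite (negPf js) mulr1 addrC addKr normrM [`|rc x|]normC_real (ger0_norm x0).
      apply: le_lt_trans (Dw j); rewrite -[leRHS]mul1r; apply: ler_wpM2r => //.
      by rewrite -rc1 rc_le.
    rewrite mulr0 addr0; case: ifP => _; first exact: Dw.
    by rewrite subrr normr0 -rc0 rc_lt.
  have mv := @dir_mean_value R V f (partial j f) u (bv R j) h (partial j f z) e'.
  have {}mv : `|f (u + h *: bv R j) - f u - h * partial j f z| <= rc (2 * e') * `|h|.
    apply: mv => x x01.
      have [Op _] := sub _ (inD x x01).
      by apply: derivable_is_derive; exact: df Op.
    by have [_ hp] := sub _ (inD x x01); rewrite distrC ltW.
  have -> : f (u + h *: bv R j) - f z - (h * partial j f z + S) =
    (f (u + h *: bv R j) - f u - h * partial j f z) + (f u - f z - S) by ring.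
  apply: le_trans (ler_normD _ _) _.
  have -> : rc (2 * e' * (size s).+1%:R) = rc (2 * e') + rc (2 * e' * (size s)%:R) :> C.
    by rewrite -rcD; congr rc; rewrite -(natr1 (size s)) mulrDr mulr1 addrC.
  rewrite [leRHS]mulrDl; apply: lerD; last exact: IH.
  apply: le_trans mv _; apply: ler_wpM2l.
    by rewrite -rc0 rc_le mulr_ge0 // ltW.
  by have := norm_coord_le (w - z) j; rewrite !mxE.
have := claim (enum 'I_n) (enum_uniq _); rewrite big_enum size_enum_ord /=.
have -> : mix (enum 'I_n) w z = w by apply/rowP => i; rewrite mxE mem_enum.
move=> /le_trans; apply; apply: ler_wpM2r; first exact: normr_ge0.
have n0 : 0 < 2 * n.+1%:R :> R by rewrite mulr_gt0.
rewrite rc_le mulrAC -[leRHS](@divfK _ (2 * n.+1%:R)) ?gt_eqF // mulrC.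
by apply: ler_wpM2l; [exact: ltW|rewrite ler_pM2l // ler_nat].
Qed.

(** Membership in [Ainfty] asks for a total differential, whereas the projections are controlled
    through continuous partial derivatives. *)
Lemma hol_holomorphic : holomorphic Omega f.
Proof.
move=> z Oz.
pose lin : V -> C := \sum_(j < n) (partial j f z *: (fun w : V => w ord0 j : C)).
have linE w : lin w = \sum_j w ord0 j * partial j f z.
  by rewrite /lin fct_sumE; apply: eq_bigr => j _; rewrite mulrC.
have dlin : differentiable lin z.
  apply: differentiable_sum => j; apply: differentiableZ.
  exact: differentiable_coord.
(* The remainder should have differential 0, so only a little-o estimate is left; [lin] is
   differentiable as a combination of coordinates. *)
pose g := f - lin.
have gE : g \o shift z = cst (g z) + \0 +o_ (nbhs (0 : V)) id.
  apply/eqaddoP => e e0; have [e1 e2] := gt0_Re e0.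
  have [r r0 hr] := hol_increment Oz e1.
  have h1 : \forall h \near (0 : V), polydisc 0 r h.
    exact: open_near (@polydisc_open R n 0 r r0) (@polydisc_center R n 0 r r0).
  apply: filterS h1 => h Dh.
  have Dz : polydisc z r (h + z).
    by move=> i; have := Dh i; rewrite !mxE subr0 addrK.
  have := hr _ Dz; rewrite addrK -e2.
  have -> // : f (h + z) - f z - \sum_j ((h + z) ord0 j - z ord0 j) * partial j f z =
     (g \o shift z - (cst (g z) + \0)) h.
  rewrite -[RHS]/(f (h + z) - lin (h + z) - ((f z - lin z) + 0)) !linE addr0.
  have -> : \sum_j ((h + z) ord0 j - z ord0 j) * partial j f z =
    \sum_j (h + z) ord0 j * partial j f z - \sum_j z ord0 j * partial j f z.
    by rewrite -sumrB; apply: eq_bigr => j _; rewrite mulrBl.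
  by ring.
have dg : differentiable g z.
  have c0 : continuous (\0 : {linear V -> C}) by exact: cst_continuous.
  have e := diff_unique c0 gE.
  apply/diff_locallyP; rewrite e; split; [exact: c0|exact: gE].
have -> : f = g + lin by rewrite /g subrK.
exact: differentiableD dg dlin.
Qed.

End ContinuouslyDifferentiable.

Section FiniteSums.
Variables (R : realType) (n : nat).
Local Notation C := (Cplx R).
Local Notation V := 'rV[C]_n.
Variable Omega : set V.
Hypothesis oO : open Omega.
Implicit Types (g : V -> C) (b : 'rV[nat]_n).

Lemma cont_on_add (X : set V) g1 g2 :
  cont_on X g1 -> cont_on X g2 -> cont_on X (fun z => g1 z + g2 z).
Proof. by move=> h1 h2 z Xz; exact: cvgD (h1 z Xz) (h2 z Xz). Qed.

Lemma partial_add j g1 g2 : hol Omega g1 -> hol Omega g2 ->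
  eqon Omega (partial j (fun z => g1 z + g2 z)) (fun z => partial j g1 z + partial j g2 z).
Proof.
by move=> [_ d1 _] [_ d2 _] z Oz; exact: deriveD (d1 j z Oz) (d2 j z Oz).
Qed.

Lemma hol_add g1 g2 : hol Omega g1 -> hol Omega g2 -> hol Omega (fun z => g1 z + g2 z).
Proof.
move=> h1 h2; have [c1 d1 p1] := h1; have [c2 d2 p2] := h2; split.
- exact: cont_on_add.
- by move=> j z Oz; exact: derivableD (d1 j z Oz) (d2 j z Oz).
- move=> j; apply: cont_on_eq (cont_on_add (p1 j) (p2 j)) => z Oz.
  exact: esym (partial_add j h1 h2 Oz).
Qed.

Lemma partial_zero j : partial j (fun _ : V => 0 : C) = fun _ => 0.
Proof. by apply/funext => z; exact: derive_cst. Qed.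

Lemma hol_zero : hol Omega (fun _ => 0).
Proof.
split.
- by move=> z Oz; exact: cvg_cst.
- by move=> j z Oz; exact: derivable_cst.
- move=> j; have -> : 'D_(bv R j) (fun _ : V => 0 : C) = fun _ => 0 by exact: partial_zero.
  by move=> z Oz; exact: cvg_cst.
Qed.

Lemma Dmulti_add b g1 g2 : hol Omega g1 -> hol Omega g2 ->
  eqon Omega (Dmulti b (fun z => g1 z + g2 z)) (fun z => Dmulti b g1 z + Dmulti b g2 z).
Proof.
move=> h1 h2.
have it m j u1 u2 : hol Omega u1 -> hol Omega u2 ->
    eqon Omega (iter m (partial j) (fun z => u1 z + u2 z))
      (fun z => iter m (partial j) u1 z + iter m (partial j) u2 z).
  move=> hu1 hu2; elim: m => [//|m IH]; rewrite !iterS.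
  apply: eqon_trans (partial_eqon oO j _ IH) _.
    exact: (iter_hol oO m j (hol_add hu1 hu2)).
  exact: (partial_add j (iter_hol oO m j hu1) (iter_hol oO m j hu2)).
suff h t : eqon Omega (partials t b (fun z => g1 z + g2 z))
    (fun z => partials t b g1 z + partials t b g2 z).
  exact: (h (enum 'I_n)).
elim: t => [//|j t IH] /=.
apply: eqon_trans (iter_eqon oO _ _ _ IH) _.
  exact: (partials_hol oO t b (hol_add h1 h2)).
exact: (it _ _ _ _ (partials_hol oO t b h1) (partials_hol oO t b h2)).
Qed.

Lemma Dmulti_zero b : Dmulti b (fun _ : V => 0 : C) = fun _ => 0.
Proof.
rewrite /Dmulti; elim: (enum 'I_n) => [//|j s IH] /=; rewrite IH.
by elim: (b ord0 j) => [//|m IHm]; rewrite iterS IHm partial_zero.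
Qed.

Lemma cont_on_sum (X : set V) (F : nat -> V -> C) N : (forall i, cont_on X (F i)) ->
  cont_on X (fun z => \sum_(i < N) F i z).
Proof.
move=> hF; elim: N => [|N IH].
  apply: (@cont_on_eq _ _ X (fun _ => 0)); last by move=> z _; exact: cvg_cst.
  by move=> z _; rewrite big_ord0.
apply: cont_on_eq (cont_on_add IH (hF N)) => z _.
by rewrite big_ord_recr.
Qed.

Lemma hol_sum (F : nat -> V -> C) N : (forall i, hol Omega (F i)) ->
  hol Omega (fun z => \sum_(i < N) F i z).
Proof.
move=> hF; elim: N => [|N IH].
  by apply: (hol_eqon oO hol_zero) => z _; rewrite big_ord0.
by apply: (hol_eqon oO (hol_add IH (hF N))) => z _; rewrite big_ord_recr.
Qed.

Lemma Dmulti_sum b (F : nat -> V -> C) N : (forall i, hol Omega (F i)) ->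
  eqon Omega (Dmulti b (fun z => \sum_(i < N) F i z)) (fun z => \sum_(i < N) Dmulti b (F i) z).
Proof.
move=> hF; elim: N => [|N IH].
  have -> : (fun z : V => \sum_(i < 0) F i z) = fun _ => 0.
    by apply/funext => z; rewrite big_ord0.
  by rewrite Dmulti_zero => z _; rewrite big_ord0.
have -> : (fun z : V => \sum_(i < N.+1) F i z) = fun z => \sum_(i < N) F i z + F N z.
  by apply/funext => z; rewrite big_ord_recr.
apply: eqon_trans (Dmulti_add b (hol_sum N hF) (hF N)) _ => z Oz.
by rewrite big_ord_recr /= (IH z Oz).
Qed.

End FiniteSums.

(** * Rotation invariance and continuous extension to the closure *)

Section ReinhardtClosure.
Variables (R : realType) (n : nat).
Local Notation C := (Cplx R).
Local Notation V := 'rV[C]_n.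
Variable Omega : set V.
Implicit Types (g h : V -> C) (z : V).

Lemma reinhardt_rot_inv : reinhardt Omega -> rot_inv Omega.
Proof.
move=> rO j t z Oz.
have := rO (\row_l (if l == j then expi t else 1)) z _ Oz.
have -> : \row_l ((\row_l (if l == j then expi t else 1)) ord0 l * z ord0 l) = turn j t z.
  apply/rowP => l; rewrite turnE [LHS]mxE [X in X * _]mxE.
  by case: eqP => [->//|_]; rewrite mul1r.
by apply=> l; rewrite mxE; case: ifP => _; [exact: norm_expi|exact: normr1].
Qed.

Lemma rot_inv_closure : rot_inv Omega -> rot_inv (closure Omega).
Proof.
move=> rO j t z clz A nA.
have [[A1 A2] /= [tA1 zA2] sub] := @turn_joint R n j t z A nA.
have [w [Ow A2w]] := clz A2 zA2.
exists (turn j t w); split; first exact: rO.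
apply: (sub (t, w)); split => //=.
exact: nbhs_singleton tA1.
Qed.

Lemma closure_extE g h z : cont_on (closure Omega) h -> eqon Omega h g ->
  closure Omega z -> closure_ext Omega g z = h z.
Proof.
move=> ch e clz.
have PF : ProperFilter (within Omega (nbhs z)) by exact: within_nbhs_proper.
apply: cvg_lim; first exact: norm_hausdorff.
have hO : h @ within Omega (nbhs z) --> h z.
  have := ch z clz; apply: cvg_trans; apply: cvg_app.
  by apply: within_subset; exact: subset_closure.
apply: cvg_near_eq hO _; rewrite near_withinE; near=> w => Ow; exact: e.
Unshelve. all: by end_near. Qed.

Lemma extends_cont_on g : extends_to_closure Omega g ->
  exists2 h, cont_on (closure Omega) h & eqon Omega h g.
Proof. by move=> [h [/subspace_continuousP ch e]]; exists h. Qed.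

Lemma cont_on_extends g h : cont_on (closure Omega) h -> eqon Omega h g ->
  extends_to_closure Omega g.
Proof. by move=> ch e; exists h; split => //; apply/subspace_continuousP. Qed.

Lemma Dmulti_unit j (g : V -> C) : Dmulti (\row_i (i == j : nat)) g = partial j g.
Proof.
suff h s : uniq s -> partials s (\row_i (i == j : nat)) g = if j \in s then partial j g else g.
  by have := h (enum 'I_n) (enum_uniq _); rewrite mem_enum.
elim: s => [//|i s IH] /= /andP[is_ us]; rewrite IH // mxE in_cons.
have [e|ij] := eqVneq i j; last reflexivity.
rewrite -e (negPf is_); reflexivity.
Qed.

(** Continuity of the first partial derivatives is read off from their extensions to the closure. *)
Lemma Ainfty_hol f : open Omega -> Ainfty Omega f -> hol Omega f.
Proof.
move=> oO [hf ext]; split.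
- by move=> z Oz; apply: cont_on_cvg; exact: differentiable_continuous (hf z Oz).
- by move=> j z Oz; exact: diff_derivable (hf z Oz).
- move=> j; have [h ch e] := extends_cont_on (ext (\row_i (i == j : nat))).
  rewrite Dmulti_unit in e.
  apply: cont_on_eq e _; apply: cont_on_sub ch; exact: subset_closure.
Qed.

(** [Y] localizes the limit: a bound on a bounded piece of the domain passes to those closure points
    that have [Y] as a neighborhood. *)
Lemma closure_bound h (Y : set V) (c : R) z : cont_on (closure Omega) h ->
  closure Omega z -> nbhs z Y -> (forall w, Omega w -> Y w -> `|h w| <= rc c) ->
  `|h z| <= rc c.
Proof.
move=> ch clz nY hY.
have PF : ProperFilter (within Omega (nbhs z)) by exact: within_nbhs_proper.
have hO : h @ within Omega (nbhs z) --> h z.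
  have := ch z clz; apply: cvg_trans; apply: cvg_app.
  by apply: within_subset; exact: subset_closure.
apply: le_rc_eps => [|e e0]; first exact: normr_ge0.
have e0C : 0 < rc e :> C by rewrite -rc0 rc_lt.
have /cvgrPdist_le /(_ _ e0C) h1 := hO.
have h2 : \forall w \near within Omega (nbhs z), Omega w /\ Y w.
  by rewrite near_withinE; apply: filterS nY => w Yw Ow.
have [w [hw [Ow Yw]]] := filter_ex (filterI h1 h2).
rewrite -(subrK (h w) (h z)) addrC rcD; apply: le_trans (ler_normD _ _) _.
by apply: lerD; [exact: hY|exact: hw].
Unshelve. all: by end_near. Qed.

End ReinhardtClosure.

Section CompactBounds.
Variables (R : realType) (n : nat).
Local Notation C := (Cplx R).
Local Notation V := 'rV[C]_n.

Lemma compact_norm_bound (Q : set V) (g : V -> C) : compact Q -> cont_on Q g ->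
  exists2 M : R, 0 < M & forall z, Q z -> `|g z| <= rc M.
Proof.
move=> cQ cg.
pose N (z : V) : R := complex.Re `|g z|.
have cN : {within Q, continuous N}.
  apply/subspace_continuousP => z Qz.
  have h : (fun w => `|g w|) @ within Q (nbhs z) --> `|g z| by exact: cvg_norm (cg z Qz).
  exact: cvg_Re h.
have [M [_ hM]] := compact_bounded (continuous_compact cN cQ).
exists (`|M| + 1); first by rewrite ltr_wpDl.
move=> z Qz; have [N0 ->] := ge0_Re (normr_ge0 (g z)); rewrite rc_le.
apply: le_trans (ler_norm _) _; apply: (hM (`|M| + 1)); last by exists z.
by apply: le_lt_trans (ler_norm _) _; rewrite ltrDl.
Qed.

(** A product of squares instead of discs: each square is the continuous image of a product of two
    segments. *)
Lemma compact_box (m : R) :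
  compact [set z : V | forall j, [set c : C | exists2 p : R * R,
    (`[- m, m] `*` `[- m, m])%classic p & p.1 +i* p.2 = c] (z ord0 j)].
Proof.
apply: (@rV_compact C n (fun _ => [set c : C | exists2 p : R * R,
    (`[- m, m] `*` `[- m, m])%classic p & p.1 +i* p.2 = c])) => _.
have cI : compact (`[- m, m] `*` `[- m, m])%classic.
  by apply: compact_setX; exact: segment_compact.
have cf : {within (`[- m, m] `*` `[- m, m])%classic,
    continuous (fun p : R * R => p.1 +i* p.2 : C)}.
  apply: continuous_subspaceT => p.
  by apply: cvg_ReIm; [exact: cvg_fst|exact: cvg_snd].
exact: continuous_compact cf cI.
Qed.

Lemma closed_bounded_norm_bound (Q : set V) (h : V -> C) (m : R) :
  closed Q -> cont_on Q h ->
  exists2 M : R, 0 < M & forall z, Q z -> (forall j, `|z ord0 j| <= rc m) -> `|h z| <= rc M.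
Proof.
move=> cQ ch; set P := [set z : V | forall j, [set c : C | exists2 p : R * R,
    (`[- m, m] `*` `[- m, m])%classic p & p.1 +i* p.2 = c] (z ord0 j)].
have cP : compact P := @compact_box m.
have cPQ : compact (Q `&` P) by rewrite setIC; exact: compact_closedI.
have chP : cont_on (Q `&` P) h by apply: cont_on_sub ch; exact: subIsetl.
have [M M0 hM] := compact_norm_bound cPQ chP.
exists M => // z Qz zm; apply: hM; split => // j /=.
exists (complex.Re (z ord0 j), complex.Im (z ord0 j)); last by case: (z ord0 j).
have hr := le_trans (Re_le_norm _) (zm j); have hi := le_trans (Im_le_norm _) (zm j).
move: hr hi; rewrite !rc_le => hr hi.
by split; rewrite /= in_itv /= -ler_norml.
Qed.

End CompactBounds.

(** * Partial sums in the topology of the closure *)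

Section LaurentSeries.
Variables (R : realType) (n : nat).
Local Notation C := (Cplx R).
Local Notation V := 'rV[C]_n.
Variables (Omega : set V) (f : V -> C).
Hypothesis oO : open Omega.
Hypothesis rO : rot_inv Omega.
Hypothesis hf : hol Omega f.
Hypothesis ext : forall b, extends_to_closure Omega (Dmulti b f).
Implicit Types (b : 'rV[nat]_n).

(** The derivative depends only on the set of coordinates in [t]. There are finitely many such sets,
    and the sum of their bounds serves all of them. *)
Lemma second_partials_Dmulti_bounded (m : R) b : exists2 B : R, 0 <= B &
  forall t, uniq t -> forall w, Omega w -> (forall j, `|w ord0 j| <= rc m) ->
  `|second_partials t (Dmulti b f) w| <= rc B.
Proof.
have bd b' : exists B : R, 0 < B /\ forall w, Omega w -> (forall j, `|w ord0 j| <= rc m) ->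
    `|Dmulti b' f w| <= rc B.
  have [h ch e] := extends_cont_on (ext b').
  have [B B0 hB] := closed_bounded_norm_bound m (@closed_closure _ Omega) ch.
  exists B; split => // w Ow wm; rewrite -(e w Ow); apply: hB => //.
  exact: subset_closure.
have [B hB] := choice (fun A : {set 'I_n} => bd (\row_i (b ord0 i + (i \in A).*2)%N)).
exists (\sum_A B A); first by apply: sumr_ge0 => A _; have [/ltW] := hB A.
move=> t ut w Ow wm; rewrite (second_partials_Dmulti oO b hf ut Ow).
have [_ h] := hB [set i in t].
have -> : \row_i (b ord0 i + (i \in t).*2)%N =
    \row_i (b ord0 i + (i \in [set i in t]).*2)%N :> 'rV[nat]_n.
  by apply/rowP => i; rewrite !mxE inE.
apply: le_trans (h w Ow wm) _; rewrite rc_le (bigD1 [set i in t]) //= lerDl.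
by apply: sumr_ge0 => A _; have [/ltW] := hB A.
Qed.

Let E := enum 'I_n.
Variable sigma : nat -> 'rV[int]_n.

Definition psum N : V -> C := fun z => \sum_(i < N) fprojs E (sigma i) f z.

Definition shifted b i : 'rV[int]_n := \row_l (sigma i ord0 l - (b ord0 l)%:Z).

Lemma psum_hol N : hol Omega (psum N).
Proof. exact: (hol_sum oO N (fun i => fprojs_hol oO rO E (sigma i) hf)). Qed.

Lemma Dmulti_psum b N :
  eqon Omega (Dmulti b (psum N)) (fun z => \sum_(i < N) fprojs E (shifted b i) (Dmulti b f) z).
Proof.
apply: eqon_trans (Dmulti_sum oO b N (fun i => fprojs_hol oO rO E (sigma i) hf)) _.
by move=> z Oz; apply: eq_bigr => i _; exact: (Dmulti_fprojs oO rO b (sigma i) hf Oz).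
Qed.

(** The projections are applied to the extension [h] on the closure, which is rotation invariant;
    this yields boundary continuity even for terms with negative exponents. *)
Lemma psum_ext b N (h : V -> C) : cont_on (closure Omega) h -> eqon Omega h (Dmulti b f) ->
  cont_on (closure Omega) (fun z => \sum_(i < N) fprojs E (shifted b i) h z) /\
  eqon Omega (fun z => \sum_(i < N) fprojs E (shifted b i) h z) (Dmulti b (psum N)).
Proof.
move=> ch e; split.
  have rC := rot_inv_closure rO.
  exact: (@cont_on_sum R n _ (fun i => fprojs E (shifted b i) h) N
    (fun i => @fprojs_cont R n _ E (shifted b i) h rC ch)).
move=> z Oz; rewrite (Dmulti_psum b N Oz); apply: eq_bigr => i _.
exact: (fprojs_eqon rO E (shifted b i) e Oz).
Qed.

Lemma psum_Ainfty N : Ainfty Omega (psum N).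
Proof.
split; first exact: (hol_holomorphic oO (psum_hol N)).
move=> b; have [h ch e] := extends_cont_on (ext b).
by have [c' e'] := psum_ext N ch e; exact: cont_on_extends c' e'.
Qed.

Hypothesis bij_sigma : bijective sigma.

(** Differentiation translates the indices by a fixed vector, so the differentiated series again
    runs once through all projections, now of [Dmulti b f]. *)
Lemma shifted_bij b : bijective (shifted b).
Proof.
have [tau sK tK] := bij_sigma.
exists (fun a : 'rV[int]_n => tau (\row_l (a ord0 l + (b ord0 l)%:Z))).
  move=> i; rewrite -[RHS]sK; congr tau; apply/rowP => l.
  by rewrite !mxE subrK.
by move=> a; apply/rowP => l; rewrite mxE tK mxE addrK.
Qed.

Lemma psum_uniform (K : set V) b (eps : R) : compact K -> K `<=` closure Omega -> 0 < eps ->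
  exists N0, forall N, (N0 <= N)%N -> forall z, K z ->
  `|closure_ext Omega (Dmulti b (psum N)) z - closure_ext Omega (Dmulti b f) z| <= rc eps.
Proof.
move=> cK Kcl eps0.
have coord_bd j : exists M : R, 0 < M /\ forall z, K z -> `|z ord0 j| <= rc M.
  have cc : cont_on K (fun z : V => z ord0 j : C).
    by move=> z _; apply: cont_on_cvg; exact: coord_cvg.
  by have [M M0 hM] := compact_norm_bound cK cc; exists M.
have [M hM] := choice coord_bd.
(* Strictly above every coordinate bound on [K], so that the open polydisc of radius [m] is a
   neighborhood of each point of [K]. *)
pose m := \sum_j M j + 1.
have Mm j : M j < m.
  rewrite /m (bigD1 j) //= -addrA ltrDl; apply: ltr_wpDl => //.
  by apply: sumr_ge0 => i _; have [/ltW] := hM i.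
have m0 : 0 <= m.
  by rewrite /m addr_ge0 //; apply: sumr_ge0 => i _; have [/ltW] := hM i.
pose Y := Omega `&` [set z : V | forall j, `|z ord0 j| < rc m].
have YO : Y `<=` Omega by exact: subIsetl.
have rY : rot_inv Y.
  move=> j t z [Oz zm]; split; first exact: rO.
  move=> l; rewrite turnE; case: eqP => _; last exact: zm.
  by rewrite normrM norm_expi mul1r.
have Ym z j : Y z -> `|z ord0 j| <= rc m by move=> [_ zm]; exact: ltW (zm j).
have [B B0 hB] := second_partials_Dmulti_bounded m b.
have gB t : uniq t -> forall w, Y w -> `|second_partials t (Dmulti b f) w| <= rc B.
  by move=> ut w [Ow wm]; apply: hB => // j; exact: ltW.
have hD := Dmulti_hol oO b hf.
have [N0 hN0] := fprojs_sum_uniform oO rO YO rY m0 Ym hD B0 gB (shifted_bij b) eps0.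
exists N0 => N N0N z Kz.
have [h ch e] := extends_cont_on (ext b).
have [cH eH] := psum_ext N ch e.
have clz := Kcl z Kz.
rewrite (closure_extE cH eH clz) (closure_extE ch e clz).
(* The error is continuous on the closure and bounded by [eps] on [Y]; [closure_bound] carries the
   bound to [K]. *)
pose D w := \sum_(i < N) fprojs E (shifted b i) h w - h w.
have cD : cont_on (closure Omega) D.
  by move=> w clw; exact: cvgB (cH w clw) (ch w clw).
have nz : nbhs z [set w : V | forall j, `|w ord0 j| < rc m].
  have -> : [set w : V | forall j, `|w ord0 j| < rc m] = polydisc 0 m.
    by apply/seteqP; split => w h1 j; have := h1 j; rewrite mxE subr0.
  apply: open_near (@polydisc_open R n 0 m _) _.
    by rewrite /m ltr_wpDl //; apply: sumr_ge0 => i _; have [/ltW] := hM i.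
  move=> j; rewrite mxE subr0; have [_ hMj] := hM j.
  by apply: le_lt_trans (hMj z Kz) _; rewrite rc_lt.
apply: (closure_bound cD clz nz) => w Ow wm.
have Yw : Y w by [].
have := hN0 N N0N w Yw; rewrite /D (e w Ow).
have -> // : \sum_(i < N) fprojs E (shifted b i) h w =
   \sum_(i < N) fprojs E (shifted b i) (Dmulti b f) w.
by apply: eq_bigr => i _; exact: (fprojs_eqon rO E (shifted b i) e Ow).
Qed.

End LaurentSeries.

Section FromPartialSums.
Variables (R : realType) (n : nat).
Local Notation C := (Cplx R).
Local Notation V := 'rV[C]_n.
Variables (Omega : set V).
Hypothesis oO : open Omega.

Lemma Ainfty_eqon (g1 g2 : V -> C) : Ainfty Omega g1 -> eqon Omega g1 g2 ->
  Ainfty Omega g2.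
Proof.
move=> A1 e; have h1 := Ainfty_hol oO A1; have [_ ext1] := A1.
split; first exact: (hol_holomorphic oO (hol_eqon oO h1 e)).
move=> b; have [h ch eh] := extends_cont_on (ext1 b).
apply: (cont_on_extends ch); exact: eqon_trans eh (Dmulti_eqon oO b h1 e).
Qed.

Lemma closure_ext_eqon b (g1 g2 : V -> C) z : Ainfty Omega g1 -> eqon Omega g1 g2 ->
  closure Omega z -> closure_ext Omega (Dmulti b g1) z = closure_ext Omega (Dmulti b g2) z.
Proof.
move=> A1 e clz; have h1 := Ainfty_hol oO A1; have [_ ext1] := A1.
have [h ch eh] := extends_cont_on (ext1 b).
rewrite (closure_extE ch eh clz).
rewrite (closure_extE ch (eqon_trans eh (Dmulti_eqon oO b h1 e)) clz).
reflexivity.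
Qed.

Lemma cvg_uniform_rc (K : set V) (u : nat -> V -> C) (g : V -> C) :
  (forall eps : R, 0 < eps -> exists N0, forall N, (N0 <= N)%N ->
     forall z, K z -> `|u N z - g z| <= rc eps) ->
  {uniform K, u @ \oo --> g}.
Proof.
move=> h P /uniform_nbhs[E [entE subP]].
move: entE; rewrite -entourage_ballE => -[d d0 subE].
have [d1 dE] := gt0_Re d0.
have d2 : 0 < complex.Re d / 2 by rewrite divr_gt0.
have [N0 hN0] := h _ d2.
exists N0 => // N /= N0N; apply: subP => z Kz; apply: subE => /=.
rewrite -ball_normE /= distrC; apply: le_lt_trans (hN0 N N0N z Kz) _.
by rewrite [ltRHS]dE rc_lt ltr_pdivrMr // mulr_natr mulr2n ltrDl.
Qed.

End FromPartialSums.

Theorem theorem1p1 (R : realType) (n : nat) (n_gt0 : (0 < n)%N)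
  (Omega : set 'rV[Cplx R]_n) (f : 'rV[Cplx R]_n -> Cplx R)
  (domOmega : domain Omega) (reinOmega : reinhardt Omega)
  (fA : Ainfty Omega f)
  (z0 : 'rV[Cplx R]_n) (z0Omega : Omega z0)
  (z0_neq0 : forall j : 'I_n, z0 ord0 j != 0)
  (sigma : nat -> 'rV[int]_n) (bij_sigma : bijective sigma) :
  cvg_Ainfty Omega
    (fun (N : nat) (z : 'rV[Cplx R]_n) =>
       \sum_(j < N) laurent_coef f z0 (sigma j) * monomial (sigma j) z)
    f.
Proof.
have [oO conO] := domOmega; have rO := reinhardt_rot_inv reinOmega.
have hf := Ainfty_hol oO fA; have [cf _ _] := hf; have [_ ext] := fA.
(* The coefficient is computed at [z0], where the monomial is invertible; Euler's equations carry
   the identity to every point of the domain. *)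
have termE a z : Omega z ->
    fprojs (enum 'I_n) a f z = laurent_coef f z0 a * monomial a z.
  move=> Oz; rewrite (laurent_coefE rO a cf z0Omega).
  have euler j w : Omega w -> w ord0 j * partial j (fprojs (enum 'I_n) a f) w =
      (a ord0 j)%:~R * fprojs (enum 'I_n) a f w.
    exact: (fprojs_euler oO rO a hf (enum_uniq _) (mem_enum _ j)).
  have h := euler_connected oO (fprojs_hol oO rO (enum 'I_n) a hf) euler conO z0Omega z0_neq0 Oz.
  by rewrite mulrAC -h mulfK // monomial_neq0.
have sumE N : eqon Omega (psum f sigma N)
    (fun z => \sum_(j < N) laurent_coef f z0 (sigma j) * monomial (sigma j) z).
  by move=> z Oz; apply: eq_bigr => j _; exact: termE.
have pA N : Ainfty Omega (psum f sigma N) by exact: psum_Ainfty.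
split; [by move=> N; exact: Ainfty_eqon (pA N) (sumE N)|exact: fA|].
move=> K cK Kcl b; apply: cvg_uniform_rc => eps eps0.
have [N0 hN0] := psum_uniform oO rO hf ext bij_sigma b cK Kcl eps0.
exists N0 => N N0N z Kz; have := hN0 N N0N z Kz.
by rewrite (closure_ext_eqon oO b (pA N) (sumE N) (Kcl z Kz)).
Qed.
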